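(* Let $B_1=\{z\in\mathbb{R}^2:|z|<1\}$. There exists a sequence $\{\mathbf{w}_k\}$ of $D$-solutions to the stationary Navier--Stokes equations $$-\Delta\mathbf{w}_k+(\mathbf{w}_k\cdot\nabla)\mathbf{w}_k+\nabla p_k=\mathbf{0},\qquad \nabla\cdot\mathbf{w}_k=0\qquad\text{in } B_1,$$ with vorticities $\omega_k$ (not identically zero), such that $$\frac{\bigl|\overline{\mathbf{w}}_k(1)-\overline{\mathbf{w}}_k(0)\bigr|}{\|\omega_k\|_{L^2(B_1)}}=\frac{1}{2\pi}\left|\int_{B_1}\frac{\omega_k\,z^\bot}{|z|^2}\right|\Big/\|\omega_k\|_{L^2(B_1)}\to\infty\qquad\text{as } k\to\infty .$$
   Context: A $D$-solution in a plane domain $\Omega$ is a (necessarily smooth) real vector field $\mathbf{w}=(w_1,w_2)$ solving the stationary Navier--Stokes equations in $\Omega$ with some pressure $p:\Omega\to\mathbb{R}$ and having finite Dirichlet integral $\int_\Omega|\nabla\mathbf{w}|^2<\infty$. The vorticity of $\mathbf{w}$ is $\omega=\partial_y w_1-\partial_x w_2$. For $z=(x,y)$, $z^\bot=(-y,x)$. For $r>0$, $\overline{\mathbf{w}}(r)=\frac{1}{2\pi r}\int_{|z|=r}\mathbf{w}\,ds$ is the mean value over the circle of radius $r$ centered at the origin (for $r=1$ in the sense of traces), and $\overline{\mathbf{w}}(0)=\mathbf{w}(0)$. *)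

(* Defs.v *)
(* MathComp-Analysis; the plane is R * R, with R : realType.  The norm that the
   library puts on R * R is the sup norm, which induces the same topology; the
   Euclidean norm is [enorm]. *)
From HB Require Import structures.
From mathcomp Require Import all_boot all_order all_algebra.
From mathcomp Require Import all_classical all_reals all_analysis.
Set Implicit Arguments.
Unset Strict Implicit.
Unset Printing Implicit Defensive.
Import Order.TTheory GRing.Theory Num.Theory numFieldNormedType.Exports.
Local Open Scope classical_set_scope.
Local Open Scope ring_scope.

Section Plane.
Variable R : realType.

Definition enorm (z : R * R) : R := Num.sqrt (z.1 ^+ 2 + z.2 ^+ 2).

Definition perp (z : R * R) : R * R := (- z.2, z.1).

Definition unit_disc : set (R * R) := [set z | enorm z < 1].

Definition closed_unit_disc : set (R * R) := [set z | enorm z <= 1].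

Definition leb2 : {measure set (measurableTypeR R * measurableTypeR R) -> \bar R} :=
  (@lebesgue_measure R \x @lebesgue_measure R)%E.

Definition dx (f : R * R -> R) (z : R * R) : R := 'D_((1, 0) : R * R) f z.

Definition dy (f : R * R -> R) (z : R * R) : R := 'D_((0, 1) : R * R) f z.

(* Meaningful for open U. *)
Fixpoint Ck (k : nat) (U : set (R * R)) (f : R * R -> R) : Prop :=
  (forall z, U z -> {for z, continuous f}) /\
  if k is k'.+1 then
    [/\ forall z, U z -> derivable f z ((1, 0) : R * R)
                         /\ derivable f z ((0, 1) : R * R),
        Ck k' U (dx f) & Ck k' U (dy f)]
  else True.

Definition smooth (U : set (R * R)) (f : R * R -> R) : Prop :=
  forall k, Ck k U f.

Definition laplacian (f : R * R -> R) (z : R * R) : R :=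
  dx (dx f) z + dy (dy f) z.

Definition fld1 (w : R * R -> R * R) (z : R * R) : R := (w z).1.

Definition fld2 (w : R * R -> R * R) (z : R * R) : R := (w z).2.

(* The sign is opposite to that of the usual curl. *)
Definition vorticity (w : R * R -> R * R) (z : R * R) : R :=
  dy (fld1 w) z - dx (fld2 w) z.

Definition divergence (w : R * R -> R * R) (z : R * R) : R :=
  dx (fld1 w) z + dy (fld2 w) z.

Definition advect (w : R * R -> R * R) (f : R * R -> R) (z : R * R) : R :=
  fld1 w z * dx f z + fld2 w z * dy f z.

Definition steady_NS (U : set (R * R)) (w : R * R -> R * R) (p : R * R -> R) :
    Prop :=
  forall z, U z ->
    [/\ - laplacian (fld1 w) z + advect w (fld1 w) z + dx p z = 0,
        - laplacian (fld2 w) z + advect w (fld2 w) z + dy p z = 0 &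
        divergence w z = 0].

Definition dirichlet (U : set (R * R)) (w : R * R -> R * R) : \bar R :=
  (\int[leb2]_(z in U)
     (dx (fld1 w) z ^+ 2 + dy (fld1 w) z ^+ 2
      + dx (fld2 w) z ^+ 2 + dy (fld2 w) z ^+ 2)%:E)%E.

(* w is a D-solution in the open set U, with pressure p. *)
Definition D_solution (U : set (R * R)) (w : R * R -> R * R) (p : R * R -> R) :
    Prop :=
  [/\ smooth U (fld1 w) /\ smooth U (fld2 w), smooth U p,
      steady_NS U w p & (dirichlet U w < +oo)%E].

Definition H1_sqnorm (U : set (R * R)) (u : R * R -> R) : \bar R :=
  (\int[leb2]_(z in U) (u z ^+ 2 + dx u z ^+ 2 + dy u z ^+ 2)%:E)%E.

Definition circle_pt (r t : R) : R * R := (r * cos t, r * sin t).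

(* The trace operator is the continuous extension to W^{1,2}(B_1) of the
   restriction map C^oo(closure B_1) -> L^2(boundary of B_1).  Here u is smooth
   inside B_1, its pointwise derivatives are its weak derivatives, and only the
   values of g on the unit circle matter; g is unique almost everywhere there. *)
Definition is_trace (u g : R * R -> R) : Prop :=
  measurable_fun `[0, 2 * pi] (fun t : R => g (circle_pt 1 t)) /\
  exists v : nat -> R * R -> R,
    [/\ forall n, exists U : set (R * R),
          [/\ open U, closed_unit_disc `<=` U & smooth U (v n)],
        (fun n => H1_sqnorm unit_disc (fun z => v n z - u z)) @ \oo --> 0%E &
        (fun n => \int[@lebesgue_measure R]_(t in `[0%R, (2 * pi)%R])
            ((v n (circle_pt 1 t) - g (circle_pt 1 t)) ^+ 2)%:E)%E
          @ \oo --> 0%E].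

Definition is_vtrace (w g : R * R -> R * R) : Prop :=
  is_trace (fld1 w) (fld1 g) /\ is_trace (fld2 w) (fld2 g).

Definition circle_mean (r : R) (u : R * R -> R) : R :=
  (2 * pi * r)^-1 *
  (\int[@lebesgue_measure R]_(t in `[0, 2 * pi]) (u (circle_pt r t) * r)).

(* w lives on the open unit disc and g is its trace on the unit circle. *)
Definition mean_field (w g : R * R -> R * R) (r : R) : R * R :=
  if r == 0 then w (0, 0)
  else if r < 1 then (circle_mean r (fld1 w), circle_mean r (fld2 w))
  else (circle_mean r (fld1 g), circle_mean r (fld2 g)).

Definition L2_norm (U : set (R * R)) (f : R * R -> R) : R :=
  fine ('N[leb2]_(2%:E)[EFin \o (f \_ U)])%E.

Definition vorticity_moment (w : R * R -> R * R) : R * R :=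
  (\int[leb2]_(z in unit_disc)
     (vorticity w z * (perp z).1 / enorm z ^+ 2),
   \int[leb2]_(z in unit_disc)
     (vorticity w z * (perp z).2 / enorm z ^+ 2)).

End Plane.

(* Main.v *)
Require Import Defs.
From HB Require Import structures.
From mathcomp Require Import all_boot all_order all_algebra.
From mathcomp Require Import all_classical all_reals all_analysis.
From mathcomp Require Import measurable_realfun.
From mathcomp Require Import ring lra zify.
Set Implicit Arguments.
Unset Strict Implicit.
Unset Printing Implicit Defensive.
Import Order.TTheory GRing.Theory Num.Theory numFieldNormedType.Exports.
Local Open Scope classical_set_scope.
Local Open Scope ring_scope.

(* With a stream function psi, w = (psi_y, - psi_x), omega = Lap psi, and the
   flow is steady when Lap omega = psi_y omega_x - psi_x omega_y.  Around the
   strain psi = a x y, with a = s^2 large, the linearised equation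
   Lap e = a (x e_x - y e_y) has explicit solutions which are close to
   (x y)^m G(y) on the unit square, where G' = s exp (- (s y)^2 / 2) and
   G(0) = 0, so that G is nearly a multiple of the sign of y.  Combining them
   approximates F(x y) G(y) for F(t) = sum_(j < J) 2^j / (j + 1) (1 - t^2)^(16^j).
   With S the J-th harmonic sum, the integral of F(x y)^2 over the disc is O(S),
   while that of F(x y) G(y) y / |z|^2 is at least c S: the ratio grows like
   the square root of S.  The vorticity eps e + h of an actual flow is
   found by solving for the Taylor coefficients of h degree by degree, with
   |h| <= eta eps for a small absolute constant eta once eps is small enough
   (in terms of a and J); as 1 / |z| is integrable, h does not matter.
   All these flows are analytic beyond the closed disc, hence their own traces,
   and the mean value identity is Green's formula. *)

(** No boundary condition is prescribed, so every solution analytic near the closed disc is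
    admissible; this is why explicit eigenfunctions and Taylor series with freely chosen Cauchy data
    suffice. The square of 1 / |z| just fails to be integrable, so the gain can only be logarithmic
    and has to use all dyadic scales. The strain has velocity (a x, - a y). For large a, transport
    makes the vorticity nearly a function of x y on each side of y = 0, and as y is compressed, a
    jump across y = 0 survives as a viscous layer of width 1 / s. The exponent 16^j gives the j-th
    bump the width 4^-j, the size of x y at distance 2^-j from the origin. With heights 2^j c_j the
    moment is about the sum of c_j and the squared norm about that of (j + 1) c_j^2, where j + 1 is
    the logarithm in the area of the set |x y| <= 4^-j; by Cauchy-Schwarz c_j = 1 / (j + 1) is the
    best choice. The nonlinear step has to face the large first-order term a (x h_x - y h_y): the
    inverse Laplacian is chosen so as to gain a factor N + 1 in degree N even after this
    operator. *)

Section LevelSums.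
Variable R : realType.
Implicit Types F G : nat -> nat -> R.

(** For F the terms of a double power series, this is its homogeneous part of degree N. *)
Definition lev (N : nat) F : R := \sum_(i < N.+1) F i (N - i)%N.

Lemma eq_lev N F G : (forall i j, (i + j)%N = N -> F i j = G i j) ->
  lev N F = lev N G.
Proof.
by move=> H; apply: eq_bigr => i _; apply: H; have := ltn_ord i; lia.
Qed.

Lemma le_lev N F G : (forall i j, (i + j)%N = N -> F i j <= G i j) ->
  lev N F <= lev N G.
Proof.
by move=> H; apply: ler_sum => i _; apply: H; have := ltn_ord i; lia.
Qed.

Lemma lev_ge0 N F : (forall i j, 0 <= F i j) -> 0 <= lev N F.
Proof. by move=> H; apply: sumr_ge0. Qed.

Lemma lev_eq0 N F : (forall i j, (i + j)%N = N -> F i j = 0) -> lev N F = 0.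
Proof.
by move=> H; apply: big1 => i _; apply: H; have := ltn_ord i; lia.
Qed.

Lemma levD N F G : lev N (fun i j => F i j + G i j) = lev N F + lev N G.
Proof. exact: big_split. Qed.

Lemma levZ N k F : lev N (fun i j => k * F i j) = k * lev N F.
Proof. by rewrite /lev mulr_sumr. Qed.

Lemma levB N F G : lev N (fun i j => F i j - G i j) = lev N F - lev N G.
Proof. exact: sumrB. Qed.

Lemma lev_norm N F : `|lev N F| <= lev N (fun i j => `|F i j|).
Proof. exact: ler_norm_sum. Qed.

Lemma lev_sym N F : lev N F = lev N (fun i j => F j i).
Proof.
rewrite /lev (reindex_inj rev_ord_inj) /=; apply: eq_bigr => i _.
by have iN := ltn_ord i; congr F; lia.
Qed.

Lemma lev0 F : lev 0 F = F 0%N 0%N.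
Proof. by rewrite /lev big_ord1. Qed.

Lemma lev_shiftl N F : F 0%N N.+2 = 0 -> F 1%N N.+1 = 0 ->
  lev N (fun i j => F i.+2 j) = lev N.+2 F.
Proof.
move=> F0 F1; rewrite /lev [RHS]big_ord_recl [X in _ = _ + X]big_ord_recl /=.
by rewrite /bump /= subn0 subSS subn0 F0 F1 !add0r.
Qed.

Lemma lev_shiftr N F : F N.+2 0%N = 0 -> F N.+1 1%N = 0 ->
  lev N (fun i j => F i j.+2) = lev N.+2 F.
Proof.
move=> F0 F1; rewrite lev_sym (lev_sym N.+2).
exact: (@lev_shiftl _ (fun i j => F j i)).
Qed.

Lemma lev_triangle N F :
  \sum_(n < N.+1) lev n F = \sum_(i < N.+1) \sum_(j < (N - i).+1) F i j.
Proof.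
elim: N => [|N IH]; first by rewrite !big_ord1 lev0.
rewrite big_ord_recr /= IH [RHS]big_ord_recr /= subnn big_ord1.
rewrite /lev [X in _ + X]big_ord_recr /= subnn addrA; congr (_ + _).
rewrite -big_split /=; apply: eq_bigr => i _.
by rewrite (subSn (ltnSE (ltn_ord i))) [RHS]big_ord_recr.
Qed.

Lemma triangleC N F :
  \sum_(i < N.+1) \sum_(j < (N - i).+1) F i j =
  \sum_(j < N.+1) \sum_(i < (N - j).+1) F i j.
Proof.
rewrite -lev_triangle -(lev_triangle N (fun i j => F j i)).
by apply: eq_bigr => n _; exact: lev_sym.
Qed.

(** Compatibility of the grading with products: a sum over four indices of total N, regrouped by the
    degree k + l of the first factor. *)
Lemma lev_convolution N (P : nat -> nat -> nat -> nat -> R) :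
  lev N (fun i j => \sum_(k < i.+1) \sum_(l < j.+1) P k l (i - k)%N (j - l)%N)
  = \sum_(n < N.+1) lev n (fun k l => lev (N - n) (P k l)).
Proof.
pose H i k := \sum_(l < (N - i).+1) P k l (i - k)%N (N - i - l)%N.
transitivity (\sum_(i < N.+1) lev i (fun k m => H (k + m)%N k)).
  apply: eq_bigr => i _; apply: eq_bigr => k _.
  by rewrite /H subnKC // -ltnS.
transitivity (\sum_(n < N.+1) lev n (fun k l => lev (N - (k + l)) (P k l)));
    last first.
  by apply: eq_bigr => n _; apply: eq_lev => k l <-.
(* Written over triangles, the two sides differ only in the order of the sums over l and m, which
   [triangleC] exchanges. *)
rewrite !lev_triangle; apply: eq_bigr => k _.
rewrite /H /lev; under eq_bigr do rewrite subnDA addKn.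
under [RHS]eq_bigr do rewrite subnDA.
rewrite (triangleC _ (fun m l => P k l m (N - k - m - l)%N)).
by apply: eq_bigr => l _; apply: eq_bigr => m _; congr P; lia.
Qed.

End LevelSums.

(** * Formal power series in two variables, and a right inverse of the Laplacian *)

Section Arrays.
Variable R : realType.
(* [c i j] is the coefficient of x^i y^j in a power series. *)
Definition array := nat -> nat -> R.
Implicit Types c d : array.

Definition dX c : array := fun i j => i.+1%:R * c i.+1 j.
Definition dY c : array := fun i j => j.+1%:R * c i j.+1.
Definition lap c : array := fun i j => dX (dX c) i j + dY (dY c) i j.
Definition conv c d : array := fun i j =>
  \sum_(k < i.+1) \sum_(l < j.+1) c k l * d (i - k)%N (j - l)%N.

Definition lnorm N c : R := lev N (fun i j => `|c i j|).

Lemma lnorm_ge0 N c : 0 <= lnorm N c.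
Proof. exact: lev_ge0. Qed.

Lemma lnorm_dX N c : lnorm N (dX c) <= N.+1%:R * lnorm N.+1 c.
Proof.
rewrite /lnorm -levZ [X in _ <= X]/lev big_ord_recl /=.
rewrite -[X in X <= _]add0r lerD ?mulr_ge0 //.
apply: ler_sum => i _; rewrite /bump /= add1n subSS /dX normrM normr_nat.
by rewrite ler_wpM2r // ler_nat.
Qed.

Lemma lnorm_dY N c : lnorm N (dY c) <= N.+1%:R * lnorm N.+1 c.
Proof.
rewrite /lnorm lev_sym (lev_sym N.+1).
exact: (lnorm_dX N (fun i j => c j i)).
Qed.

Lemma lnorm_conv N c d :
  lnorm N (conv c d) <= \sum_(n < N.+1) lnorm n c * lnorm (N - n) d.
Proof.
apply: (@le_trans _ _ (lev N (fun i j => \sum_(k < i.+1) \sum_(l < j.+1)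
    `|c k l| * `|d (i - k)%N (j - l)%N|))).
  apply: le_lev => i j _; apply: le_trans (ler_norm_sum _ _ _) _.
  apply: ler_sum => k _; apply: le_trans (ler_norm_sum _ _ _) _.
  by apply: ler_sum => l _; rewrite normrM.
rewrite (lev_convolution N (fun k l m n => `|c k l| * `|d m n|)).
apply: ler_sum => n _; rewrite /lnorm mulrC -levZ le_eqVlt; apply/orP; left.
by apply/eqP; apply: eq_lev => k l _; rewrite levZ mulrC.
Qed.

(* Right inverse of [lap], solved outwards from the diagonal p = q so that
   the factors (q + 2)(q + 1) / (p + 2)(p + 1) met on the way are at most 1. *)
Fixpoint above (g : array) (p q : nat) {struct p} : R :=
  match p with
  | p'.+2 => if (q <= p')%N then
      (g p' q - (q.+2 * q.+1)%:R * above g p' q.+2) / (p'.+2 * p'.+1)%:R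
    else 0
  | _ => 0
  end.

Fixpoint below (g : array) (p q : nat) {struct q} : R :=
  match q with
  | q'.+2 => if (p < q')%N then
      (g p q' - (p.+2 * p.+1)%:R * below g p.+2 q') / (q'.+2 * q'.+1)%:R
    else 0
  | _ => 0
  end.

Definition ilap (g : array) : array := fun p q => above g p q + below g p q.

Lemma above0 g p q : (p <= q.+1)%N -> above g p q = 0.
Proof. by case: p => [|[|p]] //= pq; case: leqP => //; lia. Qed.

Lemma below0 g p q : (q <= p.+2)%N -> below g p q = 0.
Proof. by case: q => [|[|q]] //= pq; case: ltnP => //; lia. Qed.

(** For j <= i the coefficient equation at (i, j) is the definition of [above] at (i + 2, j),
    otherwise that of [below] at (i, j + 2); the contributions of the other function vanish. *)
Lemma ilapK g : lap (ilap g) = g.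
Proof.
apply/funext => i; apply/funext => j; rewrite /lap /dX /dY /ilap.
rewrite !mulrA -!natrM; case: (leqP j i) => ij.
  rewrite (below0 g (p:=i.+2)) ?(below0 g (p:=i)); [|lia..].
  rewrite !addr0 /= ij [(i.+2 * i.+1)%N]mulnC [(j.+2 * j.+1)%N]mulnC.
  by rewrite mulrC mulfVK ?subrK // pnatr_eq0.
rewrite (above0 g (p:=i.+2)) ?(above0 g (p:=i)); [|lia..].
rewrite !add0r /= ij [(i.+2 * i.+1)%N]mulnC [(j.+2 * j.+1)%N]mulnC.
by rewrite addrC mulrC mulfVK ?subrK // pnatr_eq0.
Qed.

(** The l1 norm of the degree-N coefficients of x c_x - y c_y, the drift term of the linearised
    equation. *)
Definition wnorm N c : R := lev N (fun i j => `|i%:R - j%:R| * `|c i j|).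

Lemma ilap_diag g i : ilap g i i = 0.
Proof. by rewrite /ilap above0 ?below0 ?addr0 //; lia. Qed.

Lemma lnorm_le_wnorm N c : (forall i, c i i = 0) -> lnorm N c <= wnorm N c.
Proof.
move=> c0; apply: le_lev => i j _; case: (eqVneq i j) => [->|ij].
  by rewrite c0 normr0 mulr0.
rewrite ler_peMl //; case: (ltngtP i j) ij => // ij _.
  by rewrite distrC -natrB ?(ltnW ij) // normr_nat ler1n subn_gt0.
by rewrite -natrB ?(ltnW ij) // normr_nat ler1n subn_gt0.
Qed.

(** The defining equation gives (i + 2)(i + 1) |A(i + 2, j)| - (j + 2)(j + 1) |A(i, j + 2)| <= |g(i,
    j)| for j <= i, with A = [above g]. Summed over i + j = N and shifted to degree N + 2, the left
    side gives |A(p, q)| the weight p (p - 1) - q (q - 1) = (p - q)(p + q - 1), and p + q - 1 = N +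
    1. *)
Lemma lev_above N g :
  N.+1%:R * lev N.+2 (fun p q => (p%:R - q%:R) * `|above g p q|) <=
  lev N (fun i j => (j <= i)%:R * `|g i j|).
Proof.
pose al i j := (i.+2 * i.+1)%:R * `|above g i.+2 j|.
pose be i j := (j.+2 * j.+1)%:R * `|above g i j.+2|.
have H : lev N (fun i j => al i j - be i j) <=
         lev N (fun i j => (j <= i)%:R * `|g i j|).
  apply: le_lev => i j _; rewrite /al /be.
  case: (leqP j i) => [ij|ij]; last first.
    by rewrite !above0 ?normr0 ?mulr0 ?subrr ?mul0r //; lia.
  rewrite mul1r [above g i.+2 j]/= ij normrM normfV normr_nat mulrC.
  rewrite mulfVK ?pnatr_eq0 //.
  rewrite lerBlDr (le_trans (ler_normB _ _)) //.
  by rewrite normrM normr_nat.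
apply: le_trans H; rewrite le_eqVlt; apply/orP; left; apply/eqP.
rewrite levB /al /be.
rewrite (@lev_shiftl R N (fun p q => (p * p.-1)%:R * `|above g p q|)); last 2 first.
- by rewrite mul0n mul0r.
- by rewrite muln0 mul0r.
rewrite (@lev_shiftr R N (fun p q => (q * q.-1)%:R * `|above g p q|)); last 2 first.
- by rewrite mul0n mul0r.
- by rewrite muln0 mul0r.
rewrite -levB -levZ; apply: eq_lev => p q pq.
rewrite -mulrBl mulrA; congr (_ * _).
have E n : (n * n.-1)%:R = n%:R * (n%:R - 1) :> R.
  by case: n => [|n]; rewrite ?mul0n ?mul0r //= natrM -natr1 addrK.
rewrite !E; have -> : q%:R = N%:R + 2 - p%:R :> R.
  by rewrite -natrD addn2 -pq natrD addrAC subrr add0r.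
by rewrite -natr1; ring.
Qed.

Lemma lev_below N g :
  N.+1%:R * lev N.+2 (fun p q => (q%:R - p%:R) * `|below g p q|) <=
  lev N (fun i j => (i < j)%:R * `|g i j|).
Proof.
pose al i j := (j.+2 * j.+1)%:R * `|below g i j.+2|.
pose be i j := (i.+2 * i.+1)%:R * `|below g i.+2 j|.
have H : lev N (fun i j => al i j - be i j) <=
         lev N (fun i j => (i < j)%:R * `|g i j|).
  apply: le_lev => i j _; rewrite /al /be.
  case: (ltnP i j) => [ij|ij]; last first.
    by rewrite !below0 ?normr0 ?mulr0 ?subrr ?mul0r //; lia.
  rewrite mul1r [below g i j.+2]/= ij normrM normfV normr_nat mulrC.
  rewrite mulfVK ?pnatr_eq0 //.
  rewrite lerBlDr (le_trans (ler_normB _ _)) //.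
  by rewrite normrM normr_nat.
apply: le_trans H; rewrite le_eqVlt; apply/orP; left; apply/eqP.
rewrite levB /al /be.
rewrite (@lev_shiftr R N (fun p q => (q * q.-1)%:R * `|below g p q|)); last 2 first.
- by rewrite mul0n mul0r.
- by rewrite muln0 mul0r.
rewrite (@lev_shiftl R N (fun p q => (p * p.-1)%:R * `|below g p q|)); last 2 first.
- by rewrite mul0n mul0r.
- by rewrite muln0 mul0r.
rewrite -levB -levZ; apply: eq_lev => p q pq.
rewrite -mulrBl mulrA; congr (_ * _).
have E n : (n * n.-1)%:R = n%:R * (n%:R - 1) :> R.
  by case: n => [|n]; rewrite ?mul0n ?mul0r //= natrM -natr1 addrK.
rewrite !E; have -> : q%:R = N%:R + 2 - p%:R :> R.
  by rewrite -natrD addn2 -pq natrD addrAC subrr add0r.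
by rewrite -natr1; ring.
Qed.

(** [above] and [below] have disjoint supports, so the two bounds add up. As the factor N + 1 is
    gained in the weighted norm, the term of size a in the linearised equation becomes harmless in
    high degree. *)
Lemma wnorm_ilap N g : N.+1%:R * wnorm N.+2 (ilap g) <= lnorm N g.
Proof.
have -> : lnorm N g = lev N (fun i j => (j <= i)%:R * `|g i j|) +
                      lev N (fun i j => (i < j)%:R * `|g i j|).
  rewrite -levD; apply: eq_lev => i j _; rewrite -mulrDl ltnNge.
  by case: (j <= i)%N; rewrite /= ?addr0 ?add0r mul1r.
apply: le_trans (lerD (lev_above N g) (lev_below N g)).
rewrite -mulrDr -levD ler_wpM2l //; apply: le_lev => p q _.
rewrite /ilap; case: (leqP q p) => pq.
  rewrite (@below0 _ p q) ?normr0 ?mulr0 ?addr0; last lia.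
  by rewrite ger0_norm // subr_ge0 ler_nat.
rewrite (@above0 _ p q) ?normr0 ?mulr0 ?add0r; last lia.
by rewrite distrC ger0_norm // subr_ge0 ler_nat ltnW.
Qed.

Lemma wnorm_ilap_low N g : (N < 2)%N -> wnorm N (ilap g) = 0.
Proof.
case: N => [|[|//]] _; apply: lev_eq0 => i j ij;
  by rewrite /ilap above0 ?below0 ?addr0 ?normr0 ?mulr0 //; lia.
Qed.

Lemma lnorm_ilap N g : N.+1%:R * lnorm N.+2 (ilap g) <= lnorm N g.
Proof.
apply: le_trans (wnorm_ilap N g); rewrite ler_wpM2l //.
exact/lnorm_le_wnorm/ilap_diag.
Qed.

Lemma lnorm_ilap_low N g : (N < 2)%N -> lnorm N (ilap g) = 0.
Proof.
move=> N2; apply/eqP; rewrite eq_le lnorm_ge0 andbT -(wnorm_ilap_low g N2).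
exact/lnorm_le_wnorm/ilap_diag.
Qed.

End Arrays.

(** * Real series: Cauchy products and polynomial factors *)

Section RealSequences.
Variable R : realType.
Implicit Types a b u v : nat -> R.

Lemma cvg_norm_le u l (B : R) :
  u @ \oo --> l -> (forall n, `|u n| <= B) -> `|l| <= B.
Proof.
move=> ul uB; apply: (closed_cvg (fun x => `|x| <= B)) ul; last exact: nearW.
exact: (closed_comp (f := @Num.norm R R)
  (fun x _ => @norm_continuous _ _ x) (@closed_le R B)).
Qed.

Lemma series_bounded_cvg u v (B : R) : (forall n, `|u n| <= v n) ->
  (forall n, series v n <= B) -> cvgn (series u).
Proof.
move=> uv vB; apply: normed_cvg.
have v0 n : 0 <= v n by apply: le_trans (uv n).
apply: (@series_le_cvg R (fun n => `|u n|) v) => //.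
apply: nondecreasing_is_cvgn; first by apply: nondecreasing_series.
by exists B => _ [n _ <-].
Qed.

Lemma series_norm_le u v n : (forall n, `|u n| <= v n) ->
  `|series u n| <= series v n.
Proof.
move=> uv; rewrite /series /=; apply: le_trans (ler_norm_sum _ _ _) _.
exact: ler_sum.
Qed.

Definition convolution a b n : R := \sum_(k < n.+1) a k * b (n - k)%N.

Lemma series_convolution a b n :
  series (convolution a b) n = \sum_(i < n) \sum_(j < n - i) a i * b j.
Proof.
case: n => [|n]; first by rewrite /series /= big_ord0 big_nil.
have := lev_triangle n (fun i j => a i * b j).
rewrite /series /= big_mkord => ->; apply: eq_bigr => i _.
by rewrite subSn // -ltnS.
Qed.

Lemma seriesM a b n :
  series a n * series b n = \sum_(i < n) \sum_(j < n) a i * b j.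
Proof.
rewrite /series /= !big_mkord big_distrl /=; apply: eq_bigr => i _.
by rewrite big_distrr.
Qed.

Lemma sum_ord_split (f : nat -> R) (m n : nat) : (m <= n)%N ->
  \sum_(j < n) f j = \sum_(j < m) f j + \sum_(m <= j < n) f j.
Proof. by move=> mn; rewrite -!(big_mkord xpredT) (@big_cat_nat _ _ _ m). Qed.

Lemma cvg_half : (fun n => n./2) @ \oo --> \oo.
Proof.
apply/cvgnyPge => A; near=> n.
have : (A.*2 <= n)%N by near: n; exact: nbhs_infty_ge.
move=> ?; lia.
Unshelve. all: by end_near. Qed.

(** For the majorants u and v, the triangle i + j < n lies between the squares of sides n / 2 and n,
    so its sum is squeezed. For a and b, the difference between square and triangle is dominated by
    that of the majorants. *)
Lemma cvg_series_convolution a b u v (B C la lb : R) :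
  (forall n, `|a n| <= u n) -> (forall n, series u n <= B) ->
  (forall n, `|b n| <= v n) -> (forall n, series v n <= C) ->
  series a @ \oo --> la -> series b @ \oo --> lb ->
  series (convolution a b) @ \oo --> la * lb.
Proof.
move=> au uB bv vC ala blb.
have u0 n : 0 <= u n by apply: le_trans (au n).
have v0 n : 0 <= v n by apply: le_trans (bv n).
have cu : series u @ \oo --> limn (series u).
  by apply: (series_bounded_cvg (v := u) (B := B)) => // n; rewrite ger0_norm.
have cv : series v @ \oo --> limn (series v).
  by apply: (series_bounded_cvg (v := v) (B := C)) => // n; rewrite ger0_norm.
have cuv : series u n * series v n @[n --> \oo] -->
    limn (series u) * limn (series v) by exact: cvgM.
have cuv2 : series u n./2 * series v n./2 @[n --> \oo] -->
    limn (series u) * limn (series v).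
  exact: (cvg_comp _ _ cvg_half cuv).
have ct : series (convolution u v) @ \oo -->
    limn (series u) * limn (series v).
  apply: squeeze_cvgr cuv2 cuv; apply: nearW => n.
  rewrite !seriesM series_convolution; apply/andP; split.
    have hn : (n./2 <= n)%N by lia.
    rewrite (sum_ord_split (fun i => \sum_(j < n - i) u i * v j) hn).
    rewrite -[X in X <= _]addr0 lerD ?sumr_ge0 // => [|i _]; last first.
      by apply: sumr_ge0 => j _; rewrite mulr_ge0.
    apply: ler_sum => i _.
    have hi : (n./2 <= n - i)%N by have := ltn_ord i; lia.
    rewrite (sum_ord_split (fun j => u i * v j) hi).
    by rewrite lerDl sumr_ge0 // => j _; rewrite mulr_ge0.
  apply: ler_sum => i _.
  rewrite (sum_ord_split (fun j => u i * v j) (leq_subr i n)).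
  by rewrite lerDl sumr_ge0 // => j _; rewrite mulr_ge0.
have cE : (series u n * series v n - series (convolution u v) n)
    @[n --> \oo] --> (0 : R).
  by rewrite -(subrr (limn (series u) * limn (series v))); exact: cvgB.
have cF : (series a n * series b n - series (convolution a b) n)
    @[n --> \oo] --> (0 : R).
  apply/cvgr0Pnorm_le => e e0; near=> n.
  apply: (@le_trans _ _ `|series u n * series v n
                         - series (convolution u v) n|); last first.
    by near: n; move/cvgr0Pnorm_le : cE => /(_ _ e0).
  rewrite !seriesM !series_convolution -!sumrB.
  apply: le_trans (ler_norm_sum _ _ _) _.
  rewrite [leRHS]ger0_norm; last first.
    apply: sumr_ge0 => i _.
    rewrite (sum_ord_split (fun j => u i * v j) (leq_subr i n)) addrAC subrr.
    by rewrite add0r sumr_ge0 // => j _; rewrite mulr_ge0.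
  apply: ler_sum => i _.
  rewrite (sum_ord_split (fun j => u i * v j) (leq_subr i n)) addrAC subrr.
  rewrite (sum_ord_split (fun j => a i * b j) (leq_subr i n)) addrAC subrr.
  rewrite !add0r; apply: le_trans (ler_norm_sum _ _ _) _.
  by apply: ler_sum => j _; rewrite normrM ler_pM.
have -> : series (convolution a b) = (fun n => series a n * series b n -
    (series a n * series b n - series (convolution a b) n)).
  by apply/funext => n; rewrite opprB addrC subrK.
by rewrite -[la * lb]subr0; apply: cvgB => //; exact: cvgM.
Unshelve. all: by end_near. Qed.

(** One factor n + 1 at a time, through the midpoint m of r and r'. With r' / m = 1 + t, Bernoulli's
    inequality gives 1 + n t <= (r' / m)^n, and n + 1 <= (1 + 1 / t)(1 + n t). *)
Lemma poly_geometric_bound (r r' : R) k : 0 < r -> r < r' ->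
  exists2 K : R, 0 < K & forall n, n.+1%:R ^+ k * r ^+ n <= K * r' ^+ n.
Proof.
elim: k r r' => [|k IH] r r' r0 rr'.
  exists 1 => // n; rewrite expr0 !mul1r lerXn2r ?nnegrE; lra.
have [K1 K10 H1] := IH r ((r + r') / 2) r0 ltac:(lra).
set m := (r + r') / 2 in H1; have m0 : 0 < m by rewrite /m; lra.
have mr' : m < r' by rewrite /m; lra.
pose t := r' / m - 1.
have t0 : 0 < t by rewrite /t subr_gt0 ltr_pdivlMr // mul1r.
have bern n : 1 + n%:R * t <= (r' / m) ^+ n.
  have -> : r' / m = 1 + t by rewrite /t; ring.
  elim: n => [|n IHn]; first by rewrite mul0r addr0 expr0.
  rewrite exprS; apply: (@le_trans _ _ ((1 + t) * (1 + n%:R * t))).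
    rewrite -natr1 mulrDl mul1r mulrDl mul1r.
    have : 0 <= t * (n%:R * t) by rewrite !mulr_ge0 // ltW.
    lra.
  by rewrite ler_wpM2l //; lra.
exists (K1 * (1 + t^-1)).
  by rewrite mulr_gt0 // addr_gt0 // invr_gt0.
move=> n; rewrite exprS -mulrA.
apply: (@le_trans _ _ (n.+1%:R * (K1 * m ^+ n))); first by rewrite ler_wpM2l.
rewrite mulrCA -!mulrA ler_wpM2l ?(ltW K10) //.
have -> : r' ^+ n = (r' / m) ^+ n * m ^+ n by rewrite -exprMn mulfVK ?gt_eqF.
rewrite mulrA ler_wpM2r ?exprn_ge0 ?(ltW m0) //.
apply: (@le_trans _ _ ((1 + t^-1) * (1 + n%:R * t))); last first.
  by rewrite ler_wpM2l // addr_ge0 // invr_ge0 ltW.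
have -> : (1 + t^-1) * (1 + n%:R * t) = 1 + n%:R * t + t^-1 + n%:R.
  by field; rewrite gt_eqF.
rewrite -natr1.
have : 0 <= n%:R * t by rewrite mulr_ge0 // ltW.
have : 0 < t^-1 by rewrite invr_gt0.
lra.
Qed.

End RealSequences.

(** * Evaluation of absolutely convergent series on boxes *)

Section Evaluation.
Variable R : realType.
Implicit Types (c d : array R) (z : R * R) (r : R).

Definition lval c z N : R := lev N (fun i j => c i j * (z.1 ^+ i * z.2 ^+ j)).
Definition ev c z : R := limn (series (lval c z)).
Definition majorant r c N : R := lnorm N c * r ^+ N.
Definition absconv r c := exists B, forall n, series (majorant r c) n <= B.
Definition inbox r z := `|z.1| <= r /\ `|z.2| <= r.
Definition transpose c : array R := fun i j => c j i.

Lemma lval_transpose c z N : lval (transpose c) (z.2, z.1) N = lval c z N.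
Proof. by rewrite /lval lev_sym; apply: eq_lev => i j _; rewrite [_ ^+ j * _]mulrC. Qed.

Lemma ev_transpose c z : ev (transpose c) (z.2, z.1) = ev c z.
Proof. by congr (limn (series _)); apply/funext => N; exact: lval_transpose. Qed.

Lemma lnorm_transpose N c : lnorm N (transpose c) = lnorm N c.
Proof. by rewrite /lnorm lev_sym. Qed.

Lemma absconv_transpose r c : absconv r c -> absconv r (transpose c).
Proof.
move=> [B cB]; exists B => n; rewrite (_ : majorant r (transpose c) = majorant r c) //.
by apply/funext => N; rewrite /majorant lnorm_transpose.
Qed.

Lemma lval_le r c z N : inbox r z -> `|lval c z N| <= majorant r c N.
Proof.
move=> [z1 z2]; apply: le_trans (lev_norm _ _) _.
rewrite /majorant /lnorm mulrC -levZ; apply: le_lev => i j <-.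
rewrite !normrM !normrX exprD mulrC ler_wpM2r //.
by rewrite ler_pM ?exprn_ge0 // lerXn2r ?nnegrE // (le_trans _ z1).
Qed.

Lemma majorant_ge0 r c N : 0 <= r -> 0 <= majorant r c N.
Proof. by move=> r0; rewrite mulr_ge0 ?lnorm_ge0 ?exprn_ge0. Qed.

Lemma ev_cvg r c z : absconv r c -> inbox r z ->
  series (lval c z) @ \oo --> ev c z.
Proof.
move=> [B cB] rz; apply: (series_bounded_cvg (v := majorant r c) (B := B)) => //.
by move=> N; exact: lval_le.
Qed.

Lemma ev_le r c z (B : R) : inbox r z ->
  (forall n, series (majorant r c) n <= B) -> `|ev c z| <= B.
Proof.
move=> rz cB; apply: (@cvg_norm_le _ (series (lval c z))).
  by apply: ev_cvg rz; exists B.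
move=> n; apply: le_trans (cB n); apply: series_norm_le => N.
exact: lval_le.
Qed.

Lemma absconv_le r r' c : 0 <= r -> r <= r' -> absconv r' c -> absconv r c.
Proof.
move=> r0 rr' [B cB]; exists B => n; apply: le_trans (cB n).
apply: ler_sum => N _; rewrite /majorant ler_wpM2l ?lnorm_ge0 //.
by rewrite lerXn2r ?nnegrE ?(le_trans r0 rr').
Qed.

Lemma absconvD r c d : 0 <= r -> absconv r c -> absconv r d -> absconv r (c + d).
Proof.
move=> r0 [B cB] [C dC]; exists (B + C) => n; apply: le_trans (lerD (cB n) (dC n)).
rewrite /series /= -big_split; apply: ler_sum => N _ /=.
rewrite /majorant -mulrDl ler_wpM2r ?exprn_ge0 // /lnorm -levD.
by apply: le_lev => i j _; exact: ler_normD.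
Qed.

Lemma lnormZ k c N : lnorm N (k *: c) = `|k| * lnorm N c.
Proof. by rewrite /lnorm -levZ; apply: eq_lev => i j _; rewrite -normrM. Qed.

Lemma absconvZ r k c : absconv r c -> absconv r (k *: c).
Proof.
move=> [B cB]; exists (`|k| * B) => n.
apply: le_trans (ler_wpM2l (normr_ge0 k) (cB n)).
rewrite /series /= mulr_sumr; apply: ler_sum => N _.
by rewrite /majorant lnormZ mulrA.
Qed.

Lemma absconvB r c d : 0 <= r -> absconv r c -> absconv r d -> absconv r (c - d).
Proof.
move=> r0 cc dd; rewrite -scaleN1r; apply: absconvD => //; exact: absconvZ.
Qed.

Lemma evD r c d z : absconv r c -> absconv r d -> inbox r z ->
  ev (c + d) z = ev c z + ev d z.
Proof.
move=> cc dd rz; apply: cvg_lim => //.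
rewrite (_ : series _ = series (lval c z) + series (lval d z)); last first.
  rewrite -seriesD; congr series; apply/funext => N.
  rewrite -[RHS]/(lval c z N + lval d z N) /lval -levD.
  by apply: eq_lev => i j _; rewrite -mulrDl.
by apply: cvgD; [exact: ev_cvg cc rz | exact: ev_cvg dd rz].
Qed.

Lemma evZ r k c z : absconv r c -> inbox r z -> ev (k *: c) z = k * ev c z.
Proof.
move=> cc rz; apply: cvg_lim => //.
rewrite (_ : series _ = fun n => k * series (lval c z) n); last first.
  rewrite -[RHS]/(k *: series (lval c z)) -seriesZ; congr series.
  apply/funext => N.
  rewrite -[RHS]/(k * lval c z N) /lval -levZ.
  by apply: eq_lev => i j _; rewrite [RHS]mulrA.
by apply: cvgMl_tmp; exact: ev_cvg cc rz.
Qed.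

Lemma evB r c d z : absconv r c -> absconv r d -> inbox r z ->
  ev (c - d) z = ev c z - ev d z.
Proof.
move=> cc dd rz; rewrite -scaleN1r (evD (r := r)) //; last exact: absconvZ.
by rewrite (evZ (r := r)) // mulN1r.
Qed.

Lemma majorant_conv r c d N : 0 <= r ->
  majorant r (conv c d) N <= convolution (majorant r c) (majorant r d) N.
Proof.
move=> r0; rewrite /majorant /convolution.
apply: le_trans (ler_wpM2r (exprn_ge0 _ r0) (lnorm_conv N c d)) _.
rewrite mulr_suml; apply: ler_sum => n _.
by rewrite mulrACA -exprD subnKC // -ltnS.
Qed.

Lemma absconv_conv r c d : 0 <= r -> absconv r c -> absconv r d ->
  absconv r (conv c d).
Proof.
move=> r0 [B cB] [C dC]; exists (B * C) => n.
apply: (@le_trans _ _ (series (convolution (majorant r c) (majorant r d)) n)).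
  by apply: ler_sum => N _; exact: majorant_conv.
have S0 e m : 0 <= series (majorant r e) m.
  by apply: sumr_ge0 => N _; exact: majorant_ge0.
apply: le_trans (ler_pM (S0 c n) (S0 d n) (cB n) (dC n)).
rewrite seriesM series_convolution; apply: ler_sum => i _.
rewrite (sum_ord_split (fun j => majorant r c i * majorant r d j) (leq_subr i n)).
by rewrite lerDl sumr_ge0 // => j _; rewrite mulr_ge0 ?majorant_ge0.
Qed.

Lemma lval_conv c d z : lval (conv c d) z = convolution (lval c z) (lval d z).
Proof.
apply/funext => N; rewrite /lval /convolution.
rewrite -[RHS]/(\sum_(n < N.+1) _).
transitivity (lev N (fun i j => \sum_(k < i.+1) \sum_(l < j.+1)
  (c k l * (z.1 ^+ k * z.2 ^+ l)) *
  (d (i - k)%N (j - l)%N * (z.1 ^+ (i - k) * z.2 ^+ (j - l))))).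
  apply: eq_lev => i j _; rewrite /conv mulr_suml; apply: eq_bigr => k _.
  rewrite mulr_suml; apply: eq_bigr => l _.
  have ki : (k <= i)%N by rewrite -ltnS.
  have lj : (l <= j)%N by rewrite -ltnS.
  have -> : z.1 ^+ i = z.1 ^+ k * z.1 ^+ (i - k) by rewrite -exprD subnKC.
  have -> : z.2 ^+ j = z.2 ^+ l * z.2 ^+ (j - l) by rewrite -exprD subnKC.
  ring.
rewrite (lev_convolution N (fun k l m n => (c k l * (z.1 ^+ k * z.2 ^+ l)) *
  (d m n * (z.1 ^+ m * z.2 ^+ n)))).
apply: eq_bigr => n _; rewrite mulrC -levZ; apply: eq_lev => i j _.
by rewrite levZ mulrC.
Qed.

Lemma ev_conv r c d z : absconv r c -> absconv r d -> inbox r z ->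
  ev (conv c d) z = ev c z * ev d z.
Proof.
move=> cc dd rz; apply: cvg_lim => //; rewrite lval_conv.
have [B cB] := cc; have [C dC] := dd.
apply: (cvg_series_convolution (u := majorant r c) (v := majorant r d)
  (B := B) (C := C)) => //.
- by move=> n; exact: lval_le.
- by move=> n; exact: lval_le.
- exact: ev_cvg cc rz.
- exact: ev_cvg dd rz.
Qed.

Lemma absconv_poly k r r' c : 0 < r -> r < r' -> absconv r' c ->
  exists B, forall n, series (fun N => lnorm N c * (N.+1%:R ^+ k * r ^+ N)) n <= B.
Proof.
move=> r0 rr' [B cB]; have [K K0 HK] := poly_geometric_bound k r0 rr'.
exists (K * B) => n; apply: le_trans (ler_wpM2l (ltW K0) (cB n)).
rewrite /series /= mulr_sumr; apply: ler_sum => N _.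
by rewrite /majorant [leRHS]mulrCA ler_wpM2l ?lnorm_ge0.
Qed.

Lemma absconv_dX r r' c : 0 < r -> r < r' -> absconv r' c -> absconv r (dX c).
Proof.
move=> r0 rr' cc; have [B cB] := absconv_poly 1 r0 rr' cc.
exists (r^-1 * B) => n.
have r1 : 0 <= r^-1 by rewrite invr_ge0 ltW.
apply: le_trans (ler_wpM2l r1 (cB n.+1)).
rewrite /series /= big_nat_recl //= mulrDr mulr_sumr ler_wpDl //.
  by rewrite !mulr_ge0 ?lnorm_ge0 ?exprn_ge0 // ltW.
apply: ler_sum => N _; rewrite /majorant expr1 exprS.
rewrite (_ : r^-1 * _ = N.+2%:R * lnorm N.+1 c * r ^+ N); last first.
  by field; rewrite gt_eqF.
rewrite ler_wpM2r ?exprn_ge0 ?(ltW r0) //.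
apply: le_trans (lnorm_dX N c) _.
by rewrite ler_wpM2r ?lnorm_ge0 // ler_nat.
Qed.

Lemma dY_transpose c : dY c = transpose (dX (transpose c)).
Proof. by []. Qed.

Lemma absconv_dY r r' c : 0 < r -> r < r' -> absconv r' c -> absconv r (dY c).
Proof.
move=> r0 rr' cc; rewrite dY_transpose; apply: absconv_transpose.
by apply: absconv_dX rr' _ => //; exact: absconv_transpose.
Qed.

(** The crude factor i^2 lets the induction close, since i^2 + i <= (i + 1)^2, and r >= 1 lets lower
    powers of r be replaced by r^i. *)
Lemma exprD_quadratic (x h r : R) i : 1 <= r -> `|x| <= r -> `|x + h| <= r ->
  `|(x + h) ^+ i - x ^+ i - h * (i%:R * x ^+ i.-1)| <= h ^+ 2 * (i%:R ^+ 2 * r ^+ i).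
Proof.
move=> r1 xr xhr; have r0 : 0 <= r by lra.
elim: i => [|i IH].
  by rewrite !expr0 !mul0r mulr0 subrr subr0 normr0 expr0n /= mul0r mulr0.
set e := (x + h) ^+ i - _ - _ in IH.
have -> : (x + h) ^+ i.+1 - x ^+ i.+1 - h * (i.+1%:R * x ^+ i.+1.-1) =
    (x + h) * e + h ^+ 2 * (i%:R * x ^+ i.-1).
  rewrite /e; case: i {IH e} => [|i] /=; first by rewrite expr0; ring.
  rewrite -!natr1 !exprS; ring.
apply: le_trans (ler_normD _ _) _.
apply: (@le_trans _ _ (r * (h ^+ 2 * (i%:R ^+ 2 * r ^+ i)) +
    h ^+ 2 * (i%:R * r ^+ i.+1))).
  apply: lerD; first by rewrite normrM ler_pM.
  rewrite normrM ger0_norm ?sqr_ge0 // ler_wpM2l ?sqr_ge0 //.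
  rewrite normrM normr_nat normrX ler_wpM2l //.
  apply: (@le_trans _ _ (r ^+ i.-1)); first by rewrite lerXn2r ?nnegrE.
  by rewrite ler_weXn2l //; lia.
rewrite -natr1 (exprS r i).
have -> : h ^+ 2 * ((i%:R + 1) ^+ 2 * (r * r ^+ i)) =
  r * (h ^+ 2 * (i%:R ^+ 2 * r ^+ i)) + h ^+ 2 * (i%:R * (r * r ^+ i)) +
  h ^+ 2 * ((i%:R + 1) * (r * r ^+ i)) by ring.
by rewrite lerDl (mulr_ge0 (sqr_ge0 h)) // !mulr_ge0 ?addr_ge0 ?exprn_ge0 //.
Qed.

Lemma lval_dX c z N :
  lval (dX c) z N = lev N.+1 (fun i j => c i j * (i%:R * z.1 ^+ i.-1 * z.2 ^+ j)).
Proof.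
rewrite /lval [RHS]/lev big_ord_recl /= !mul0r mulr0 add0r.
apply: eq_bigr => i _; rewrite /dX /bump /= add1n subSS; ring.
Qed.

(** A quadratic remainder uniform on the box yields both the partial derivative and a Lipschitz
    bound. The factor (N + 1)^2 coming from the monomials is absorbed by the larger radius r'. *)
Lemma ev_quadratic r r' c : 1 <= r -> r < r' -> absconv r' c ->
  exists B, forall z h, inbox r z -> `|z.1 + h| <= r ->
    `|ev c (z.1 + h, z.2) - ev c z - h * ev (dX c) z| <= B * h ^+ 2.
Proof.
move=> r1 rr' cc; have r0 : 0 < r by lra.
have [B cB] := absconv_poly 2 r0 rr' cc; exists B => z h rz zh.
have cr : absconv r c by apply: absconv_le cc; lra.
have cX : absconv r (dX c) by apply: absconv_dX cc.
pose u N := lval c (z.1 + h, z.2) N - lval c z N -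
  h * lev N (fun i j => c i j * (i%:R * z.1 ^+ i.-1 * z.2 ^+ j)).
(* The partial sums are shifted by one because degree N of [dX c] comes from degree N + 1 of c. *)
have ucvg : series u n.+1 @[n --> \oo] -->
    ev c (z.1 + h, z.2) - ev c z - h * ev (dX c) z.
  have -> : (fun n => series u n.+1) = (fun n => series (lval c (z.1 + h, z.2)) n.+1 -
      series (lval c z) n.+1 - h * series (lval (dX c) z) n).
    apply/funext => n; rewrite /u /series /= !sumrB -mulr_sumr; congr (_ - _ * _).
    rewrite big_nat_recl //= lev0 mul0r mul0r mulr0 add0r.
    by apply: eq_bigr => N _; rewrite lval_dX.
  have rz' : inbox r (z.1 + h, z.2) by split => //=; exact: rz.2.
  apply: cvgB; last by apply: cvgMl_tmp; exact: ev_cvg cX rz.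
  apply: cvgB; rewrite (cvg_shiftS (series _)).
    exact: ev_cvg cr rz'.
  exact: ev_cvg cr rz.
apply: (cvg_norm_le ucvg) => n.
apply: (@le_trans _ _ (series (fun N => h ^+ 2 *
    (lnorm N c * (N.+1%:R ^+ 2 * r ^+ N))) n.+1)); last first.
  rewrite [leLHS](_ : _ = h ^+ 2 * series (fun N => lnorm N c * (N.+1%:R ^+ 2 * r ^+ N)) n.+1).
    by rewrite mulrC ler_wpM2r ?sqr_ge0.
  by rewrite /series /= mulr_sumr.
apply: series_norm_le => N.
rewrite /u /lval -levZ -!levB; apply: le_trans (lev_norm _ _) _.
rewrite /lnorm [leRHS]mulrCA mulrC -levZ; apply: le_lev => i j ij /=.
have -> : c i j * ((z.1 + h) ^+ i * z.2 ^+ j) - c i j * (z.1 ^+ i * z.2 ^+ j) -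
    h * (c i j * (i%:R * z.1 ^+ i.-1 * z.2 ^+ j)) =
    (((z.1 + h) ^+ i - z.1 ^+ i - h * (i%:R * z.1 ^+ i.-1)) * z.2 ^+ j) * c i j.
  by ring.
rewrite normrM ler_wpM2r // normrM.
have [z1 z2] := rz.
apply: le_trans (ler_pM _ _ (exprD_quadratic i r1 z1 zh) (_ : _ <= r ^+ j)) _ => //.
by rewrite normrX lerXn2r ?nnegrE // ltW.
rewrite -mulrA -(mulrA (i%:R ^+ 2)) -exprD ij ler_wpM2l ?sqr_ge0 //.
rewrite ler_wpM2r ?exprn_ge0 ?(ltW r0) // lerXn2r ?nnegrE // ler_nat; lia.
Qed.

End Evaluation.

(** * Convergent power series are smooth functions *)

Section Smoothness.
Variable R : realType.
Implicit Types (c d : array R) (z v : R * R) (r : R) (f g : R * R -> R).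

Lemma is_derive_quadratic f z v (l B e : R) : 0 < e ->
  (forall h, `|h| < e -> `|f (h *: v + z) - f z - h * l| <= B * h ^+ 2) ->
  is_derive z v f l.
Proof.
move=> e0 fB.
have H : h^-1 *: (f (h *: v + z) - f z) @[h --> 0^'] --> l.
  apply/cvgrPdist_le => eps eps0; near=> h.
  have h0 : h != 0 by near: h; exact: nbhs_dnbhs_neq.
  have he : `|h| < e by near: h; exact: dnbhs0_lt.
  have hB : `|h| < eps / (`|B| + 1).
    by near: h; apply: dnbhs0_lt; rewrite divr_gt0 // ltr_wpDl.
  have -> : l - h^-1 *: (f (h *: v + z) - f z) =
     - (h^-1 * (f (h *: v + z) - f z - h * l)).
    by rewrite /GRing.scale /=; field.
  rewrite normrN normrM normfV ler_pdivrMl ?normr_gt0 //.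
  apply: le_trans (fB h he) _.
  rewrite -(ger0_norm (sqr_ge0 h)) normrX expr2 mulrCA ler_wpM2l //.
  move: hB; rewrite ltr_pdivlMr ?ltr_wpDl // => hB.
  apply: le_trans (ltW hB); rewrite mulrC ler_wpM2l //.
  by have := ler_norm B; lra.
by apply: DeriveDef; [apply/cvg_ex; exists l | exact: cvg_lim].
Unshelve. all: by end_near. Qed.

Definition obox r : set (R * R) := [set z | `|z.1| < r /\ `|z.2| < r].

Lemma near_coord z (e : R) : 0 < e ->
  \forall t \near z, `|z.1 - t.1| < e /\ `|z.2 - t.2| < e.
Proof.
move=> e0; near=> t; split; near: t.
- by apply: (@cvgr_dist_lt _ _ _ (nbhs z) _ fst z.1) => //; exact: cvg_fst.
- by apply: (@cvgr_dist_lt _ _ _ (nbhs z) _ snd z.2) => //; exact: cvg_snd.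
Unshelve. all: by end_near. Qed.

Lemma near_obox r z : obox r z -> \forall t \near z, obox r t.
Proof.
move=> [z1 z2]; pose e := Num.min (r - `|z.1|) (r - `|z.2|).
have e0 : 0 < e by rewrite lt_min !subr_gt0 z1.
near=> t.
have [t1 t2] : `|z.1 - t.1| < e /\ `|z.2 - t.2| < e by near: t; exact: near_coord.
move: t1 t2; rewrite /e !lt_min => /andP[t1 _] /andP[_ t2]; split.
- by have := ler_normB z.1 (z.1 - t.1); rewrite subKr; lra.
- by have := ler_normB z.2 (z.2 - t.2); rewrite subKr; lra.
Unshelve. all: by end_near. Qed.

Lemma open_obox r : open (obox r).
Proof. by rewrite openE => z /near_obox. Qed.

(* The power series with coefficients c is analytic in [obox r]. *)
Definition an r c := forall s, 0 < s -> s < r -> absconv s c.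

(** Passes from the open box to a closed one that contains a neighbourhood of z; s >= 1 is what
    [ev_quadratic] asks for. *)
Lemma obox_inbox r z : 1 < r -> obox r z ->
  exists s, [/\ 1 <= s, s < r & forall t, `|z.1 - t.1| < (r - s) / 2 ->
    `|z.2 - t.2| < (r - s) / 2 -> inbox s t].
Proof.
move=> r1 [z1 z2]; pose m := Num.max 1 (Num.max `|z.1| `|z.2|).
have mr : m < r by rewrite !gt_max r1 z1.
have m1 : 1 <= m by rewrite le_max lexx.
have mz1 : `|z.1| <= m by rewrite !le_max lexx orbT.
have mz2 : `|z.2| <= m by rewrite !le_max lexx !orbT.
exists ((m + r) / 2); split; [lra|lra|] => t t1 t2; split.
- by have := ler_normB z.1 (z.1 - t.1); rewrite subKr; lra.
- by have := ler_normB z.2 (z.2 - t.2); rewrite subKr; lra.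
Qed.

Lemma inbox_center (s e : R) z : 0 < e -> (forall t, `|z.1 - t.1| < e ->
    `|z.2 - t.2| < e -> inbox s t) -> inbox s z.
Proof. by move=> e0; apply; rewrite subrr normr0. Qed.

Lemma an_between r s c : 1 < r -> 1 <= s -> s < r -> an r c ->
  exists2 s', s < s' & absconv s' c.
Proof. by move=> r1 s1 sr cr; exists ((s + r) / 2); [lra|apply: cr; lra]. Qed.

Lemma is_derive_evX r c z : 1 < r -> an r c -> obox r z ->
  is_derive z ((1, 0) : R * R) (ev c) (ev (dX c) z).
Proof.
move=> r1 cr rz; have [s [s1 sr ins]] := obox_inbox r1 rz.
have [s' ss' cs'] := an_between r1 s1 sr cr.
have [B HB] := ev_quadratic s1 ss' cs'.
have e0 : 0 < (r - s) / 2 by lra.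
have sz := inbox_center e0 ins.
apply: (@is_derive_quadratic _ _ _ _ B _ e0) => h he.
have -> : h *: ((1, 0) : R * R) + z = (z.1 + h, z.2).
  case: z {rz ins sz} => x y.
  by rewrite -[LHS]/(h * 1 + x, h * 0 + y) mulr1 mulr0 add0r addrC.
apply: HB => //.
have [] // := ins (z.1 + h, z.2) => /=.
  by rewrite opprD addNKr normrN.
by rewrite subrr normr0.
Qed.

Lemma is_derive_evY r c z : 1 < r -> an r c -> obox r z ->
  is_derive z ((0, 1) : R * R) (ev c) (ev (dY c) z).
Proof.
move=> r1 cr rz; have [s [s1 sr ins]] := obox_inbox r1 rz.
have [s' ss' cs'] := an_between r1 s1 sr cr.
have [B HB] := ev_quadratic s1 ss' (absconv_transpose cs').
have e0 : 0 < (r - s) / 2 by lra.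
have sz := inbox_center e0 ins.
apply: (@is_derive_quadratic _ _ _ _ B _ e0) => h he.
have -> : h *: ((0, 1) : R * R) + z = (z.1, z.2 + h).
  case: z {rz ins sz} => x y.
  by rewrite -[LHS]/(h * 0 + x, h * 1 + y) mulr1 mulr0 add0r addrC.
rewrite -(ev_transpose c (_, _)) -(ev_transpose c z) -(ev_transpose (dY c) z) /=.
apply: (HB (z.2, z.1)) => /=.
  by case: sz => ? ?; split.
have [] // := ins (z.1, z.2 + h) => /=.
  by rewrite subrr normr0.
by rewrite opprD addNKr normrN.
Qed.

Lemma ev_lipschitzX s r c : 1 <= s -> s < r -> an r c ->
  exists C, 0 <= C /\ forall z h, inbox s z -> `|z.1 + h| <= s ->
    `|ev c (z.1 + h, z.2) - ev c z| <= C * `|h|.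
Proof.
move=> s1 sr cr; have r1 : 1 < r by lra.
have [s' ss' cs'] := an_between r1 s1 sr cr.
have [B HB] := ev_quadratic s1 ss' cs'.
have [D cD] : absconv s (dX c) by apply: absconv_dX cs' => //; lra.
have D0 : 0 <= D by have := cD 0%N; rewrite /series /= big_nil.
exists (`|B| * (2 * s) + D); split; first by rewrite addr_ge0 ?mulr_ge0 //; lra.
move=> z h sz zh; have := HB z h sz zh => H.
have dz := ev_le sz cD.
have h2 : `|h| <= 2 * s.
  by have := ler_normB (z.1 + h) z.1; rewrite addrAC subrr add0r; case: sz; lra.
rewrite -[X in `|X|](subrK (h * ev (dX c) z)).
apply: le_trans (ler_normD _ _) _; rewrite mulrDl; apply: lerD.
  apply: le_trans H _; rewrite -(ger0_norm (sqr_ge0 h)) normrX expr2 mulrA.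
  rewrite ler_wpM2r //; apply: (@le_trans _ _ (`|B| * `|h|)).
    by rewrite ler_wpM2r // ler_norm.
  by rewrite ler_wpM2l.
by rewrite normrM mulrC ler_wpM2r.
Qed.

Lemma an_transpose r c : an r c -> an r (transpose c).
Proof. by move=> cr s s0 sr; apply: absconv_transpose; exact: cr. Qed.

(** Moves along one coordinate at a time, through the corner (t.1, z.2), which stays in the box. *)
Lemma ev_lipschitz s r c : 1 <= s -> s < r -> an r c ->
  exists C, 0 <= C /\ forall z t, inbox s z -> inbox s t ->
    `|ev c z - ev c t| <= C * (`|z.1 - t.1| + `|z.2 - t.2|).
Proof.
move=> s1 sr cr; have [C [C0 HC]] := ev_lipschitzX s1 sr cr.
have [D [D0 HD]] := ev_lipschitzX s1 sr (an_transpose cr).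
exists (C + D); split; first by rewrite addr_ge0.
move=> [x y] [x' y'] [/= xs ys] [/= xs' ys'].
have H1 := HC (x', y) (x - x').
rewrite /= addrC subrK in H1; have {}H1 := H1 (conj xs' ys) xs.
have H2 := HD (y', x') (y - y').
rewrite /= addrC subrK in H2; have {}H2 := H2 (conj ys' xs') ys.
rewrite (ev_transpose c (x', y)) (ev_transpose c (x', y')) in H2.
rewrite -(subrK (ev c (x', y)) (ev c (x, y))) -addrA.
apply: le_trans (ler_normD _ _) _.
have := normr_ge0 (x - x'); have := normr_ge0 (y - y'); nra.
Qed.

Lemma continuous_ev r c z : 1 < r -> an r c -> obox r z ->
  {for z, continuous (ev c)}.
Proof.
move=> r1 cr rz; have [s [s1 sr ins]] := obox_inbox r1 rz.
have [C [C0 HC]] := ev_lipschitz s1 sr cr.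
have e0 : 0 < (r - s) / 2 by lra.
have sz := inbox_center e0 ins.
apply/cvgrPdist_lt => e e1; near=> t.
have [t1 t2] : `|z.1 - t.1| < (r - s) / 2 /\ `|z.2 - t.2| < (r - s) / 2.
  by near: t; exact: near_coord.
have [t3 t4] : `|z.1 - t.1| < e / (2 * (C + 1)) /\ `|z.2 - t.2| < e / (2 * (C + 1)).
  by near: t; apply: near_coord; rewrite divr_gt0 //; lra.
apply: le_lt_trans (HC z t sz (ins t t1 t2)) _.
move: t3 t4; rewrite !ltr_pdivlMr ?mulr_gt0; [|lra..].
have := normr_ge0 (z.1 - t.1); have := normr_ge0 (z.2 - t.2); nra.
Unshelve. all: by end_near. Qed.

Lemma an_dX r c : an r c -> an r (dX c).
Proof.
move=> cr s s0 sr; apply: (@absconv_dX _ s ((s + r) / 2)) => //; first lra.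
by apply: cr; lra.
Qed.

Lemma an_dY r c : an r c -> an r (dY c).
Proof.
move=> cr s s0 sr; apply: (@absconv_dY _ s ((s + r) / 2)) => //; first lra.
by apply: cr; lra.
Qed.

Lemma an_conv r c d : an r c -> an r d -> an r (conv c d).
Proof. by move=> cr dr s s0 sr; apply: absconv_conv; [exact: ltW|exact: cr|exact: dr]. Qed.

Lemma anD r c d : an r c -> an r d -> an r (c + d).
Proof. by move=> cr dr s s0 sr; apply: absconvD; [exact: ltW|exact: cr|exact: dr]. Qed.

Lemma anB r c d : an r c -> an r d -> an r (c - d).
Proof. by move=> cr dr s s0 sr; apply: absconvB; [exact: ltW|exact: cr|exact: dr]. Qed.

Lemma anZ r k c : an r c -> an r (k *: c).
Proof. by move=> cr s s0 sr; apply: absconvZ; exact: cr. Qed.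

Lemma obox_absconv r c d z : 1 < r -> an r c -> an r d -> obox r z ->
  exists s, [/\ absconv s c, absconv s d & inbox s z].
Proof.
move=> r1 cr dr rz; have [s [s1 sr ins]] := obox_inbox r1 rz.
exists s; split; [apply: cr; lra|apply: dr; lra|].
by apply: inbox_center ins; lra.
Qed.

Lemma evD_an r c d z : 1 < r -> an r c -> an r d -> obox r z ->
  ev (c + d) z = ev c z + ev d z.
Proof.
by move=> r1 cr dr rz; have [s [? ? ?]] := obox_absconv r1 cr dr rz; exact: (evD (r := s)).
Qed.

Lemma evB_an r c d z : 1 < r -> an r c -> an r d -> obox r z ->
  ev (c - d) z = ev c z - ev d z.
Proof.
by move=> r1 cr dr rz; have [s [? ? ?]] := obox_absconv r1 cr dr rz; exact: (evB (r := s)).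
Qed.

Lemma evZ_an r k c z : 1 < r -> an r c -> obox r z -> ev (k *: c) z = k * ev c z.
Proof.
by move=> r1 cr rz; have [s [? ? ?]] := obox_absconv r1 cr cr rz; exact: (evZ (r := s)).
Qed.

Lemma ev_conv_an r c d z : 1 < r -> an r c -> an r d -> obox r z ->
  ev (conv c d) z = ev c z * ev d z.
Proof.
by move=> r1 cr dr rz; have [s [? ? ?]] := obox_absconv r1 cr dr rz; exact: (ev_conv (r := s)).
Qed.

Lemma dx_ev r c z : 1 < r -> an r c -> obox r z -> dx (ev c) z = ev (dX c) z.
Proof. by move=> r1 cr rz; have [_ <-] := is_derive_evX r1 cr rz. Qed.

Lemma dy_ev r c z : 1 < r -> an r c -> obox r z -> dy (ev c) z = ev (dY c) z.
Proof. by move=> r1 cr rz; have [_ <-] := is_derive_evY r1 cr rz. Qed.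

Lemma Ck_eq k (U : set (R * R)) f g : open U -> (forall z, U z -> f z = g z) ->
  Ck k U f -> Ck k U g.
Proof.
move=> oU; elim: k f g => [|k IH] f g fg /=.
  move=> [fc _]; split => // z Uz.
  have nfg : \forall t \near z, f t = g t.
    by apply: filterS (oU z Uz) => t /fg.
  have fz : f t @[t --> z] --> g z by rewrite -fg //; exact: fc.
  exact: (cvg_trans (near_eq_cvg _) fz).
move=> [fc [fd fX fY]].
have nfg z : U z -> \forall t \near z, f t = g t.
  by move=> Uz; apply: filterS (oU z Uz) => t /fg.
split.
  move=> z Uz.
  have fz : f t @[t --> z] --> g z by rewrite -fg //; exact: fc.
  exact: (cvg_trans (near_eq_cvg (nfg z Uz)) fz).
split.
- move=> z Uz; have [f1 f2] := fd z Uz.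
  by split; [apply: near_eq_derivable f1|apply: near_eq_derivable f2];
     exact: nfg.
- apply: IH fX => z Uz; apply: near_eq_derive; exact: nfg.
- apply: IH fY => z Uz; apply: near_eq_derive; exact: nfg.
Qed.

(** The induction runs over all arrays at once, as the partial derivatives are again values of
    arrays analytic in the same box. *)
Lemma smooth_ev r c : 1 < r -> an r c -> smooth (obox r) (ev c).
Proof.
move=> r1 cr k; elim: k c cr => [|k IH] c cr /=.
  by split => // z rz; exact: continuous_ev rz.
split; first by move=> z rz; exact: continuous_ev rz.
split.
- move=> z rz; split.
  + by have [] := is_derive_evX r1 cr rz.
  + by have [] := is_derive_evY r1 cr rz.
- apply: Ck_eq (IH _ (an_dX cr)); first exact: open_obox.
  by move=> z rz; rewrite (dx_ev r1).
- apply: Ck_eq (IH _ (an_dY cr)); first exact: open_obox.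
  by move=> z rz; rewrite (dy_ev r1).
Qed.

Lemma Ck_sub k (U V : set (R * R)) f : U `<=` V -> Ck k V f -> Ck k U f.
Proof.
move=> UV; elim: k f => [|k IH] f /= [fc H].
  by split=> // z /UV; exact: fc.
case: H => fd fX fY; split; first by move=> z /UV; exact: fc.
by split; [move=> z /UV; exact: fd|exact: IH|exact: IH].
Qed.

End Smoothness.

(** * The scalar recursion that majorises the nonlinear correction *)

Section ScalarRecursion.
Variable R : realType.
Implicit Types u E : nat -> R.

Variables (a : R) (M : nat).
Hypotheses (a1 : 1 <= a) (aM : 8 * a <= M%:R).

(* The weight decreases like (8 a)^-N for N < M, where the factor a / (N + 1)
   of the recursion is not small. *)
Definition weight N : R := 2 ^+ N * (8 * a)^-1 ^+ minn N M.

Local Notation tau := (8 * a)^-1.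

Let tau0 : 0 < tau. Proof. by rewrite invr_gt0; move: a1 => ?; lra. Qed.

Let tau1 : tau <= 1. Proof. by rewrite invf_le1; move: a1 => ?; lra. Qed.

Lemma weight_ge0 N : 0 <= weight N.
Proof. by rewrite mulr_ge0 ?exprn_ge0 // ltW. Qed.

Lemma weight_ge N : 2 ^+ N * tau ^+ M <= weight N.
Proof.
rewrite ler_wpM2l ?exprn_ge0 // ler_wiXn2l // ?ltW //.
exact: geq_minr.
Qed.

Lemma weight_le N : weight N <= 2 ^+ N.
Proof. by rewrite ler_piMr ?exprn_ge0 // exprn_ile1 // ltW. Qed.

(** For N >= M the factor 2^2 meets a / (N + 1) <= 1 / 8. For N < M the exponent of 1 / (8 a) grows
    by at least one (by exactly one if N = M - 1), and 4 a / (8 a) = 1 / 2. *)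
Lemma weight_step N : weight N.+2 * (a / N.+1%:R) <= weight N / 2.
Proof.
move: a1 tau0 tau1 => b1 t0 t1; rewrite mulrA ler_pdivrMr // /weight !exprS.
case: (leqP M N) => MN.
  have -> : minn N.+2 M = M by apply/minn_idPr; lia.
  have H : 8 * a <= N.+1%:R by apply: le_trans aM _; rewrite ler_nat; lia.
  have : 0 <= 2 ^+ N * tau ^+ M by rewrite mulr_ge0 ?exprn_ge0 // ltW.
  nra.
have H : tau ^+ minn N.+2 M <= tau * tau ^+ N.
  by rewrite -exprS ler_wiXn2l // ?ltW //; lia.
have ta : tau * a = 8^-1 by field; lra.
have N1 : 1 <= N.+1%:R :> R by rewrite ler1n.
have p1 : 0 <= 2 ^+ N :> R by rewrite exprn_ge0.
have p2 : 0 <= tau ^+ N by rewrite exprn_ge0 // ltW.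
apply: (@le_trans _ _ (2 * (2 * 2 ^+ N) * (tau * tau ^+ N) * a)).
  by rewrite ler_wpM2r ?ler_wpM2l //; lra.
have -> : 2 * (2 * 2 ^+ N) * (tau * tau ^+ N) * a =
  4 * (tau * a) * (2 ^+ N * tau ^+ N) by ring.
rewrite ta; have : 0 <= 2 ^+ N * tau ^+ N by rewrite mulr_ge0.
nra.
Qed.

(** The loss depends on a through M, but not on eps: the smallness of eps will compensate for it in
    the quadratic term. *)
Lemma weight_conv p q : weight (p + q).+2 <= 4 / tau ^+ (2 * M) * (weight p * weight q).
Proof.
apply: le_trans (weight_le _) _.
rewrite mulrAC ler_pdivlMr ?exprn_gt0 // !exprS mulnC exprM expr2 exprD.
have t0 : 0 <= tau ^+ M by rewrite exprn_ge0 // ltW.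
have -> : 2 * (2 * (2 ^+ p * 2 ^+ q)) * (tau ^+ M * tau ^+ M) =
  4 * ((2 ^+ p * tau ^+ M) * (2 ^+ q * tau ^+ M)) by ring.
rewrite ler_wpM2l // ler_pM ?mulr_ge0 ?exprn_ge0 ?(ltW tau0) //; exact: weight_ge.
Qed.

(** A bootstrap on the number of terms: if the weighted partial sum of u is at most eta eps, then
    two degrees later the linear term contributes at most half of eta eps by [weight_step], and the
    quadratic term is O(eps^2). *)
Lemma scalar_recursion E (S eta : R) : 0 < eta -> (forall N, 0 <= E N) ->
  (forall n, series (fun N => E N * weight N) n <= S) ->
  exists2 eps0, 0 < eps0 & forall eps u, 0 < eps -> eps <= eps0 ->
    (forall N, 0 <= u N) -> u 0%N = 0 -> u 1%N = 0 ->
    (forall N, u N.+2 <= a / N.+1%:R * u N +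
       4 * convolution (fun n => eps * E n + u n) (fun n => eps * E n + u n) N) ->
    forall n, series (fun N => u N * weight N) n <= eta * eps.
Proof.
move=> eta0 E0 ES.
have [K K0 wK] : exists2 K, 0 < K &
    forall p q, weight (p + q).+2 <= K * (weight p * weight q).
  exists (4 / tau ^+ (2 * M)); last exact: weight_conv.
  by rewrite divr_gt0 ?exprn_gt0.
have S0 : 0 <= S by have := ES 0%N; rewrite /series /= big_nil.
have SE : 0 < S + eta by rewrite ltr_wpDl.
have D0 : 0 < 8 * K * (S + eta) ^+ 2 by rewrite !mulr_gt0.
(* This makes the quadratic contribution 4 K (eps (S + eta))^2 at most eta eps / 2. *)
exists (eta / (8 * K * (S + eta) ^+ 2)); first exact: divr_gt0.
move=> eps u eps0; rewrite ler_pdivlMr // => epsK u0 u_0 u_1 urec.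
pose m n := eps * E n + u n.
have m0 n : 0 <= m n by rewrite addr_ge0 // mulr_ge0 // ltW.
(* Two consecutive bounds are carried because the recursion jumps by two degrees. *)
suff H n : series (fun N => u N * weight N) n <= eta * eps /\
    series (fun N => u N * weight N) n.+1 <= eta * eps by move=> n; case: (H n).
elim: n => [|n [IH1 IH2]].
  rewrite /series /= big_nil big_nat1 u_0 mul0r.
  by have : 0 <= eta * eps by rewrite mulr_ge0 // ltW.
split=> //.
rewrite /series /= big_nat_recl // big_nat_recl //= u_0 u_1 !mul0r !add0r.
have IH : \sum_(0 <= N < n) u N * weight N <= eta * eps := IH1.
have mS : series (fun N => m N * weight N) n <= eps * (S + eta).
  rewrite /series /=; under eq_bigr do rewrite /m mulrDl -mulrA.
  rewrite big_split /= -mulr_sumr mulrDr lerD //; last by rewrite mulrC.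
  by rewrite ler_wpM2l ?(ltW eps0) //; exact: (ES n).
have mS0 : 0 <= series (fun N => m N * weight N) n.
  by apply: sumr_ge0 => N _; rewrite mulr_ge0 // weight_ge0.
have convS : \sum_(0 <= N < n) convolution m m N * weight N.+2 <=
    K * (eps * (S + eta)) ^+ 2.
  apply: (@le_trans _ _ (K * series (convolution (fun N => m N * weight N)
      (fun N => m N * weight N)) n)).
    rewrite /series /= mulr_sumr; apply: ler_sum => N _.
    rewrite /convolution mulr_suml mulr_sumr; apply: ler_sum => k _.
    have kN : (k <= N)%N by rewrite -ltnS.
    have := wK k (N - k)%N; rewrite subnKC // => H.
    rewrite (_ : K * _ = m k * m (N - k)%N * (K * (weight k * weight (N - k)))).
      by rewrite ler_wpM2l // mulr_ge0.
    by ring.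
  rewrite ler_wpM2l ?(ltW K0) //.
  apply: (@le_trans _ _ (series (fun N => m N * weight N) n ^+ 2)); last first.
    by rewrite lerXn2r // nnegrE // mulr_ge0 ?(ltW eps0) // addr_ge0 // ltW.
  rewrite expr2 seriesM series_convolution; apply: ler_sum => i _.
  rewrite (sum_ord_split (fun j => m i * weight i * (m j * weight j)) (leq_subr i n)).
  rewrite lerDl sumr_ge0 // => j _.
  by apply: mulr_ge0; apply: mulr_ge0; rewrite ?m0 ?weight_ge0.
apply: (@le_trans _ _ (eta * eps / 2 + 4 * (K * (eps * (S + eta)) ^+ 2))).
  apply: (@le_trans _ _ (\sum_(0 <= N < n) (u N * weight N / 2 +
      4 * (convolution m m N * weight N.+2)))).
    apply: ler_sum => N _.
    apply: le_trans (ler_wpM2r (weight_ge0 _) (urec N)) _.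
    rewrite mulrDl -(mulrA 4) lerD2r -(mulrA (u N)).
    apply: le_trans (ler_wpM2l (u0 N) (weight_step N)).
    by rewrite le_eqVlt; apply/orP; left; apply/eqP; ring.
  rewrite big_split /= -mulr_suml -mulr_sumr lerD //; last by rewrite ler_wpM2l.
  by rewrite ler_wpM2r // invr_ge0.
have : 8 * K * (eps * (S + eta)) ^+ 2 <= eta * eps.
  have -> : 8 * K * (eps * (S + eta)) ^+ 2 = eps * (8 * K * (S + eta) ^+ 2) * eps.
    by ring.
  by rewrite ler_wpM2r // ltW.
lra.
Qed.

End ScalarRecursion.

(** * The nonlinear correction as a fixed point among formal power series *)

Section NonlinearCorrection.
Variable R : realType.
Implicit Types (c d g h om : array R).

(** The operator x d/dx - y d/dy, diagonal on monomials. *)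
Definition mixed c : array R := fun i j => (i%:R - j%:R) * c i j.

(** The interaction psi_y omega_x - psi_x omega_y of the vorticity with the part psi = [ilap om] of
    the stream function that it generates itself. *)
Definition nonlin om : array R :=
  conv (dY (ilap om)) (dX om) - conv (dX (ilap om)) (dY om).

Definition agree n c d := forall i j, (i + j < n)%N -> c i j = d i j.

Lemma agree_above n g g' : agree n g g' -> agree n.+2 (above g) (above g').
Proof.
move=> gg' i; elim: i {-2}i (leqnn i) => [|m IH] i im j ij.
  by case: i im ij => [|[|i]].
case: i im ij => [|[|i]] //= im ij; case: leqP => // ji.
by rewrite gg' 1?(IH i) //; lia.
Qed.

Lemma agree_below n g g' : agree n g g' -> agree n.+2 (below g) (below g').
Proof.
move=> gg' i j; elim: j {-2}j (leqnn j) i => [|m IH] j jm i ij.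
  by case: j jm ij => [|[|j]].
case: j jm ij => [|[|j]] //= jm ij; case: ltnP => // ji.
by rewrite gg' 1?(IH j) //; lia.
Qed.

Lemma agree_ilap n g g' : agree n g g' -> agree n.+2 (ilap g) (ilap g').
Proof.
move=> gg' i j ij; rewrite /ilap (agree_above gg' ij).
by rewrite (agree_below gg' ij).
Qed.

Lemma ilap_low g i j : (i + j < 2)%N -> ilap g i j = 0.
Proof. by move=> ij; rewrite /ilap above0 ?below0 ?addr0 //; lia. Qed.

(** As c has no constant term, the coefficients of degree n of the product see those of d only below
    degree n. *)
Lemma agree_conv n c c' d d' : agree n.+1 c c' -> agree n d d' -> c 0%N 0%N = 0 ->
  agree n.+1 (conv c d) (conv c' d').
Proof.
move=> cc dd c0 i j ij; apply: eq_bigr => k _; apply: eq_bigr => l _.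
have ki := ltn_ord k; have lj := ltn_ord l.
rewrite cc; last lia.
case: (posnP (k + l)) => kl; last by rewrite dd //; lia.
have -> : nat_of_ord k = 0%N by lia.
have -> : nat_of_ord l = 0%N by lia.
by rewrite -cc // c0 !mul0r.
Qed.

(** Differentiating om costs one degree, which is recovered because the gradient of [ilap om]
    vanishes at the origin. *)
Lemma agree_nonlin n om om' : agree n om om' -> agree n (nonlin om) (nonlin om').
Proof.
case: n => [//|n] oo.
have ii := agree_ilap oo.
move=> i j ij; rewrite /nonlin.
rewrite -[LHS]/(conv (dY (ilap om)) (dX om) i j - conv (dX (ilap om)) (dY om) i j).
rewrite -[RHS]/(conv (dY (ilap om')) (dX om') i j - conv (dX (ilap om')) (dY om') i j).
congr (_ - _); apply: agree_conv ij.
- by move=> k l kl; rewrite /dY ii //; lia.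
- by move=> k l kl; rewrite /dX oo //; lia.
- by rewrite /dY ilap_low ?mulr0.
- by move=> k l kl; rewrite /dX ii //; lia.
- by move=> k l kl; rewrite /dY oo //; lia.
- by rewrite /dX ilap_low ?mulr0.
Qed.

(** A coefficient of [Phi c] depends only on coefficients of c of lower degree, so the iterates
    started at 0 are stationary in each degree: those of degree n from the iterate n + 1 on. *)
Lemma causal_fixpoint (Phi : array R -> array R) :
  (forall n c d, agree n c d -> agree n.+1 (Phi c) (Phi d)) ->
  exists h, Phi h = h.
Proof.
move=> PhiP; pose s n := iter n Phi (fun _ _ => 0).
have s1 n : agree n (s n) (s n.+1) by elim: n => // n IH; exact: PhiP.
have sm n m : (n <= m)%N -> agree n (s m) (s n).
  move=> /subnKC <-; elim: (m - n)%N => [|k IH]; first by rewrite addn0.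
  by move=> i j ij; rewrite addnS -s1 ?IH //; lia.
pose h i j := s (i + j).+1 i j.
have hs n : agree n h (s n).
  by move=> i j ij; rewrite /h -(sm (i + j).+1 n).
exists h; apply/funext => i; apply/funext => j.
rewrite (PhiP _ _ _ (hs (i + j)%N)) //.
Qed.

Lemma lnorm_mixed N c : lnorm N (mixed c) = wnorm N c.
Proof. by apply: eq_lev => i j _; rewrite normrM. Qed.

Lemma lnormD N c d : lnorm N (c + d) <= lnorm N c + lnorm N d.
Proof. by rewrite /lnorm -levD; apply: le_lev => i j _; exact: ler_normD. Qed.

Lemma lnormN N c : lnorm N (- c) = lnorm N c.
Proof. by apply: eq_lev => i j _; rewrite -[(- c) i j]/(- c i j) normrN. Qed.

(** In degree k + 1 the gradient of [ilap om] is bounded by (k + 2) / (k + 1) <= 2 times the norm of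
    om in degree k. The only loss, N + 1, comes from the derivative of om and is what [wnorm_ilap]
    gains back. *)
Lemma lnorm_conv_ilap N (D1 D2 : array R -> array R) om :
  (forall n c, lnorm n (D1 c) <= n.+1%:R * lnorm n.+1 c) ->
  (forall n c, lnorm n (D2 c) <= n.+1%:R * lnorm n.+1 c) ->
  lnorm N (conv (D1 (ilap om)) (D2 om)) <=
  2 * N.+1%:R * convolution (fun n => lnorm n om) (fun n => lnorm n om) N.
Proof.
move=> D1P D2P; apply: le_trans (lnorm_conv _ _ _) _.
(* The first factor has no part of degree 0; the remaining terms match those on the right after a
   shift by one, leaving the last term there to spare. *)
rewrite /convolution big_ord_recl [X in _ <= _ * X]big_ord_recr /=.
rewrite [X in X + _](_ : _ = 0) ?add0r; last first.
  have := D1P 0%N (ilap om); rewrite lnorm_ilap_low // mulr0 => H.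
  have -> : lnorm 0 (D1 (ilap om)) = 0 by apply/eqP; rewrite eq_le H lnorm_ge0.
  by rewrite mul0r.
rewrite mulrDr ler_wpDr //; first by rewrite !mulr_ge0 ?lnorm_ge0.
rewrite mulr_sumr; apply: ler_sum => k _; rewrite /bump /= add1n.
have kN := ltn_ord k.
have H1 : lnorm k.+1 (D1 (ilap om)) <= 2 * lnorm k om.
  apply: le_trans (D1P _ _) _.
  have H := lnorm_ilap k om; have H0 := lnorm_ge0 k.+2 (ilap om).
  rewrite -natr1; apply: le_trans (ler_wpM2l _ H) => //.
  have k1 : 1 <= k.+1%:R :> R by rewrite ler1n.
  nra.
have H2 : lnorm (N - k.+1) (D2 om) <= N.+1%:R * lnorm (N - k) om.
  apply: le_trans (D2P _ _) _; rewrite -subSn // subSS.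
  by rewrite ler_wpM2r ?lnorm_ge0 // ler_nat; lia.
apply: le_trans (ler_pM (lnorm_ge0 _ _) (lnorm_ge0 _ _) H1 H2) _.
by rewrite le_eqVlt; apply/orP; left; apply/eqP; ring.
Qed.

Lemma lnorm_nonlin N om : lnorm N (nonlin om) <=
  4 * N.+1%:R * convolution (fun n => lnorm n om) (fun n => lnorm n om) N.
Proof.
apply: le_trans (lnormD _ _ _) _; rewrite lnormN.
have := lnorm_conv_ilap N om (@lnorm_dY R) (@lnorm_dX R).
have := lnorm_conv_ilap N om (@lnorm_dX R) (@lnorm_dY R).
lra.
Qed.

(** The formal solution h exists for every eps; only its convergence, at radius 2, requires eps to
    be small. The recursion is run on [wnorm], in which the linear term a (x h_x - y h_y) is
    measured without loss. *)
Lemma nonlinear_correction (a eta : R) (e : array R) :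
  1 <= a -> 0 < eta -> absconv 2 e ->
  exists2 eps0, 0 < eps0 & forall eps, 0 < eps -> eps <= eps0 ->
  exists h, [/\ ilap (a *: mixed h + nonlin (eps *: e + h)) = h, absconv 2 h &
    forall z, inbox 1 z -> `|ev h z| <= eta * eps].
Proof.
move=> a1 eta0 [S eS].
pose M := Num.bound (8 * a).
have aM : 8 * a <= M%:R by apply/ltW/archi_boundP; lra.
have eS' n : series (fun N => lnorm N e * weight a M N) n <= S.
  apply: le_trans (eS n); apply: ler_sum => N _.
  by rewrite ler_wpM2l ?lnorm_ge0 //; exact: weight_le.
(* The weight is at least t 2^N, so the recursion is applied with eta t in order to obtain eta eps
   for the unweighted series at radius 2. *)
pose t := (8 * a)^-1 ^+ M.
have t0 : 0 < t by rewrite exprn_gt0 // invr_gt0; lra.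
have [eps0 eps00 H] := scalar_recursion a1 aM (mulr_gt0 eta0 t0)
  (fun N => lnorm_ge0 N e) eS'.
exists eps0 => // eps eps_gt0 epsle.
have [h hP] : exists h, ilap (a *: mixed h + nonlin (eps *: e + h)) = h.
  apply: causal_fixpoint => n c d cd.
  move=> i j ij; apply: agree_ilap (_ : (i + j < n.+2)%N); last lia.
  move=> k l kl.
  rewrite -[LHS]/(a * mixed c k l + nonlin (eps *: e + c) k l).
  rewrite -[RHS]/(a * mixed d k l + nonlin (eps *: e + d) k l).
  rewrite /mixed cd //; congr (_ + _).
  apply: agree_nonlin kl => k' l' kl'.
  rewrite -[LHS]/(eps * e k' l' + c k' l') -[RHS]/(eps * e k' l' + d k' l').
  by rewrite cd.
have hd i : h i i = 0 by rewrite -hP ilap_diag.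
have hw N : lnorm N h <= wnorm N h by exact: lnorm_le_wnorm.
have w0 N : 0 <= wnorm N h by apply: le_trans (lnorm_ge0 N h) (hw N).
have := H eps (fun N => wnorm N h) eps_gt0 epsle w0.
rewrite -{1 2}hP !wnorm_ilap_low // => /(_ erefl erefl) {}H.
have {}H n : series (fun N => wnorm N h * weight a M N) n <= eta * t * eps.
  apply: H => N.
  rewrite -{1}hP; set g := _ + _.
  have gN : lnorm N g <= a * wnorm N h + 4 * N.+1%:R *
      convolution (fun n => eps * lnorm n e + wnorm n h)
                  (fun n => eps * lnorm n e + wnorm n h) N.
    apply: le_trans (lnormD _ _ _) _; apply: lerD.
      by rewrite lnormZ lnorm_mixed ger0_norm //; lra.
    apply: le_trans (lnorm_nonlin _ _) _; rewrite ler_wpM2l //.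
    have om k : lnorm k (eps *: e + h) <= eps * lnorm k e + wnorm k h.
      apply: le_trans (lnormD _ _ _) _.
      by rewrite lnormZ gtr0_norm // lerD.
    by apply: ler_sum => k _; rewrite ler_pM ?lnorm_ge0.
  have N0 : 0 < N.+1%:R :> R by rewrite ltr0n.
  rewrite -(ler_pM2l N0); apply: le_trans (wnorm_ilap N g) _.
  apply: le_trans gN _; rewrite le_eqVlt; apply/orP; left; apply/eqP.
  by field; rewrite gt_eqF.
have wle N : lnorm N h * 2 ^+ N * t <= wnorm N h * weight a M N.
  rewrite -mulrA ler_pM ?lnorm_ge0 //; last exact: weight_ge.
  by apply: mulr_ge0; [exact: exprn_ge0|exact: ltW].
have H2 n : series (majorant 2 h) n <= eta * eps.
  rewrite -(ler_pM2r t0); apply: (@le_trans _ _ (eta * t * eps)); last first.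
    by rewrite mulrAC.
  apply: le_trans (H n); rewrite /series /= mulr_suml; apply: ler_sum => N _.
  exact: wle.
exists h; split => //; first by exists (eta * eps).
move=> z z1; apply: (ev_le z1) => n; apply: le_trans (H2 n).
apply: ler_sum => N _; rewrite ler_wpM2l ?lnorm_ge0 // expr1n.
by rewrite exprn_ege1 // ler1n.
Qed.

End NonlinearCorrection.

(** * Calculus with arrays: multiplication by x and y, product rule, identity principle,
    potentials *)

Section ArrayOperations.
Variable R : realType.
Implicit Types (c d g : array R) (z : R * R) (r : R).

Definition mX c : array R := fun i j => if i is i'.+1 then c i' j else 0.
Definition mY c : array R := fun i j => if j is j'.+1 then c i j' else 0.
Definition unit_array : array R := fun i j => ((i == 0%N) && (j == 0%N))%:R.

Lemma lnorm_mX N c : lnorm N.+1 (mX c) = lnorm N c.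
Proof.
rewrite /lnorm {1}/lev big_ord_recl /= normr0 add0r; apply: eq_bigr => i _.
by rewrite /bump /= add1n subSS.
Qed.

Lemma lnorm0_mX c : lnorm 0 (mX c) = 0.
Proof. by rewrite /lnorm lev0 normr0. Qed.

Lemma absconv_mX r c : 0 <= r -> absconv r c -> absconv r (mX c).
Proof.
move=> r0 [B cB]; exists (r * B) => n.
have B0 : 0 <= B by have := cB 0%N; rewrite /series /= big_nil.
case: n => [|n]; first by rewrite /series /= big_nil mulr_ge0.
rewrite /series /= big_nat_recl //= /majorant lnorm0_mX mul0r add0r.
apply: le_trans (ler_wpM2l r0 (cB n)); rewrite /series /= mulr_sumr.
by apply: ler_sum => N _; rewrite lnorm_mX exprS mulrCA.
Qed.

Lemma lval_mX c z N : lval (mX c) z N.+1 = z.1 * lval c z N.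
Proof.
rewrite /lval [LHS]/lev big_ord_recl /= mul0r add0r mulr_sumr.
by apply: eq_bigr => i _; rewrite /bump /= add1n subSS exprS; ring.
Qed.

Lemma ev_mX r c z : absconv r c -> inbox r z -> ev (mX c) z = z.1 * ev c z.
Proof.
move=> cr rz; apply: cvg_lim => //; rewrite -cvg_shiftS /=.
rewrite (_ : (fun n => series _ n.+1) = fun n => z.1 * series (lval c z) n).
  by apply: cvgMl_tmp; exact: ev_cvg cr rz.
apply/funext => n; rewrite /series /= big_nat_recl //= mulr_sumr.
rewrite [X in X + _](_ : _ = 0) ?add0r; last by rewrite /lval lev0 /= mul0r.
by apply: eq_bigr => N _; rewrite lval_mX.
Qed.

Lemma mY_transpose c : mY c = transpose (mX (transpose c)).
Proof. by []. Qed.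

Lemma absconv_mY r c : 0 <= r -> absconv r c -> absconv r (mY c).
Proof.
move=> r0 cr; rewrite mY_transpose; apply: absconv_transpose.
by apply: absconv_mX => //; exact: absconv_transpose.
Qed.

Lemma ev_mY r c z : absconv r c -> inbox r z -> ev (mY c) z = z.2 * ev c z.
Proof.
move=> cr [z1 z2]; rewrite -ev_transpose -(ev_transpose c).
by rewrite (ev_mX (r := r)) //; exact: absconv_transpose.
Qed.

Lemma an_mX r c : an r c -> an r (mX c).
Proof. by move=> cr s s0 sr; apply: absconv_mX; [exact: ltW|exact: cr]. Qed.

Lemma an_mY r c : an r c -> an r (mY c).
Proof. by move=> cr s s0 sr; apply: absconv_mY; [exact: ltW|exact: cr]. Qed.

Lemma ev_mX_an r c z : 1 < r -> an r c -> obox r z -> ev (mX c) z = z.1 * ev c z.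
Proof.
by move=> r1 cr rz; have [s [? ? ?]] := obox_absconv r1 cr cr rz; exact: (ev_mX (r := s)).
Qed.

Lemma ev_mY_an r c z : 1 < r -> an r c -> obox r z -> ev (mY c) z = z.2 * ev c z.
Proof.
by move=> r1 cr rz; have [s [? ? ?]] := obox_absconv r1 cr cr rz; exact: (ev_mY (r := s)).
Qed.

Lemma lval_unit_array z : lval unit_array z = fun N => (N == 0%N)%:R.
Proof.
apply/funext => -[|N]; first by rewrite /lval lev0 /= !expr0 !mul1r.
apply: lev_eq0 => i j ij; rewrite /unit_array (_ : _ && _ = false) ?mul0r //.
by apply/negbTE/negP => /andP[/eqP i0 /eqP j0]; move: ij; rewrite i0 j0.
Qed.

Lemma series_delta0 n : series (fun N => (N == 0%N)%:R : R) n.+1 = 1.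
Proof. by rewrite /series /= big_nat_recl //= big1 ?addr0. Qed.

Lemma ev_unit_array z : ev unit_array z = 1.
Proof.
apply: cvg_lim => //; rewrite lval_unit_array -cvg_shiftS.
rewrite (_ : [sequence _]_n = fun=> 1); first exact: cvg_cst.
by apply/funext => n; exact: series_delta0.
Qed.

Lemma an_unit_array r : an r unit_array.
Proof.
move=> s s0 _; exists 1 => -[|n]; first by rewrite /series /= big_nil.
rewrite -(series_delta0 n); apply: ler_sum => -[|N] _.
  by rewrite /majorant /lnorm lev0 expr0 mulr1 /unit_array /= normr1.
rewrite /majorant (_ : lnorm N.+1 unit_array = 0) ?mul0r //.
apply: lev_eq0 => i j ij; rewrite /unit_array (_ : _ && _ = false) ?normr0 //.
by apply/negbTE/negP => /andP[/eqP i0 /eqP j0]; move: ij; rewrite i0 j0.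
Qed.

Lemma absconv_ilap r c : 0 <= r -> absconv r c -> absconv r (ilap c).
Proof.
move=> r0 [B cB]; exists (r ^+ 2 * B) => n.
have B0 : 0 <= B by have := cB 0%N; rewrite /series /= big_nil.
have H m : series (majorant r (ilap c)) m.+2 <= r ^+ 2 * B.
  rewrite /series /= !big_nat_recl //= /majorant !lnorm_ilap_low // !mul0r !add0r.
  apply: le_trans (ler_wpM2l (sqr_ge0 r) (cB m)); rewrite /series /= mulr_sumr.
  apply: ler_sum => N _; rewrite /majorant -add2n exprD mulrCA.
  rewrite ler_wpM2l ?sqr_ge0 // ler_wpM2r ?exprn_ge0 //.
  apply: le_trans (lnorm_ilap N c); rewrite ler_peMl ?lnorm_ge0 //.
  by rewrite ler1n.
apply: le_trans (H n); rewrite /series /= big_nat_recr //= big_nat_recr //=.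
by rewrite -addrA lerDl addr_ge0 ?majorant_ge0.
Qed.

Lemma an_ilap r c : an r c -> an r (ilap c).
Proof. by move=> cr s s0 sr; apply: absconv_ilap; [exact: ltW|exact: cr]. Qed.

Lemma dX_conv c d : dX (conv c d) = conv (dX c) d + conv c (dX d).
Proof.
apply/funext => i; apply/funext => j.
rewrite -[RHS]/(conv (dX c) d i j + conv c (dX d) i j) /dX /conv.
pose S f := \sum_(k < i.+2) \sum_(l < j.+1)
  f (nat_of_ord k) * (c k l * d (i.+1 - k)%N (j - l)%N).
(* The factor i + 1 of the derivative is split as k + (i + 1 - k), one summand for each factor of
   the product. *)
transitivity (S (fun k => k%:R) + S (fun k => (i.+1 - k)%:R)).
  rewrite /S -big_split /= mulr_sumr; apply: eq_bigr => k _.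
  rewrite -big_split /= mulr_sumr; apply: eq_bigr => l _.
  by rewrite -mulrDl -natrD subnKC // -ltnS.
congr (_ + _); rewrite /S.
- rewrite big_ord_recl /= big1 ?add0r => [|l _]; last by rewrite mul0r.
  apply: eq_bigr => k _; apply: eq_bigr => l _.
  by rewrite /bump /= add1n subSS mulrA.
- rewrite big_ord_recr /= subnn [X in _ + X]big1 ?addr0 => [|l _]; last by rewrite mul0r.
  apply: eq_bigr => k _; apply: eq_bigr => l _.
  by rewrite subSn -1?ltnS // mulrCA.
Qed.

Lemma conv_transpose c d : transpose (conv c d) = conv (transpose c) (transpose d).
Proof.
apply/funext => i; apply/funext => j; rewrite /transpose /conv exchange_big /=.
by [].
Qed.

Lemma dY_conv c d : dY (conv c d) = conv (dY c) d + conv c (dY d).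
Proof.
rewrite dY_transpose conv_transpose dX_conv.
rewrite -[LHS]/(transpose (conv (dX (transpose c)) (transpose d)) +
  transpose (conv (transpose c) (dX (transpose d)))) !conv_transpose.
by [].
Qed.

Lemma dXD c d : dX (c + d) = dX c + dX d.
Proof. by apply/funext => i; apply/funext => j; rewrite /dX -mulrDr. Qed.

Lemma dYD c d : dY (c + d) = dY c + dY d.
Proof. by apply/funext => i; apply/funext => j; rewrite /dY -mulrDr. Qed.

Lemma dXZ k c : dX (k *: c) = k *: dX c.
Proof. by apply/funext => i; apply/funext => j; rewrite /dX mulrCA. Qed.

Lemma dYZ k c : dY (k *: c) = k *: dY c.
Proof. by apply/funext => i; apply/funext => j; rewrite /dY mulrCA. Qed.

Lemma dXB c d : dX (c - d) = dX c - dX d.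
Proof. by rewrite -scaleN1r dXD dXZ scaleN1r. Qed.

Lemma dYB c d : dY (c - d) = dY c - dY d.
Proof. by rewrite -scaleN1r dYD dYZ scaleN1r. Qed.

Lemma dXdY c : dX (dY c) = dY (dX c).
Proof. by apply/funext => i; apply/funext => j; rewrite /dX /dY mulrCA. Qed.

Lemma lapE c : lap c = dX (dX c) + dY (dY c).
Proof. by []. Qed.

Lemma lapD c d : lap (c + d) = lap c + lap d.
Proof. by rewrite !lapE !dXD !dYD addrACA. Qed.

Lemma lapZ k c : lap (k *: c) = k *: lap c.
Proof. by rewrite !lapE !dXZ !dYZ scalerDr. Qed.

Lemma an_lap r c : an r c -> an r (lap c).
Proof. by move=> cr; rewrite lapE; apply: anD; [do 2 apply: an_dX|do 2 apply: an_dY]. Qed.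

Lemma mixedE c : mixed c = mX (dX c) - mY (dY c).
Proof.
apply/funext => i; apply/funext => j; rewrite /mixed mulrBl.
rewrite -[RHS]/(mX (dX c) i j - mY (dY c) i j) /mX /mY /dX /dY.
by case: i j => [|i] [|j]; rewrite ?mul0r ?subr0 ?sub0r.
Qed.

Lemma obox0 r : 0 < r -> obox r ((0, 0) : R * R).
Proof. by move=> r0; split; rewrite normr0. Qed.

Lemma ev0 c : ev c (0, 0) = c 0%N 0%N.
Proof.
apply: cvg_lim => //; rewrite -cvg_shiftS.
rewrite (_ : [sequence _]_n = fun=> c 0%N 0%N); first exact: cvg_cst.
apply/funext => n; rewrite /series /= big_nat_recl //= [X in _ + X]big1.
  by rewrite addr0 /lval lev0 /= !expr0 !mulr1.
move=> N _; apply: lev_eq0 => -[|i] [|j] //= _;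
  by rewrite !exprS ?mul0r ?mulr0.
Qed.

(** The coefficients are recovered by differentiating at the origin. This turns identities between
    values into identities between arrays. *)
Lemma ev_inj0 r c : 1 < r -> an r c -> (forall z, obox r z -> ev c z = 0) -> c = (fun _ _ => 0).
Proof.
move=> r1 cr c0.
have dx0 (f : R * R -> R) v : (forall z, obox r z -> f z = 0) ->
    forall z, obox r z -> 'D_v f z = 0.
  move=> f0 z rz; rewrite (@near_eq_derive _ _ _ _ (cst 0)) ?derive_cst //.
  by apply: filterS (near_obox rz) => t /f0.
apply/funext => i; apply/funext => j.
elim: i c cr c0 => [|i IHi] c cr c0; last first.
  have := IHi (dX c) (an_dX cr); rewrite /dX => H.
  have {}H : i.+1%:R * c i.+1 j = 0.
    by apply: H => z rz; rewrite -(dx_ev r1 cr rz); exact: dx0 c0 _ rz.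
  by move/eqP : H; rewrite mulf_eq0 pnatr_eq0 => /eqP.
elim: j c cr c0 => [|j IHj] c cr c0.
  by rewrite -ev0 c0 //; apply: obox0; lra.
have := IHj (dY c) (an_dY cr); rewrite /dY => H.
have {}H : j.+1%:R * c 0%N j.+1 = 0.
  by apply: H => z rz; rewrite -(dy_ev r1 cr rz); exact: dx0 c0 _ rz.
by move/eqP : H; rewrite mulf_eq0 pnatr_eq0 => /eqP.
Qed.

(** The potential of the form P1 dx + P2 dy, integrated up the axis x = 0 and then along x, with
    value 0 at the origin. *)
Definition primitive (P1 P2 : array R) : array R := fun i j =>
  if i is i'.+1 then P1 i' j / i%:R
  else if j is j'.+1 then P2 0%N j' / j%:R else 0.

Lemma dX_primitive P1 P2 : dX (primitive P1 P2) = P1.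
Proof.
by apply/funext => i; apply/funext => j; rewrite /dX /= mulrC divfK // pnatr_eq0.
Qed.

Lemma dY_primitive P1 P2 : dY P1 = dX P2 -> dY (primitive P1 P2) = P2.
Proof.
move=> PP; apply/funext => i; apply/funext => j; rewrite /dY.
case: i => [|i] /=; first by rewrite mulrC divfK // pnatr_eq0.
rewrite mulrA -[X in X / _]/(dY P1 i j) PP /dX mulrC mulKf //; exact: lt0r_neq0.
Qed.

Lemma absconv_primitive r P1 P2 : 0 <= r -> absconv r P1 -> absconv r P2 ->
  absconv r (primitive P1 P2).
Proof.
move=> r0 [B PB] [C PC]; exists (r * (B + C)) => n.
have B0 : 0 <= B by have := PB 0%N; rewrite /series /= big_nil.
have C0 : 0 <= C by have := PC 0%N; rewrite /series /= big_nil.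
have div_le (x : R) m : `|x / m.+1%:R| <= `|x|.
  by rewrite normrM normfV normr_nat ler_pdivrMr // ler_peMr // ler1n.
case: n => [|n]; first by rewrite /series /= big_nil mulr_ge0 ?addr_ge0.
rewrite /series /= big_nat_recl //= /majorant {1}/lnorm lev0 /= normr0 mul0r add0r.
apply: (@le_trans _ _ (r * (series (majorant r P1) n + series (majorant r P2) n))).
  rewrite /series /= -big_split /= mulr_sumr; apply: ler_sum => N _.
  rewrite exprS mulrCA ler_wpM2l // /majorant -mulrDl ler_wpM2r ?exprn_ge0 //.
  rewrite {1}/lnorm /lev big_ord_recl /= addrC lerD //.
    by apply: ler_sum => i _; rewrite /bump /= add1n subSS.
  apply: le_trans (div_le _ _) _.
  by rewrite /lnorm /lev big_ord_recl /= subn0 lerDl sumr_ge0.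
by rewrite ler_wpM2l // lerD.
Qed.

Lemma an_primitive r P1 P2 : an r P1 -> an r P2 -> an r (primitive P1 P2).
Proof.
by move=> P1r P2r s s0 sr; apply: absconv_primitive; [exact: ltW|exact: P1r|exact: P2r].
Qed.

End ArrayOperations.

Lemma anN (R : realType) (r : R) (c : array R) : an r c -> an r (- c).
Proof. by move=> cr; rewrite -scaleN1r; exact: anZ. Qed.

Ltac solve_an := lazymatch goal with
  | |- an _ (dX _) => apply: an_dX; solve_an
  | |- an _ (dY _) => apply: an_dY; solve_an
  | |- an _ (conv _ _) => apply: an_conv; solve_an
  | |- an _ (_ + _) => apply: anD; solve_an
  | |- an _ (- _) => apply: anN; solve_an
  | |- an _ _ => assumption
  end.

(** * From the vorticity equation to a velocity and a pressure *)

Section StreamFunction.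
Variable R : realType.
Variables (r : R) (psi : array R).
Hypotheses (r1 : 1 < r) (psir : an r psi).

Let om := lap psi.
Let W1 := dY psi.
Let W2 := - dX psi.

Hypothesis vorticity_equation : forall z, obox r z ->
  ev (lap om) z = ev (dY psi) z * ev (dX om) z - ev (dX psi) z * ev (dY om) z.

Definition stream_field (z : R * R) : R * R := (ev W1 z, ev W2 z).

(** The pressure gradient dictated by the momentum equation, Lap w - (w . grad) w. *)
Let P1 := lap W1 - (conv W1 (dX W1) + conv W2 (dY W1)).
Let P2 := lap W2 - (conv W1 (dX W2) + conv W2 (dY W2)).

Lemma evN_an c z : an r c -> obox r z -> ev (- c) z = - ev c z.
Proof. by move=> cr rz; rewrite -scaleN1r (evZ_an _ r1) // mulN1r. Qed.

Lemma dXN (c : array R) : dX (- c) = - dX c.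
Proof. by rewrite -scaleN1r dXZ scaleN1r. Qed.

Lemma dYN (c : array R) : dY (- c) = - dY c.
Proof. by rewrite -scaleN1r dYZ scaleN1r. Qed.

Let anW1 : an r W1. Proof. exact: an_dY. Qed.
Let anW2 : an r W2. Proof. by apply: anN; exact: an_dX. Qed.
Let anP1 : an r P1.
Proof.
by apply: anB; [exact: an_lap|apply: anD; apply: an_conv => //; [exact: an_dX|exact: an_dY]].
Qed.
Let anP2 : an r P2.
Proof.
by apply: anB; [exact: an_lap|apply: anD; apply: an_conv => //; [exact: an_dX|exact: an_dY]].
Qed.

(** The form P1 dx + P2 dy is closed exactly by the vorticity equation. The identity is checked on
    values, where [ring] applies, and returned to coefficients by [ev_inj0]. *)
Lemma pressure_compatible : dY P1 = dX P2.
Proof.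
apply/eqP; rewrite -subr_eq0; apply/eqP.
apply: (ev_inj0 r1); first by apply: anB; [exact: an_dY|exact: an_dX].
move=> z rz.
rewrite (evB_an r1 _ _ rz); [|exact: an_dY|exact: an_dX].
rewrite /P1 /P2 dYB dXB !dYD !dXD !dY_conv !dX_conv ?lapE ?dXD ?dYD ?dXD ?dYD.
rewrite /W1 /W2 !(dXN, dYN) !dXdY.
have := vorticity_equation rz; rewrite /om ?lapE ?(dXD, dYD) ?dXdY.
rewrite !(evB_an r1 _ _ rz, evD_an r1 _ _ rz, ev_conv_an r1 _ _ rz, evN_an _ rz); try solve_an.
by move/eqP; rewrite -subr_eq0 => /eqP <-; ring.
Qed.

Lemma dx_near (f g : R * R -> R) (z : R * R) :
  (forall t, obox r t -> f t = g t) -> obox r z -> dx f z = dx g z.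
Proof.
by move=> fg rz; apply: near_eq_derive; apply: filterS (near_obox rz) => t /fg.
Qed.

Lemma dy_near (f g : R * R -> R) (z : R * R) :
  (forall t, obox r t -> f t = g t) -> obox r z -> dy f z = dy g z.
Proof.
by move=> fg rz; apply: near_eq_derive; apply: filterS (near_obox rz) => t /fg.
Qed.

Lemma laplacian_ev c z : an r c -> obox r z -> laplacian (ev c) z = ev (lap c) z.
Proof.
move=> cr rz; rewrite /laplacian.
rewrite (dx_near (g := ev (dX c))) // => [|t rt]; last by rewrite (dx_ev r1).
rewrite (dy_near (g := ev (dY c))) // => [|t rt]; last by rewrite (dy_ev r1).
rewrite (dx_ev r1 _ rz) ?(dy_ev r1 _ rz) ?lapE; [|exact: an_dY|exact: an_dX].
by rewrite (evD_an r1 _ _ rz) //; [do 2 apply: an_dX|do 2 apply: an_dY].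
Qed.

Lemma stream_steady_NS : steady_NS (obox r) stream_field (ev (primitive P1 P2)).
Proof.
move=> z rz.
have f1 : fld1 stream_field = ev W1 by [].
have f2 : fld2 stream_field = ev W2 by [].
have ap : an r (primitive P1 P2) by exact: an_primitive.
rewrite /divergence /advect f1 f2 !laplacian_ev // !(dx_ev r1 _ rz) //.
rewrite !(dy_ev r1 _ rz) // dX_primitive dY_primitive; last exact: pressure_compatible.
have X1 : an r (dX W1) by exact: an_dX.
have Y1 : an r (dY W1) by exact: an_dY.
have X2 : an r (dX W2) by exact: an_dX.
have Y2 : an r (dY W2) by exact: an_dY.
have L1 : an r (lap W1) by exact: an_lap.
have L2 : an r (lap W2) by exact: an_lap.
have c11 : an r (conv W1 (dX W1)) by exact: an_conv.
have c21 : an r (conv W2 (dY W1)) by exact: an_conv.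
have c12 : an r (conv W1 (dX W2)) by exact: an_conv.
have c22 : an r (conv W2 (dY W2)) by exact: an_conv.
have s1 : an r (conv W1 (dX W1) + conv W2 (dY W1)) by exact: anD.
have s2 : an r (conv W1 (dX W2) + conv W2 (dY W2)) by exact: anD.
split.
- rewrite (evB_an r1 L1 s1 rz) (evD_an r1 c11 c21 rz).
  rewrite (ev_conv_an r1 anW1 X1 rz) (ev_conv_an r1 anW2 Y1 rz); ring.
- rewrite (evB_an r1 L2 s2 rz) (evD_an r1 c12 c22 rz).
  rewrite (ev_conv_an r1 anW1 X2 rz) (ev_conv_an r1 anW2 Y2 rz); ring.
- have -> : dY W2 = - dX W1 by rewrite /W2 dYN /W1 dXdY.
  by rewrite (evN_an X1 rz) subrr.
Qed.

Lemma stream_vorticity z : obox r z -> vorticity stream_field z = ev om z.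
Proof.
move=> rz; rewrite /vorticity.
rewrite -[fld1 stream_field]/(ev W1) -[fld2 stream_field]/(ev W2).
rewrite (dx_ev r1 anW2 rz) (dy_ev r1 anW1 rz) /W2 dXN /W1.
rewrite (evN_an _ rz); last by do 2 apply: an_dX.
rewrite opprK /om lapE (evD_an r1 _ _ rz) 1?addrC //.
- by do 2 apply: an_dX.
- by do 2 apply: an_dY.
Qed.

Lemma stream_smooth : [/\ smooth (obox r) (fld1 stream_field),
  smooth (obox r) (fld2 stream_field) & smooth (obox r) (ev (primitive P1 P2))].
Proof.
split; [exact: smooth_ev r1 anW1|exact: smooth_ev r1 anW2|].
by apply: smooth_ev r1 _; exact: an_primitive.
Qed.

End StreamFunction.

(** * Slices of functions of two variables, and mean value arguments *)

Section OneVariable.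
Variable R : realType.

Lemma is_derive_slice1 (f : R * R -> R) (x y l : R) :
  is_derive (x, y) ((1, 0) : R * R) f l -> is_derive x 1 (fun t => f (t, y)) l.
Proof.
have E : (fun h : R => h^-1 *: (f (h *: ((1, 0) : R * R) + (x, y)) - f (x, y))) =
    (fun h => h^-1 *: (f (h *: 1 + x, y) - f (x, y))).
  apply/funext => h.
  by rewrite -[_ *: _ + (x, y)]/(h * 1 + x, h * 0 + y) mulr0 add0r.
move=> [d1 d2]; apply: DeriveDef; last first.
  by rewrite -d2 /derive /= E.
by move: d1; rewrite /derivable /= E.
Qed.

Lemma is_derive_slice2 (f : R * R -> R) (x y l : R) :
  is_derive (x, y) ((0, 1) : R * R) f l -> is_derive y 1 (fun t => f (x, t)) l.
Proof.
have E : (fun h : R => h^-1 *: (f (h *: ((0, 1) : R * R) + (x, y)) - f (x, y))) =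
    (fun h => h^-1 *: (f (x, h *: 1 + y) - f (x, y))).
  apply/funext => h.
  by rewrite -[_ *: _ + (x, y)]/(h * 0 + x, h * 1 + y) mulr0 add0r.
move=> [d1 d2]; apply: DeriveDef; last first.
  by rewrite -d2 /derive /= E.
by move: d1; rewrite /derivable /= E.
Qed.

Lemma mvt_ge (f df : R -> R) (m x y : R) : x <= y ->
  (forall t, x <= t <= y -> is_derive t 1 f (df t)) ->
  (forall t, x <= t <= y -> m <= df t) -> m * (y - x) <= f y - f x.
Proof.
move=> xy fd mf.
have [||c cxy ->] := @MVT_segment R f df x y xy.
- by move=> t; rewrite in_itv /= => /andP[/ltW xt /ltW ty]; apply: fd; rewrite xt.
- apply: derivable_within_continuous => t; rewrite in_itv /= => txy.
  by have [] := fd t txy.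
- by move: cxy; rewrite in_itv /= => cxy; rewrite ler_wpM2r ?subr_ge0 // mf.
Qed.

Lemma mvt_eq (f : R -> R) (r x y : R) : `|x| < r -> `|y| < r ->
  (forall t : R, `|t| < r -> is_derive t 1 f 0) -> f x = f y.
Proof.
wlog xy : x y / x <= y => [H xr yr fd|].
  by have [xy|/ltW yx] := leP x y; [exact: H|symmetry; exact: H].
move=> xr yr fd.
have tr t : x <= t <= y -> `|t| < r.
  by move=> /andP[xt ty]; move: xr yr; rewrite !ltr_norml => /andP[? _] /andP[_ ?]; lra.
have [||c _ H] := @MVT_segment R f (fun=> 0) x y xy.
- by move=> t; rewrite in_itv /= => /andP[/ltW xt /ltW ty]; apply/fd/tr; rewrite xt.
- apply: derivable_within_continuous => t; rewrite in_itv /= => txy.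
  by have [] := fd t (tr t txy).
- by move: H; rewrite mul0r => /eqP; rewrite subr_eq0 => /eqP.
Qed.

End OneVariable.

(** * The regularised sign function G of the overview *)

Section LinearSolution.
Variable R : realType.
Variable s : R.
Implicit Types (c : array R) (z : R * R).

(* Taylor coefficients of s exp (- (s y)^2 / 2). *)
Fixpoint gauss_coef (n : nat) : R :=
  match n with
  | n'.+2 => - s ^+ 2 * gauss_coef n' / n'.+2%:R
  | 1%N => 0
  | 0%N => s
  end.

Definition gauss_array : array R := fun i j => if i is 0%N then gauss_coef j else 0.

(** Once n + 2 exceeds (s r)^2, the step from n to n + 2 does not increase the terms, so the sum of
    the finitely many earlier ones is a bound. *)
Lemma gauss_coef_bound (r : R) : 0 <= r -> exists C, forall n, `|gauss_coef n| * r ^+ n <= C.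
Proof.
move=> r0; pose K := Num.bound (s ^+ 2 * r ^+ 2).
have KP : s ^+ 2 * r ^+ 2 <= K%:R.
  by apply/ltW/archi_boundP; rewrite mulr_ge0 ?sqr_ge0.
pose C := \sum_(N < K.+2) `|gauss_coef N| * r ^+ N.
have t0 N : 0 <= `|gauss_coef N| * r ^+ N by rewrite mulr_ge0 ?exprn_ge0.
have small N : (N < K.+2)%N -> `|gauss_coef N| * r ^+ N <= C.
  move=> NK; rewrite /C (bigD1 (Ordinal NK)) //= lerDl sumr_ge0 //.
exists C => n; elim: n {-2}n (leqnn n) => [|m IH] n nm.
  by apply: small; lia.
case: (ltnP n K.+2) => [/small //|Kn].
case: n nm Kn => [//|[//|n]] nm Kn /=.
apply: le_trans (IH n _); last lia.
have n0 : 0 < n.+2%:R :> R by rewrite ltr0n.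
rewrite normrM normfV normr_nat normrM normrN (ger0_norm (sqr_ge0 s)).
rewrite -{2}(addn2 n) exprD.
rewrite (_ : _ * _ = (`|gauss_coef n| * r ^+ n) * ((s ^+ 2 * r ^+ 2) / n.+2%:R)).
  rewrite ler_piMr // ler_pdivrMr // mul1r; apply: le_trans KP _.
  by rewrite ler_nat; lia.
by field; rewrite gt_eqF.
Qed.

Lemma lnorm_gauss_array N : lnorm N gauss_array = `|gauss_coef N|.
Proof.
rewrite /lnorm /lev big_ord_recl /= subn0 big1 ?addr0 // => i _.
by rewrite normr0.
Qed.

Lemma an_gauss_array r : an r gauss_array.
Proof.
(* The bound is taken at radius 2 t, which leaves the geometric factor 2^-N at radius t. *)
move=> t t0 _; have [C HC] := gauss_coef_bound (ltW (mulr_gt0 (ltr0n R 2) t0)).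
have C0 : 0 <= C by apply: le_trans (HC 0%N); rewrite mulr_ge0 ?exprn_ge0 ?mulr_ge0 ?(ltW t0).
exists (2 * C) => n.
have half : series (fun N => (2^-1 : R) ^+ N) n <= 2.
  suff -> : series (fun N => (2^-1 : R) ^+ N) n = 2 - 2 * 2^-1 ^+ n.
    by rewrite gerBl mulr_ge0 ?exprn_ge0.
  elim: n => [|n IH]; first by rewrite /series /= big_nil expr0; ring.
  by rewrite seriesSr IH exprS; field.
apply: le_trans (ler_wpM2r C0 half); rewrite /series /= mulr_suml.
apply: ler_sum => N _; rewrite /majorant lnorm_gauss_array.
have -> : t ^+ N = 2^-1 ^+ N * (2 * t) ^+ N by rewrite -exprMn mulKf.
by rewrite mulrCA ler_wpM2l ?exprn_ge0.
Qed.

(** The Taylor coefficients of G, as a function of y alone. *)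
Definition primitive_array : array R := primitive (fun _ _ => 0) gauss_array.

Lemma dX_gauss_array : dX gauss_array = (fun _ _ => 0).
Proof. by apply/funext => i; apply/funext => j; rewrite /dX mulr0. Qed.

Lemma dX_primitive_array : dX primitive_array = (fun _ _ => 0).
Proof. exact: dX_primitive. Qed.

Lemma dY_primitive_array : dY primitive_array = gauss_array.
Proof.
apply: dY_primitive; rewrite dX_gauss_array.
by apply/funext => i; apply/funext => j; rewrite /dY mulr0.
Qed.

Lemma an0 r : an r (fun _ _ => 0 : R).
Proof.
move=> t t0 _; exists 0 => n; rewrite /series /= big1 // => N _.
rewrite /majorant (_ : lnorm N _ = 0) ?mul0r //.
by apply: lev_eq0 => i j _; rewrite normr0.
Qed.

Lemma an_primitive_array r : an r primitive_array.
Proof. by apply: an_primitive; [exact: an0|exact: an_gauss_array]. Qed.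

Lemma dY_gauss_array : dY gauss_array = - s ^+ 2 *: mY gauss_array.
Proof.
apply/funext => i; apply/funext => j; rewrite -[RHS]/(- s ^+ 2 * mY gauss_array i j).
rewrite /dY /mY /gauss_array; case: i => [|i]; last by case: j => *; rewrite !mulr0.
case: j => [|j] /=; first by rewrite !mulr0.
by rewrite mulrC divfK // pnatr_eq0.
Qed.

Lemma is_derive_ev2 r c (x y : R) : 1 < r -> an r c -> `|x| < r -> `|y| < r ->
  is_derive y 1 (fun t => ev c (x, t)) (ev (dY c) (x, y)).
Proof.
by move=> r1 cr xr yr; apply: is_derive_slice2; exact: (is_derive_evY r1).
Qed.

Lemma ev_only_y c z : (forall i j, c i.+1 j = 0) -> ev c z = ev c (0, z.2).
Proof.
move=> c0; congr (limn (series _)); apply/funext => N.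
apply: eq_lev => -[|i] j _; rewrite ?c0 ?mul0r //.
Qed.

(** The product of the series with exp (s^2 y^2 / 2) has derivative zero by [dY_gauss_array], and
    its value at 0 is s. *)
Lemma ev_gauss_array r z : 1 < r -> obox r z ->
  ev gauss_array z = s * expR (- (s ^+ 2 * z.2 ^+ 2 / 2)).
Proof.
move=> r1 [_ z2]; rewrite ev_only_y //.
have r0 : `|0 : R| < r by rewrite normr0; lra.
pose phi t := ev gauss_array (0, t) * expR (s ^+ 2 * t ^+ 2 / 2).
have dphi (t : R) : `|t| < r -> is_derive t 1 phi 0.
  move=> tr; have dE := is_derive_ev2 r1 (@an_gauss_array r) r0 tr.
  have de : is_derive t 1 (fun t : R => expR (s ^+ 2 * t ^+ 2 / 2))
      (s ^+ 2 * t * expR (s ^+ 2 * t ^+ 2 / 2)).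
    have d1 : is_derive t 1 (fun t : R => s ^+ 2 * t ^+ 2 / 2) (s ^+ 2 * t).
      by apply: is_derive_eq; rewrite /GRing.scale /=; field.
    have d2 := is_derive_expR (s ^+ 2 * t ^+ 2 / 2).
    have := @is_derive1_comp R expR (fun t : R => s ^+ 2 * t ^+ 2 / 2) t _ _ d2 d1.
    by rewrite mulrC.
  apply: is_derive_eq.
  rewrite dY_gauss_array (evZ_an _ r1) //; last by apply: an_mY; exact: an_gauss_array.
  rewrite (ev_mY_an r1 (@an_gauss_array r)) //.
  rewrite /GRing.scale /=; ring.
have := mvt_eq z2 r0 dphi; rewrite /phi ev0 expr0n /= mulr0 mul0r expR0 mulr1.
by move=> H; rewrite expRN; apply: canRL (mulfK _) H; rewrite gt_eqF // expR_gt0.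
Qed.

Local Notation Gam y := (ev primitive_array (0, y)).

Lemma is_derive_Gam r (y : R) : 1 < r -> `|y| < r ->
  is_derive y 1 (fun y => Gam y) (s * expR (- (s ^+ 2 * y ^+ 2 / 2))).
Proof.
move=> r1 yr; have r0 : `|0 : R| < r by rewrite normr0; lra.
have := is_derive_ev2 r1 (@an_primitive_array r) r0 yr.
by rewrite dY_primitive_array (ev_gauss_array r1).
Qed.

Lemma Gam0 : Gam 0 = 0.
Proof. by rewrite ev0. Qed.

Hypothesis s1 : 1 <= s.

Lemma Gam_incr (x y : R) : `|x| < 2 -> `|y| < 2 -> x <= y -> Gam x <= Gam y.
Proof.
move: s1 => ss xr yr xy; rewrite -subr_ge0.
have /(_ 0) := mvt_ge xy (f := fun y => Gam y)
  (df := fun y => s * expR (- (s ^+ 2 * y ^+ 2 / 2))).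
rewrite mul0r; apply => t xty.
  apply: (is_derive_Gam (r := 2)); first lra.
  by move: xr yr xty; rewrite !ltr_norml; lra.
by rewrite mulr_ge0 ?expR_ge0 //; lra.
Qed.

Lemma Gam_mul_ge0 (y : R) : `|y| < 2 -> 0 <= Gam y * y.
Proof.
have r0 : `|0 : R| < 2 by rewrite normr0.
move=> yr; have [y0|/ltW y0] := leP 0 y.
  by have := Gam_incr r0 yr y0; rewrite Gam0 => ?; exact: mulr_ge0.
by have := Gam_incr yr r0 y0; rewrite Gam0 => ?; exact: mulr_le0.
Qed.

(** A comparison that leads to a bound of G independent of s: with u = (s t)^2, exp (u / 2) >= 1 + u
    / 2 gives exp (- u / 2) <= 2 / (1 + u), and s / (1 + u) is the derivative of atan (s t). *)
Lemma Gam_atan (x y : R) : `|x| < 2 -> `|y| < 2 -> x <= y ->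
  Gam y - Gam x <= 2 * atan (s * y) - 2 * atan (s * x).
Proof.
move: s1 => ss xr yr xy.
have := mvt_ge (m := 0) xy (f := fun y => 2 * atan (s * y) - Gam y)
  (df := fun y => 2 * (s / (1 + (s * y) ^+ 2)) - s * expR (- (s ^+ 2 * y ^+ 2 / 2))).
rewrite mul0r => H; suff : 0 <= 2 * atan (s * y) - Gam y - (2 * atan (s * x) - Gam x) by lra.
apply: H => t xty.
  have tr : `|t| < 2 by move: xr yr xty; rewrite !ltr_norml; lra.
  have d1 := is_derive_Gam (ltr1n R 2) tr.
  have d2 : is_derive t 1 (fun y : R => atan (s * y)) (s / (1 + (s * t) ^+ 2)).
    have da : is_derive (s * t) 1 (@atan R) (1 + (s * t) ^+ 2)^-1.
      by apply: DeriveDef; [exact: derivable_atan|rewrite -derive1E derive1_atan].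
    have dm : is_derive t 1 (fun y : R => s * y) s.
      by apply: is_derive_eq; rewrite /GRing.scale /= mulr1.
    by have := @is_derive1_comp R (@atan R) (fun y : R => s * y) t _ _ da dm; rewrite mulrC.
  by apply: is_derive_eq.
rewrite subr_ge0 [leRHS]mulrCA ler_wpM2l //; first lra.
have q0 : 0 <= (s * t) ^+ 2 by exact: sqr_ge0.
rewrite ler_pdivlMr; last lra.
rewrite expRN mulrC ler_pdivrMr ?expR_gt0 // -exprMn.
have := expR_ge1Dx ((s * t) ^+ 2 / 2); lra.
Qed.

Lemma Gam_bound (y : R) : `|y| < 2 -> `|Gam y| <= pi.
Proof.
move: s1 => ss yr; have r0 : `|0 : R| < 2 by rewrite normr0.
have pi0 := @pi_ge0 R.
have a1 := atan_gtNpi2 (s * y); have a2 := atan_ltpi2 (s * y).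
rewrite ler_norml; have [y0|/ltW y0] := leP 0 y.
  have := Gam_incr r0 yr y0; have := Gam_atan r0 yr y0.
  by rewrite Gam0 mulr0 atan0; lra.
have := Gam_incr yr r0 y0; have := Gam_atan yr r0 y0.
by rewrite Gam0 mulr0 atan0; lra.
Qed.

(** On [0, 1 / s] the derivative is at least s / 2, since exp (- 1 / 2) >= 1 / 2; beyond, G
    increases. *)
Lemma Gam_lower (y : R) : `|y| < 2 -> 1 <= s * y -> 1 / 2 <= Gam y.
Proof.
move: s1 => ss yr sy; have s0 : 0 < s by lra.
have r0 : `|0 : R| < 2 by rewrite normr0.
have is1 : s^-1 <= 1 by rewrite invf_le1.
have is0 : 0 <= s^-1 by rewrite invr_ge0 ltW.
have sr : `|s^-1| < 2 by rewrite ger0_norm //; lra.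
have : Gam s^-1 <= Gam y.
  by apply: Gam_incr => //; rewrite -(ler_pM2l s0) divff ?gt_eqF.
have := mvt_ge (m := s / 2) is0 (f := fun y => Gam y)
  (df := fun y => s * expR (- (s ^+ 2 * y ^+ 2 / 2))).
rewrite Gam0 !subr0 mulrAC divff ?gt_eqF // => H.
apply: le_trans; apply: H => t /andP[t0 t1].
  by apply: (is_derive_Gam (ltr1n R 2)); rewrite ger0_norm //; lra.
rewrite ler_wpM2l ?(ltW s0) //.
have : (s * t) ^+ 2 <= 1.
  by rewrite exprn_ile1 ?mulr_ge0 ?(ltW s0) // -[leRHS](divff (lt0r_neq0 s0)) ler_wpM2l // ltW.
rewrite exprMn => st; apply: le_trans (expR_ge1Dx _); lra.
Qed.

End LinearSolution.

(** * Explicit solutions of the linearised equation by raising operators *)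

Section ExplicitLinear.
Variable R : realType.
Implicit Types (c d : array R) (z : R * R) (nu : R).

Lemma mXD c d : mX (c + d) = mX c + mX d.
Proof.
apply/funext => i; apply/funext => j; rewrite -[RHS]/(mX c i j + mX d i j) /mX.
by case: i => [|i]; rewrite ?addr0.
Qed.

Lemma mXZ k c : mX (k *: c) = k *: mX c.
Proof.
apply/funext => i; apply/funext => j; rewrite -[RHS]/(k * mX c i j) /mX.
by case: i => [|i]; rewrite ?mulr0.
Qed.

Lemma mYD c d : mY (c + d) = mY c + mY d.
Proof.
apply/funext => i; apply/funext => j; rewrite -[RHS]/(mY c i j + mY d i j) /mY.
by case: j => [|j]; rewrite ?addr0.
Qed.

Lemma mYZ k c : mY (k *: c) = k *: mY c.
Proof.
apply/funext => i; apply/funext => j; rewrite -[RHS]/(k * mY c i j) /mY.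
by case: j => [|j]; rewrite ?mulr0.
Qed.

Lemma dX_mX c : dX (mX c) = c + mX (dX c).
Proof.
apply/funext => i; apply/funext => j; rewrite -[RHS]/(c i j + mX (dX c) i j) /mX /dX.
by case: i => [|i]; rewrite ?mul1r ?addr0 // -[in LHS]natr1 mulrDl mul1r addrC.
Qed.

Lemma dY_mY c : dY (mY c) = c + mY (dY c).
Proof.
apply/funext => i; apply/funext => j; rewrite -[RHS]/(c i j + mY (dY c) i j) /mY /dY.
by case: j => [|j]; rewrite ?mul1r ?addr0 // -[in LHS]natr1 mulrDl mul1r addrC.
Qed.

Lemma dY_mX c : dY (mX c) = mX (dY c).
Proof.
by apply/funext => i; apply/funext => j; rewrite /mX /dY; case: i => [|i]; rewrite ?mulr0.
Qed.

Lemma dX_mY c : dX (mY c) = mY (dX c).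
Proof.
by apply/funext => i; apply/funext => j; rewrite /mY /dX; case: j => [|j]; rewrite ?mulr0.
Qed.

Lemma mX_mY c : mX (mY c) = mY (mX c).
Proof. by apply/funext => -[|i]; apply/funext => -[|j]. Qed.

(* As for the harmonic oscillator, iterating x - nu d/dx and y + nu d/dy gives
   eigenvectors of (x - nu d/dx) d/dx and of (y + nu d/dy) d/dy; if the two
   eigenvalues agree, subtracting the equations yields
   nu Lap e = x e_x - y e_y. *)
Definition raise_x nu c : array R := mX c + (- nu) *: dX c.
Definition raise_y nu c : array R := mY c + nu *: dY c.

Lemma dX_raise_x nu c : dX (raise_x nu c) = c + raise_x nu (dX c).
Proof. by rewrite /raise_x dXD dX_mX dXZ addrA. Qed.

Lemma dY_raise_y nu c : dY (raise_y nu c) = c + raise_y nu (dY c).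
Proof. by rewrite /raise_y dYD dY_mY dYZ addrA. Qed.

Lemma dY_raise_x nu c : dY (raise_x nu c) = raise_x nu (dY c).
Proof. by rewrite /raise_x dYD dY_mX dYZ dXdY. Qed.

Lemma dX_raise_y nu c : dX (raise_y nu c) = raise_y nu (dX c).
Proof. by rewrite /raise_y dXD dX_mY dXZ dXdY. Qed.

Lemma raise_xZ nu k c : raise_x nu (k *: c) = k *: raise_x nu c.
Proof. by rewrite /raise_x mXZ dXZ scalerDr scalerA [_ * k]mulrC -scalerA. Qed.

Lemma raise_yZ nu k c : raise_y nu (k *: c) = k *: raise_y nu c.
Proof. by rewrite /raise_y mYZ dYZ scalerDr scalerA [_ * k]mulrC -scalerA. Qed.

Lemma raise_xy nu nu' c : raise_x nu (raise_y nu' c) = raise_y nu' (raise_x nu c).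
Proof.
rewrite /raise_x /raise_y mXD dXD mYD dYD mXZ mYZ dXZ dYZ dX_mY dY_mX mX_mY dXdY.
rewrite !scalerDr !scalerA [_ * nu']mulrC -!addrA; congr (_ + _).
by rewrite addrCA.
Qed.

Lemma zero_arrayZ k : k *: (fun _ _ => 0 : R) = (fun _ _ => 0 : R) :> array R.
Proof. by apply/funext => i; apply/funext => j; exact: mulr0. Qed.

Lemma raise_x0 nu : raise_x nu (fun _ _ => 0) = (fun _ _ => 0).
Proof. by have := raise_xZ nu 0 (fun _ _ => 0); rewrite zero_arrayZ scale0r. Qed.

Lemma raise_y0 nu : raise_y nu (fun _ _ => 0) = (fun _ _ => 0).
Proof. by have := raise_yZ nu 0 (fun _ _ => 0); rewrite zero_arrayZ scale0r. Qed.

Lemma iter_raise_x nu m c : dX c = (fun _ _ => 0) ->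
  dX (iter m.+1 (raise_x nu) c) = m.+1%:R *: iter m (raise_x nu) c.
Proof.
move=> c0; elim: m => [|m IH].
  by rewrite /= dX_raise_x c0 raise_x0 addr0 scale1r.
rewrite iterS dX_raise_x IH raise_xZ -iterS -[in RHS]natr1.
by rewrite scalerDl scale1r addrC.
Qed.

Lemma number_x nu m c : dX c = (fun _ _ => 0) ->
  raise_x nu (dX (iter m (raise_x nu) c)) = m%:R *: iter m (raise_x nu) c.
Proof.
move=> c0; case: m => [|m]; first by rewrite /= c0 raise_x0 scale0r.
by rewrite iter_raise_x // raise_xZ.
Qed.

(** The seed need not be constant in y: it suffices that (y + nu d/dy) d/dy annihilates it, which
    for G is the equation of its Gaussian derivative. *)
Lemma number_y nu n c : raise_y nu (dY c) = (fun _ _ => 0) ->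
  raise_y nu (dY (iter n (raise_y nu) c)) = n%:R *: iter n (raise_y nu) c.
Proof.
move=> c0; elim: n => [|n IH]; first by rewrite /= c0 scale0r.
rewrite iterS dY_raise_y IH -{1}[iter n _ _]scale1r -scalerDl nat1r.
by rewrite raise_yZ.
Qed.

Lemma an_raise_x r nu c : an r c -> an r (raise_x nu c).
Proof. by move=> cr; apply: anD; [exact: an_mX|apply: anZ; exact: an_dX]. Qed.

Lemma an_raise_y r nu c : an r c -> an r (raise_y nu c).
Proof. by move=> cr; apply: anD; [exact: an_mY|apply: anZ; exact: an_dY]. Qed.

Lemma ev_raise_x r nu c z : 1 < r -> an r c -> obox r z ->
  ev (raise_x nu c) z = z.1 * ev c z - nu * ev (dX c) z.
Proof.
move=> r1 cr rz; have cX := an_dX cr; rewrite (evD_an r1 _ _ rz).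
- by rewrite (ev_mX_an r1 cr rz) (evZ_an _ r1 cX rz) mulNr.
- exact: an_mX.
- exact: anZ.
Qed.

Lemma ev_raise_y r nu c z : 1 < r -> an r c -> obox r z ->
  ev (raise_y nu c) z = z.2 * ev c z + nu * ev (dY c) z.
Proof.
move=> r1 cr rz; have cY := an_dY cr; rewrite (evD_an r1 _ _ rz).
- by rewrite (ev_mY_an r1 cr rz) (evZ_an _ r1 cY rz).
- exact: an_mY.
- exact: anZ.
Qed.

Definition ymode (s : R) n : array R := iter n (raise_y (s ^- 2)) (primitive_array s).
(** For large s the parameter s^-2 of the raising operators is small and this is close to x^m y^n
    G(y). *)
Definition mode (s : R) m n : array R := iter m (raise_x (s ^- 2)) (ymode s n).

Lemma an_ymode r s n : an r (ymode s n).
Proof. by elim: n => [|n IH]; [exact: an_primitive_array|exact: an_raise_y]. Qed.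

Lemma an_mode r s m n : an r (mode s m n).
Proof. by elim: m => [|m IH]; [exact: an_ymode|exact: an_raise_x]. Qed.

Lemma raise_y_gauss s : s != 0 -> raise_y (s ^- 2) (gauss_array s) = (fun _ _ => 0).
Proof.
move=> s0; rewrite /raise_y dY_gauss_array scalerA.
rewrite (_ : _ * _ = -1); first by rewrite scaleN1r subrr.
by rewrite mulrN mulVf // expf_neq0.
Qed.

Lemma dX_ymode s n : dX (ymode s n) = (fun _ _ => 0).
Proof.
elim: n => [|n IH]; first exact: dX_primitive_array.
by rewrite /ymode iterS dX_raise_y -/(ymode s n) IH raise_y0.
Qed.

Lemma lap_mode s m : s != 0 -> lap (mode s m m) = s ^+ 2 *: mixed (mode s m m).
Proof.
move=> s0; set e := mode s m m; set nu := s ^- 2.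
have ex : raise_x nu (dX e) = m%:R *: e by apply: number_x; exact: dX_ymode.
have ey : raise_y nu (dY e) = m%:R *: e.
  have yP : raise_y nu (dY (ymode s m)) = m%:R *: ymode s m.
    by apply: number_y; rewrite dY_primitive_array raise_y_gauss.
  (* Only the number of raisings in x is inducted upon: they commute with the operators in y and
     keep the eigenvalue m. *)
  rewrite /e /mode -/nu; elim: {1 4}m => [|k IH]; first exact: yP.
  by rewrite !iterS dY_raise_x -raise_xy IH raise_xZ.
have : raise_x nu (dX e) - raise_y nu (dY e) = 0 by rewrite ex ey subrr.
rewrite /raise_x /raise_y scaleNr opprD addrACA -mixedE -opprD -scalerDr -lapE.
move/eqP; rewrite subr_eq0 => /eqP ->.
by rewrite scalerA divff ?scale1r // expf_neq0.
Qed.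

Lemma inbox1_obox z : inbox 1 z -> obox 2 z.
Proof. by move=> [z1 z2]; split; lra. Qed.

(** What matters is that C does not depend on s. The third bound is carried along because each
    raising adds nu d/dy of the previous mode: for n = 0 this is nu G' <= 1 / s, and later d/dy of
    mode n + 1 is n + 1 times mode n, so that nu = s^-2 makes it small. *)
Lemma ymode_bound n : exists2 C : R, 0 <= C & forall s z, 1 <= s -> inbox 1 z ->
  [/\ `|ev (ymode s n) z| <= C,
      `|ev (ymode s n) z - z.2 ^+ n * ev (primitive_array s) (0, z.2)| <= C / s &
      `|s ^- 2 * ev (dY (ymode s n)) z| <= C / s].
Proof.
have r1 : 1 < 2 :> R by lra.
have z1 z : inbox 1 z -> `|z.2| <= 1 by case.
have nus (s : R) : 1 <= s -> s ^- 2 <= s^-1.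
  by move=> s1; rewrite lef_pV2 ?posrE ?exprn_gt0; nra.
elim: n => [|n [C C0 HC]].
  exists (pi + 1) => [|s z s1 iz]; first by rewrite addr_ge0 // pi_ge0.
  have s0 : 0 < s by lra.
  have is0 : 0 <= s^-1 by rewrite invr_ge0 ltW.
  have z2 : `|z.2| < 2 by have := z1 _ iz; lra.
  have pz : ev (primitive_array s) z = ev (primitive_array s) (0, z.2).
    by apply: ev_only_y => i j; rewrite /primitive_array /= mul0r.
  rewrite /ymode /= pz dY_primitive_array (ev_gauss_array _ r1 (inbox1_obox iz)).
  split.
  - have := Gam_bound s1 z2; lra.
  - by rewrite expr0 mul1r subrr normr0 mulr_ge0 // addr_ge0 // pi_ge0.
  - have e1 : expR (- (s ^+ 2 * z.2 ^+ 2 / 2)) <= 1.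
      by rewrite -[leRHS]expR0 ler_expR oppr_le0 divr_ge0 // mulr_ge0 ?sqr_ge0.
    rewrite mulrA (_ : s ^- 2 * s = s^-1); last by field; rewrite gt_eqF.
    rewrite ger0_norm ?mulr_ge0 ?expR_ge0 // mulrC ler_wpM2r //.
    by have := @pi_ge0 R; lra.
exists (2 * C + n.+1%:R * C) => [|s z s1 iz]; first by rewrite addr_ge0 ?mulr_ge0.
have [H1 H2 H3] := HC s z s1 iz.
have s0 : 0 < s by lra.
have is0 : 0 <= s^-1 by rewrite invr_ge0 ltW.
have is1 : s^-1 <= 1 by rewrite invf_le1.
have z2 := z1 _ iz.
have Cs : C / s <= C by rewrite ler_piMr.
have nC : 0 <= n.+1%:R * C by rewrite mulr_ge0.
have evE : ev (ymode s n.+1) z = z.2 * ev (ymode s n) z + s ^- 2 * ev (dY (ymode s n)) z.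
  by rewrite /ymode iterS (ev_raise_y _ r1 (@an_ymode 2 s n) (inbox1_obox iz)).
split.
- rewrite evE; apply: le_trans (ler_normD _ _) _; rewrite normrM.
  have := ler_pM (normr_ge0 _) (normr_ge0 _) z2 H1; lra.
- rewrite evE (exprS z.2 n) -(mulrA z.2) addrAC -mulrBr.
  apply: le_trans (ler_normD _ _) _; rewrite normrM mulrDl.
  have := ler_pM (normr_ge0 _) (normr_ge0 _) z2 H2.
  have : 0 <= n.+1%:R * C / s by rewrite mulr_ge0.
  lra.
- have -> : dY (ymode s n.+1) = n.+1%:R *: ymode s n.
    have yP : raise_y (s ^- 2) (dY (ymode s n)) = n%:R *: ymode s n.
      by apply: number_y; rewrite dY_primitive_array raise_y_gauss // gt_eqF.
    rewrite /ymode iterS dY_raise_y -/(ymode s n) yP -{1}[ymode s n]scale1r.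
    by rewrite -scalerDl nat1r.
  rewrite (evZ_an _ r1 (@an_ymode 2 s n) (inbox1_obox iz)).
  rewrite mulrCA normrM normr_nat normrM.
  rewrite ger0_norm; last by rewrite invr_ge0 exprn_ge0 // ltW.
  have := ler_pM _ (normr_ge0 _) (nus s s1) H1.
  rewrite invr_ge0 exprn_ge0 ?(ltW s0) // => /(_ erefl) H.
  rewrite mulrDl; have : 0 <= 2 * C / s by rewrite mulr_ge0 // mulr_ge0.
  have := ler_wpM2l (ler0n R n.+1) H; lra.
Qed.

Lemma ev_zero z : ev (fun _ _ => 0) z = 0.
Proof.
apply: cvg_lim => //; rewrite (_ : series _ = cst 0); first exact: cvg_cst.
apply/funext => N; rewrite /series /= big1 // => n _.
by apply: lev_eq0 => i j _; rewrite mul0r.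
Qed.

Lemma mode_bound m n : exists2 C : R, 0 <= C & forall s z, 1 <= s -> inbox 1 z ->
  [/\ `|ev (mode s m n) z| <= C,
      `|ev (mode s m n) z - z.1 ^+ m * z.2 ^+ n * ev (primitive_array s) (0, z.2)| <= C / s &
      `|s ^- 2 * ev (dX (mode s m n)) z| <= C / s].
Proof.
have r1 : 1 < 2 :> R by lra.
have z1 z : inbox 1 z -> `|z.1| <= 1 by case.
have nus (s : R) : 1 <= s -> s ^- 2 <= s^-1.
  by move=> s1; rewrite lef_pV2 ?posrE ?exprn_gt0; nra.
elim: m => [|m [C C0 HC]].
  have [C C0 HC] := ymode_bound n; exists C => // s z s1 iz.
  have [H1 H2 H3] := HC s z s1 iz.
  rewrite /mode /= dX_ymode expr0 mul1r; split=> //.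
  by rewrite ev_zero mulr0 normr0 mulr_ge0 // invr_ge0; lra.
exists (2 * C + m.+1%:R * C) => [|s z s1 iz]; first by rewrite addr_ge0 ?mulr_ge0.
have [H1 H2 H3] := HC s z s1 iz.
have s0 : 0 < s by lra.
have is0 : 0 <= s^-1 by rewrite invr_ge0 ltW.
have is1 : s^-1 <= 1 by rewrite invf_le1.
have z2 := z1 _ iz.
have Cs : C / s <= C by rewrite ler_piMr.
have nC : 0 <= m.+1%:R * C by rewrite mulr_ge0.
have evE : ev (mode s m.+1 n) z = z.1 * ev (mode s m n) z - s ^- 2 * ev (dX (mode s m n)) z.
  by rewrite /mode iterS (ev_raise_x _ r1 (@an_mode 2 s m n) (inbox1_obox iz)).
split.
- rewrite evE; apply: le_trans (ler_normB _ _) _; rewrite normrM.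
  have := ler_pM (normr_ge0 _) (normr_ge0 _) z2 H1; lra.
- rewrite evE (exprS z.1 m) -!(mulrA z.1) addrAC -mulrBr.
  apply: le_trans (ler_normB _ _) _; rewrite normrM mulrDl.
  have := ler_pM (normr_ge0 _) (normr_ge0 _) z2 H2.
  have : 0 <= m.+1%:R * C / s by rewrite mulr_ge0.
  lra.
- have -> : dX (mode s m.+1 n) = m.+1%:R *: mode s m n.
    by rewrite /mode iter_raise_x // dX_ymode.
  rewrite (evZ_an _ r1 (@an_mode 2 s m n) (inbox1_obox iz)).
  rewrite mulrCA normrM normr_nat normrM.
  rewrite ger0_norm; last by rewrite invr_ge0 exprn_ge0 // ltW.
  have := ler_pM _ (normr_ge0 _) (nus s s1) H1.
  rewrite invr_ge0 exprn_ge0 ?(ltW s0) // => /(_ erefl) H.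
  rewrite mulrDl; have : 0 <= 2 * C / s by rewrite mulr_ge0 // mulr_ge0.
  have := ler_wpM2l (ler0n R m.+1) H; lra.
Qed.

End ExplicitLinear.

(** * Measurability in the plane, and the area of the disc *)

Section PlaneMeasure.
Variable R : realType.
Local Notation plane := (measurableTypeR R * measurableTypeR R)%type.
Local Notation mu := (@lebesgue_measure R).
Local Notation B1 := (@unit_disc R).
Local Notation nu := (@leb2 R).
Local Notation mfun D f := (measurable_fun (D : set plane) (f : plane -> R)).
Implicit Types (c : array R) (z : R * R) (f g : R * R -> R) (D : set plane).

Lemma mfun_fst D : mfun D (fun z => z.1).
Proof. by apply: measurable_funTS; exact: measurable_fst. Qed.

Lemma mfun_snd D : mfun D (fun z => z.2).
Proof. by apply: measurable_funTS; exact: measurable_snd. Qed.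

Lemma mfunM D f g : mfun D f -> mfun D g -> mfun D (fun z => f z * g z).
Proof. exact: measurable_funM. Qed.

Lemma mfunD D f g : mfun D f -> mfun D g -> mfun D (fun z => f z + g z).
Proof. exact: measurable_funD. Qed.

Lemma mfunB D f g : mfun D f -> mfun D g -> mfun D (fun z => f z - g z).
Proof. exact: measurable_funB. Qed.

Lemma mfunN D f : mfun D f -> mfun D (fun z => - f z).
Proof. exact: measurable_funN. Qed.

Lemma mfunX D f n : mfun D f -> mfun D (fun z => f z ^+ n).
Proof. exact: measurable_funX. Qed.

Lemma measurable_invr : measurable_fun [set: R] (@GRing.inv R).
Proof.
rewrite -(setvU [set (0 : R)]).
apply/measurable_funU => //; first exact: measurableC.
split; last exact: measurable_fun_set1.
apply: open_continuous_measurable_fun.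
  by rewrite openC; exact: closed_eq.
by move=> x; rewrite inE /= => /eqP x0; exact: inv_continuous.
Qed.

Lemma mfunV D f : mfun D f -> mfun D (fun z => (f z)^-1).
Proof. by move=> mf; apply: (measurableT_comp measurable_invr). Qed.

Definition sqn z : R := z.1 ^+ 2 + z.2 ^+ 2.

Lemma mfun_sqn D : mfun D sqn.
Proof. by apply: mfunD; apply: mfunX; [exact: mfun_fst|exact: mfun_snd]. Qed.

Lemma sqn_ge0 z : 0 <= sqn z.
Proof. by rewrite addr_ge0 ?sqr_ge0. Qed.

Lemma sqr_enorm z : enorm z ^+ 2 = sqn z.
Proof. by rewrite sqr_sqrtr // sqn_ge0. Qed.

Lemma unit_discE : B1 = [set z | sqn z < 1].
Proof.
apply/seteqP; split => z /= H.
  by rewrite -sqr_enorm exprn_ilt1 // sqrtr_ge0.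
by rewrite /unit_disc /= -sqrtr1 ltr_sqrt.
Qed.

Lemma measurable_unit_disc : measurable (B1 : set plane).
Proof.
rewrite unit_discE (_ : [set z | _] = setT `&` (sqn @^-1` `]-oo, 1[%classic)).
  by apply: (mfun_sqn (D := setT)).
by apply/seteqP; split => z /=; rewrite in_itv /= => // -[].
Qed.

Lemma mfun_ev r c D : an r c -> 1 < r -> D `<=` obox r -> mfun D (ev c).
Proof.
move=> cr r1 Dr; apply: (@measurable_fun_cvg _ _ _ _ (fun n z => series (lval c z) n)).
  move=> n; apply: measurable_sum => N; apply: measurable_sum => i.
  apply: mfunM => //; apply: mfunM; apply: mfunX; [exact: mfun_fst|exact: mfun_snd].
move=> z /Dr rz; have [s [cs _ sz]] := obox_absconv r1 cr cr rz.
exact: ev_cvg cs sz.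
Qed.

Lemma measurable_box (a b c d : R) :
  measurable ([set z | a <= z.1 <= b /\ c <= z.2 <= d] : set plane).
Proof.
rewrite (_ : [set z | _] = `[a, b]%classic `*` `[c, d]%classic); last first.
  by apply/seteqP; split => z /=; rewrite !in_itv.
exact: measurableX.
Qed.

Lemma leb2_box (a b c d : R) : a <= b -> c <= d ->
  nu [set z | a <= z.1 <= b /\ c <= z.2 <= d] = ((b - a) * (d - c))%:E.
Proof.
move=> ab cd.
rewrite (_ : [set z | _] = `[a, b]%classic `*` `[c, d]%classic); last first.
  by apply/seteqP; split => z /=; rewrite !in_itv.
have L (x y : R) : x <= y -> mu `[x, y]%classic = (y - x)%:E.
  move=> xy; rewrite lebesgue_measure_itv /= lte_fin.
  by case: ltrgtP xy => // -> _; rewrite subrr.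
transitivity (mu `[a, b]%classic * mu `[c, d]%classic)%E.
  by apply: product_measure1E; exact: measurable_itv.
by rewrite !L // EFinM.
Qed.

Lemma unit_disc_abs z : B1 z -> `|z.1| < 1 /\ `|z.2| < 1.
Proof.
rewrite unit_discE /= /sqn => H.
have H1 := sqr_ge0 z.1; have H2 := sqr_ge0 z.2.
split; rewrite -(@ltr_pXn2r _ 2) ?nnegrE // expr1n real_normK ?num_real //; lra.
Qed.

Lemma unit_disc_obox r : 1 <= r -> B1 `<=` obox r.
Proof. by move=> r1 z /unit_disc_abs [z1 z2]; split; lra. Qed.

Lemma leb2_unit_disc : (nu (B1) <= 4%:E)%E.
Proof.
have <- : nu [set z | -1 <= z.1 <= 1 /\ -1 <= z.2 <= 1] = 4%:E.
  by rewrite leb2_box; [congr (_%:E); ring|lra|lra].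
apply: le_measure; rewrite ?inE.
- exact: measurable_unit_disc.
- exact: measurable_box.
- by move=> z /unit_disc_abs [/ltW z1 /ltW z2]; split; rewrite -ler_norml.
Qed.

Lemma mfun_enorm D : mfun D (@enorm R).
Proof.
apply: (measurableT_comp (f := @Num.sqrt R)); last exact: mfun_sqn.
by apply: continuous_measurable_fun; exact: sqrt_continuous.
Qed.

End PlaneMeasure.

(** * Integrability of 1 / |z| over the disc *)

Section InverseDistance.
Variable R : realType.
Local Notation plane := (measurableTypeR R * measurableTypeR R)%type.
Local Notation mu := (@lebesgue_measure R).
Local Notation B1 := (@unit_disc R).
Local Notation nu := (@leb2 R).
Local Notation mfun D f := (measurable_fun (D : set plane) (f : plane -> R)).
Implicit Types (z : R * R) (f : R * R -> R).

Let box (k : nat) : set plane :=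
  [set z | - 2 ^- k <= z.1 <= 2 ^- k /\ - 2 ^- k <= z.2 <= 2 ^- k].

Let step (k : nat) (z : plane) : R := 2 ^+ k.+1 * \1_(box k) z.

Let step_ge0 k z : 0 <= step k z.
Proof. by rewrite mulr_ge0 ?exprn_ge0. Qed.

Let mstep D k : mfun D (step k).
Proof.
apply: mfunM => //; apply: measurable_funTS; apply: measurable_indic.
exact: measurable_box.
Qed.

(** One term suffices: if 2^-(k+1) < max(|x|, |y|) <= 2^-k, then z lies in [box k] and 1 / |z| <=
    2^(k+1). *)
Lemma enorm_inv_dyadic z : B1 z ->
  ((enorm z)^-1%:E <= \sum_(k <oo) (step k z)%:E)%E.
Proof.
move=> Bz; have [z1 z2] := unit_disc_abs Bz.
have s0 k : (0 <= (step k z)%:E)%E by rewrite lee_fin.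
pose m := Num.max `|z.1| `|z.2|.
have m0 : 0 <= m by rewrite le_max normr_ge0.
have [m_eq0|mn0] := eqVneq m 0.
  (* At the origin the inverse is 0 by convention. *)
  have [z10 z20] : z.1 = 0 /\ z.2 = 0.
    have : m <= 0 by rewrite m_eq0.
    by rewrite ge_max => /andP[]; rewrite !normr_le0 => /eqP -> /eqP ->.
  rewrite /enorm z10 z20 expr0n /= addr0 sqrtr0 invr0.
  by apply: nneseries_ge0 => k _ _.
have mp : 0 < m by rewrite lt_neqAle eq_sym mn0.
have m1 : m < 1 by rewrite gt_max z1.
have exk : exists n, (2 ^- n < m).
  exists (Num.bound m^-1).
  rewrite invf_plt ?posrE ?exprn_gt0 //.
  apply: lt_le_trans (archi_boundP _) _; first by rewrite invr_ge0.
  by rewrite -natrX ler_nat ltnW // ltn_expl.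
case: (ex_minnP exk) => -[|k] km kmin.
  by move: km; rewrite expr0 invr1 ltNge (ltW m1).
have mk : m <= 2 ^- k.
  by rewrite leNgt; apply/negP => /kmin; rewrite ltnn.
apply: (@le_trans _ _ (\sum_(0 <= i < k.+1) (step i z)%:E)%E); last first.
  exact: nneseries_lim_ge.
rewrite big_nat_recr //=.
apply: (@le_trans _ _ (step k z)%:E); last first.
  by rewrite leeDr // sume_ge0.
rewrite lee_fin /step indicE mem_set /=; last first.
  by move: mk; rewrite ge_max !ler_norml => /andP[].
rewrite mulr1; apply: (@le_trans _ _ m^-1); last first.
  by apply/ltW; rewrite invf_plt ?posrE ?exprn_gt0.
have menorm : m <= enorm z.
  rewrite ge_max -!sqrtr_sqr; apply/andP; split; apply: ler_wsqrtr.
    by rewrite lerDl sqr_ge0.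
  by rewrite lerDr sqr_ge0.
by rewrite lef_pV2 ?posrE // (lt_le_trans mp).
Qed.

(** The k-th step contributes at most 2^(k+1) times the area (2 2^-k)^2, that is 16 / 2^(k+1), and
    these sum to 16. *)
Lemma integral_enorm_inv : (\int[nu]_(z in B1) ((enorm z)^-1)%:E <= 16%:E)%E.
Proof.
have mB := @measurable_unit_disc R.
have meas k : measurable_fun B1 (fun z : plane => (step k z)%:E).
  by apply/measurable_EFinP; exact: mstep.
apply: (@le_trans _ _ (\int[nu]_(z in B1) (\sum_(k <oo) (step k z)%:E))%E).
  apply: ge0_le_integral => //.
  - by move=> z _; rewrite lee_fin invr_ge0 sqrtr_ge0.
  - by apply/measurable_EFinP; apply: mfunV; exact: mfun_enorm.
  - apply: ge0_emeasurable_sum => [k z _ _|k _]; [by rewrite lee_fin|exact: meas].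
  - by move=> z Bz; exact: enorm_inv_dyadic.
rewrite integral_nneseries //; last by move=> k z _; rewrite lee_fin.
have H k : (\int[nu]_(z in B1) (step k z)%:E <= (16 / (2 ^ (k + 1))%:R)%:E)%E.
  apply: (@le_trans _ _ ((2 ^+ k.+1)%:E * nu (box k))%E).
    under eq_integral do rewrite /step EFinM.
    have mb : measurable (box k) by exact: measurable_box.
    rewrite ge0_integralZl ?lee_fin ?exprn_ge0 //.
    - rewrite lee_wpmul2l ?lee_fin ?exprn_ge0 // integral_indic //.
      by apply: le_measure; rewrite ?inE; [exact: measurableI|exact: mb|move=> z []].
    - by apply/measurable_EFinP; apply: measurable_funTS; exact: measurable_indic.
  have k0 : 0 <= 2 ^- k :> R by rewrite invr_ge0 exprn_ge0.
  rewrite /box leb2_box ?lee_fin; [|lra|lra].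
  rewrite le_eqVlt; apply/orP; left; apply/eqP.
  by rewrite addn1 natrX exprS; field; rewrite expf_neq0.
have cv := @cvg_geometric_eseries_half R 16 0.
rewrite expr0 divr1 in cv.
rewrite -(cvg_lim _ cv) //; apply: lee_nneseries => //.
by move=> k _ _; apply: integral_ge0 => z _; rewrite lee_fin.
Qed.

Lemma integrable_inv_enorm f (C : R) : mfun B1 f ->
  (forall z, B1 z -> `|f z| <= C / enorm z) -> nu.-integrable B1 (EFin \o f).
Proof.
move=> mf fC; apply/integrableP; split; first exact/measurable_EFinP.
have mB := @measurable_unit_disc R.
apply: (@le_lt_trans _ _ (\int[nu]_(z in B1) (`|C|%:E * ((enorm z)^-1)%:E))%E).
  apply: ge0_le_integral => //.
  - by apply/measurableT_comp => //; exact/measurable_EFinP.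
  - by apply/measurable_EFinP; apply: mfunM => //; apply: mfunV; exact: mfun_enorm.
  - move=> z Bz; rewrite /= -EFinM lee_fin; apply: le_trans (fC z Bz) _.
    by rewrite ler_wpM2r ?ler_norm // invr_ge0 sqrtr_ge0.
rewrite ge0_integralZl ?lee_fin //.
- by apply: le_lt_trans (lee_wpmul2l _ integral_enorm_inv) _; rewrite ?lee_fin // -EFinM ltry.
- by apply/measurable_EFinP; apply: mfunV; exact: mfun_enorm.
- by move=> z _; rewrite lee_fin invr_ge0 sqrtr_ge0.
Qed.

Lemma Rintegral_inv_enorm_le f (C : R) : 0 <= C -> mfun B1 f ->
  (forall z, B1 z -> `|f z| <= C / enorm z) ->
  `|\int[nu]_(z in B1) f z| <= 16 * C.
Proof.
move=> C0 mf fC; have mB := @measurable_unit_disc R.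
have fi := integrable_inv_enorm mf fC.
apply: le_trans (le_normr_Rintegral mB fi) _.
rewrite /Rintegral -lee_fin fineK; last first.
  by apply: integrable_fin_num => //; exact: integrable_norm.
apply: (@le_trans _ _ (\int[nu]_(z in B1) (C%:E * ((enorm z)^-1)%:E))%E).
  apply: ge0_le_integral; first exact: mB.
  - by move=> z _; rewrite lee_fin.
  - by apply/measurable_EFinP; apply: measurableT_comp.
  - by apply/measurable_EFinP; apply: mfunM => //; apply: mfunV; exact: mfun_enorm.
  - by move=> z Bz; rewrite -EFinM lee_fin; exact: fC.
rewrite ge0_integralZl ?lee_fin //.
- by rewrite mulrC EFinM; apply: lee_wpmul2l integral_enorm_inv; rewrite lee_fin.
- by apply/measurable_EFinP; apply: mfunV; exact: mfun_enorm.
- by move=> z _; rewrite lee_fin invr_ge0 sqrtr_ge0.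
Qed.

End InverseDistance.

(** * Integration over the disc along chords *)

Section DiscIntegrals.
Variable R : realType.
Local Notation plane := (measurableTypeR R * measurableTypeR R)%type.
Local Notation mu := (@lebesgue_measure R).
Local Notation B1 := (@unit_disc R).
Local Notation nu := (@leb2 R).
Local Notation mfun D f := (measurable_fun (D : set plane) (f : plane -> R)).
Implicit Types (z : R * R) (f : R * R -> R).

Lemma is_derive1_continuous (F : R -> R) (x l : R) : is_derive x 1 F l -> {for x, continuous F}.
Proof. by move=> [dF _]; apply/differentiable_continuous; rewrite -derivable1_diffP. Qed.

Lemma continuous_within_itv (f : R -> R) (a b : R) :
  (forall x, a <= x <= b -> {for x, continuous f}) -> {within `[a, b], continuous f}.
Proof.
move=> fc; apply: continuous_in_subspaceT => x; rewrite inE /= in_itv /=.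
exact: fc.
Qed.

Lemma FTC_closed (F f : R -> R) (a b : R) : a < b ->
  (forall x, a <= x <= b -> is_derive x 1 F (f x)) ->
  (forall x, a <= x <= b -> {for x, continuous f}) ->
  (\int[mu]_(x in `[a, b]) (f x)%:E = (F b - F a)%:E)%E.
Proof.
move=> ab dF cf; rewrite EFinB; apply: continuous_FTC2 => //.
- exact: continuous_within_itv.
- split.
  + move=> x; rewrite in_itv /= => /andP[/ltW ax /ltW xb].
    by have [] := dF x (introT andP (conj ax xb)).
  + apply: cvg_at_right_filter; apply: (@is_derive1_continuous F a (f a)).
    by apply: dF; rewrite lexx ltW.
  + apply: cvg_at_left_filter; apply: (@is_derive1_continuous F b (f b)).
    by apply: dF; rewrite lexx ltW.
- move=> x; rewrite in_itv /= => /andP[/ltW ax /ltW xb].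
  by rewrite derive1E; have [_ ->] := dF x (introT andP (conj ax xb)).
Qed.

Lemma integral_disc_yx f : nu.-integrable B1 (EFin \o f) ->
  (\int[nu]_(z in B1) (f z)%:E =
   \int[mu]_y \int[mu]_x ((EFin \o f) \_ B1 (x, y)))%E.
Proof.
move=> /(integrable_mkcond _ (@measurable_unit_disc R)) fi.
rewrite integral_mkcond.
exact/esym/(integral21_prod_meas1 (f := (EFin \o f) \_ B1 : plane -> \bar R)).
Qed.

Lemma integral_disc_xy f : nu.-integrable B1 (EFin \o f) ->
  (\int[nu]_(z in B1) (f z)%:E =
   \int[mu]_x \int[mu]_y ((EFin \o f) \_ B1 (x, y)))%E.
Proof.
move=> /(integrable_mkcond _ (@measurable_unit_disc R)) fi.
rewrite integral_mkcond.
exact/esym/(integral12_prod_meas1 (f := (EFin \o f) \_ B1 : plane -> \bar R)).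
Qed.

Definition swap z : R * R := (z.2, z.1).

Lemma unit_disc_swap z : B1 (swap z) = B1 z.
Proof. by rewrite unit_discE /= /sqn /= addrC. Qed.

Lemma integral_disc_swap f : nu.-integrable B1 (EFin \o f) ->
  nu.-integrable B1 (EFin \o (f \o swap)) ->
  (\int[nu]_(z in B1) (f (swap z))%:E = \int[nu]_(z in B1) (f z)%:E)%E.
Proof.
move=> fi fsi; rewrite (integral_disc_yx fsi) (integral_disc_xy fi).
apply: eq_integral => y _; apply: eq_integral => x _.
rewrite !patchE /= (_ : ((x, y) \in B1) = ((y, x) \in B1)) //.
by apply/idP/idP; rewrite !inE -(unit_disc_swap (_, _)).
Qed.

(** One half of the divergence theorem: Fubini, and the fundamental theorem of calculus on each
    horizontal chord. The bound C / |z| admits a singularity at the origin, which lies on the single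
    chord y = 0. *)
Lemma integral_disc_dx (F f : R * R -> R) (C : R) :
  mfun B1 f -> (forall z, B1 z -> `|f z| <= C / enorm z) ->
  (forall x y : R, y != 0 -> x ^+ 2 + y ^+ 2 <= 1 ->
    is_derive x 1 (fun t => F (t, y)) (f (x, y))) ->
  (forall x y : R, y != 0 -> x ^+ 2 + y ^+ 2 <= 1 -> {for x, continuous (fun t : R => f (t, y))}) ->
  (forall y : R, -1 <= y <= 1 -> {for y, continuous (fun y : R =>
     F (Num.sqrt (1 - y ^+ 2), y) - F (- Num.sqrt (1 - y ^+ 2), y))}) ->
  (\int[nu]_(z in B1) (f z)%:E = \int[mu]_(y in `[(-1)%R, 1%R])
     (F (Num.sqrt (1 - y ^+ 2), y) - F (- Num.sqrt (1 - y ^+ 2), y))%:E)%E.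
Proof.
move=> mf fC dF cf cH; have fi := integrable_inv_enorm mf fC.
have fiT := fi; move/(integrable_mkcond _ (@measurable_unit_disc R)) : fiT => fiT.
set H := fun y : R => F (Num.sqrt (1 - y ^+ 2), y) - F (- Num.sqrt (1 - y ^+ 2), y) in cH *.
rewrite integral_disc_yx // [RHS]integral_mkcond.
apply: ae_eq_integral => //.
- exact: (measurable_fubini_G fiT).
- apply/(measurable_restrictT _ _).1 => //; apply/measurable_EFinP.
  apply: subspace_continuous_measurable_fun => //.
  exact: continuous_within_itv.
(* The chord y = 0 through the singularity is left out as a null set of values of y. *)
exists [set 0]; split => //; first exact: lebesgue_measure_set1.
move=> y /=; apply: contra_notP => /eqP y0 _.
rewrite [RHS]patchE; case: ifPn => [|]; rewrite ?inE ?notin_setE /= in_itv /= => y1.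
  have [ylt|yge] := ltP (y ^+ 2) 1; last first.
    have ye : y ^+ 2 = 1.
      by apply/eqP; rewrite eq_le yge andbT; move: y1 => /andP[h1 h2]; nra.
    rewrite /H ye subrr sqrtr0 oppr0 subrr integral0_eq // => x _.
    rewrite patchE memNset // unit_discE /= /sqn /= ye.
    by have := sqr_ge0 x; lra.
  have s0 : 0 < Num.sqrt (1 - y ^+ 2) by rewrite sqrtr_gt0 subr_gt0.
  set s := Num.sqrt (1 - y ^+ 2) in s0 *.
  have s2 : s ^+ 2 = 1 - y ^+ 2 by rewrite sqr_sqrtr // subr_ge0 ltW.
  have xs x : - s <= x <= s -> x ^+ 2 + y ^+ 2 <= 1.
    by move=> /andP[h1 h2]; nra.
  have -> : (\int[mu]_x ((EFin \o f) \_ B1 (x, y)) =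
             \int[mu]_(x in `](- s)%R, s[) (f (x, y))%:E)%E.
    rewrite [RHS]integral_mkcond; apply: eq_integral => x _; rewrite !patchE.
    rewrite (_ : ((x, y) \in B1) = (x \in `]-s, s[%classic)) //.
    rewrite unit_discE; apply/idP/idP; rewrite !inE /= in_itv /= /sqn /=.
      by move=> h; rewrite -ltr_norml -(@ltr_pXn2r _ 2) ?nnegrE ?(ltW s0) //
        real_normK ?num_real // s2; lra.
    rewrite -ltr_norml -(@ltr_pXn2r _ 2) ?nnegrE ?(ltW s0) //.
    by rewrite real_normK ?num_real // s2; lra.
  have mfs : measurable_fun `]-s, s[ (fun x => (f (x, y))%:E).
    apply/measurable_EFinP; apply: open_continuous_measurable_fun => //.
    move=> x; rewrite inE /= in_itv /= => /andP[/ltW h1 /ltW h2].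
    by apply: cf => //; apply: xs; rewrite h1.
  rewrite -(integral_itv_bndoo true false mfs).
  have ss : - s < s by lra.
  exact: (FTC_closed (F := fun t => F (t, y)) ss (fun x h => dF x y y0 (xs x h))
    (fun x h => cf x y y0 (xs x h))).
rewrite integral0_eq // => x _; rewrite patchE memNset // => /unit_disc_abs /= [_].
by rewrite ltr_norml => /andP[/ltW h1 /ltW h2]; apply: y1; rewrite h1.
Qed.

End DiscIntegrals.

(** * Changes of parameter on the circle *)

Section CircleIntegrals.
Variable R : realType.
Local Notation mu := (@lebesgue_measure R).
Implicit Types (f : R -> R) (F G : R * R -> R).

Lemma itv_continuous_integrable f (a b : R) : continuous f ->
  mu.-integrable `[a, b] (EFin \o f).
Proof.
move=> cf; apply: continuous_compact_integrable; first exact: segment_compact.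
exact: continuous_subspaceT.
Qed.

Lemma continuous_primitive f (M : R) : continuous f ->
  exists Phi : R -> R, forall x : R, `|x| < M -> is_derive x 1 Phi (f x).
Proof.
move=> cf; exists (fun x => \int[mu]_(t in `[(- M)%R, x]) f t) => x.
rewrite ltr_norml => /andP[Mx xM].
have [d1 d2] := continuous_FTC1_closed xM (itv_continuous_integrable (- M) M cf) Mx (cf x).
by apply: DeriveDef; [exact: d1|rewrite -derive1E; exact: d2].
Qed.

Lemma Rintegral_FTC f (Phi : R -> R) (a b : R) : a < b -> continuous f ->
  (forall x, a <= x <= b -> is_derive x 1 Phi (f x)) ->
  \int[mu]_(x in `[a, b]) f x = Phi b - Phi a.
Proof.
by move=> ab cf dP; rewrite /Rintegral (FTC_closed ab dP) // => x _; exact: cf.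
Qed.

Lemma circle_pt_continuous (t : R) :
  (cos t', sin t') @[t' --> t] --> ((cos t, sin t) : R * R).
Proof.
by apply: (@cvg_pair _ _ _ _ (nbhs (cos t)) (nbhs (sin t))); [exact: continuous_cos|exact: continuous_sin].
Qed.

Lemma is_derive_comp_affine (Phi : R -> R) (k c x l : R) :
  is_derive (k + c * x) 1 Phi l -> is_derive x 1 (fun x : R => Phi (k + c * x)) (c * l).
Proof.
move=> dP.
have dA : is_derive x 1 (fun x : R => k + c * x) c.
  by apply: is_derive_eq; rewrite /GRing.scale /=; ring.
by have := @is_derive1_comp R Phi (fun x : R => k + c * x) x _ _ dP dA; rewrite mulrC.
Qed.

(** For t in [- pi / 2, pi / 2], the angles t and pi - t run once over the circle, and so do pi / 2
    - t and t - pi / 2. The first pair comes from the chords in x, the second from those in y. *)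
Lemma integral_rotations (f1 f2 : R -> R) : continuous f1 -> continuous f2 ->
  (forall t, f1 (t + 2 * pi) = f1 t) -> (forall t, f2 (t + 2 * pi) = f2 t) ->
  \int[mu]_(t in `[- (pi / 2), pi / 2])
     (f1 t + f1 (pi - t) + f2 (pi / 2 - t) + f2 (t - pi / 2)) =
  \int[mu]_(t in `[0, 2 * pi]) (f1 t + f2 t).
Proof.
move=> c1 c2 p1 p2; have pi0 := @pi_gt0 R.
(* Primitives on (- 5 pi, 5 pi) leave room for the shift by 2 pi of angles in (- 3 pi, 3 pi). *)
have [P1 dP1] := continuous_primitive (5 * pi) c1.
have [P2 dP2] := continuous_primitive (5 * pi) c2.
have per (f Phi : R -> R) (t : R) : (forall t, f (t + 2 * pi) = f t) ->
    (forall x : R, `|x| < 5 * pi -> is_derive x 1 Phi (f x)) -> `|t| < 3 * pi ->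
    Phi (t + 2 * pi) - Phi t = Phi (2 * pi) - Phi 0.
  move=> pf dP t3; have r0 : `|0 : R| < 3 * pi by rewrite normr0; lra.
  suff : Phi (2 * pi + 1 * t) - Phi t = Phi (2 * pi + 1 * 0) - Phi 0.
    by rewrite mul1r mulr0 addr0 (addrC (2 * pi)).
  apply: (@mvt_eq R (fun t => Phi (2 * pi + 1 * t) - Phi t) (3 * pi) t 0 t3 r0) => x x3.
  have d1 : is_derive x 1 (fun x : R => Phi (2 * pi + 1 * x)) (1 * f (2 * pi + 1 * x)).
    apply: is_derive_comp_affine; apply: dP.
    by move: x3; rewrite mul1r !ltr_norml; lra.
  have d2 : is_derive x 1 Phi (f x).
    by apply: dP; move: x3; rewrite !ltr_norml; lra.
  by apply: is_derive_eq; rewrite !mul1r (addrC (2 * pi)) pf subrr.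
have cc (f : R -> R) (k c : R) : continuous f -> continuous (fun t : R => f (k + c * t)).
  move=> cf x; apply: (continuous_comp (f := fun t : R => k + c * t)); last exact: cf.
  by apply: cvgD; [exact: cvg_cst|apply: cvgMl_tmp; exact: cvg_id].
pose Psi t := P1 t - P1 (pi + (-1) * t) - P2 (pi / 2 + (-1) * t) + P2 (- (pi / 2) + 1 * t).
pose g t := f1 t + f1 (pi + (-1) * t) + f2 (pi / 2 + (-1) * t) + f2 (- (pi / 2) + 1 * t).
rewrite (_ : (fun t => _) = g); last first.
  by apply/funext => t; rewrite /g !mulN1r mul1r [- (pi / 2) + t]addrC.
have cg : continuous g.
  move=> x; apply: cvgD; last exact: cc.
  apply: cvgD; last exact: cc.
  by apply: cvgD; [exact: c1|exact: cc].
have dPsi x : - (pi / 2) <= x <= pi / 2 -> is_derive x 1 Psi (g x).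
  move=> /andP[x1 x2].
  have d1 : is_derive x 1 P1 (f1 x) by apply: dP1; rewrite ltr_norml; lra.
  have d2 : is_derive x 1 (fun x : R => P1 (pi + (-1) * x)) (-1 * f1 (pi + (-1) * x)).
    by apply: is_derive_comp_affine; apply: dP1; rewrite ltr_norml; lra.
  have d3 : is_derive x 1 (fun x : R => P2 (pi / 2 + (-1) * x)) (-1 * f2 (pi / 2 + (-1) * x)).
    by apply: is_derive_comp_affine; apply: dP2; rewrite ltr_norml; lra.
  have d4 : is_derive x 1 (fun x : R => P2 (- (pi / 2) + 1 * x)) (1 * f2 (- (pi / 2) + 1 * x)).
    by apply: is_derive_comp_affine; apply: dP2; rewrite ltr_norml; lra.
  by apply: is_derive_eq; rewrite /g; ring.
have d12 x : 0 <= x <= 2 * pi ->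
    is_derive x 1 (fun t => P1 t + P2 t) (f1 x + f2 x).
  move=> /andP[x1 x2].
  have d1 : is_derive x 1 P1 (f1 x) by apply: dP1; rewrite ltr_norml; lra.
  have d2 : is_derive x 1 P2 (f2 x) by apply: dP2; rewrite ltr_norml; lra.
  exact: is_derive_eq.
have c12 : continuous (fun t => f1 t + f2 t).
  by move=> x; apply: cvgD; [exact: c1|exact: c2].
have lt1 : - (pi / 2) < pi / 2 :> R by lra.
have lt2 : 0 < 2 * pi :> R by lra.
rewrite (Rintegral_FTC lt1 cg dPsi) (Rintegral_FTC lt2 c12 d12).
have := per f1 P1 (- (pi / 2)) p1 dP1; have := per f2 P2 (- pi) p2 dP2.
rewrite !normrN !ger0_norm; [|lra|lra] => H2 H1.
have {}H1 := H1 ltac:(lra); have {}H2 := H2 ltac:(lra).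
rewrite /Psi !mulN1r !mul1r !opprK.
have e1 : pi - pi / 2 = pi / 2 :> R by lra.
have e2 : pi / 2 - pi / 2 = 0 :> R by lra.
have e3 : - (pi / 2) + pi / 2 = 0 :> R by lra.
have e4 : pi + pi / 2 = - (pi / 2) + 2 * pi :> R by lra.
have e5 : pi / 2 + pi / 2 = - pi + 2 * pi :> R by lra.
have e6 : - (pi / 2) - pi / 2 = - pi :> R by lra.
rewrite e1 e2 e3 e4 e5 e6; lra.
Qed.

Lemma integral_sin_substitution (H : R -> R) :
  (forall y : R, -1 <= y <= 1 -> {for y, continuous H}) ->
  (\int[mu]_(y in `[(-1)%R, 1%R]) (H y)%:E =
   \int[mu]_(t in `[(- (pi / 2))%R, (pi / 2)%R]) (H (sin t) * cos t)%:E)%E.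
Proof.
move=> cH; have pi0 := @pi_gt0 R.
have sN : sin (- (pi / 2)) = -1 :> R by rewrite sinN sin_pihalf.
have ds : derive1 (@sin R) = cos.
  by apply/funext => t; rewrite derive1E; have [_ ->] := is_derive_sin t.
have := @integration_by_substitution_increasing R (@sin R) H (- (pi / 2)) (pi / 2).
rewrite sN sin_pihalf ds => ->.
- by apply: eq_integral => t _.
- lra.
- by move=> x y xI yI xy; rewrite ltr_sin.
- by move=> x _; exact: continuous_cos.
- by apply/cvg_ex; exists (cos (- (pi / 2))); apply: cvg_at_right_filter; exact: continuous_cos.
- by apply/cvg_ex; exists (cos (pi / 2)); apply: cvg_at_left_filter; exact: continuous_cos.
- split.
  + by move=> x _; exact: derivable_sin.
  + by apply: cvg_at_right_filter; exact: continuous_sin.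
  + by apply: cvg_at_left_filter; exact: continuous_sin.
- exact: continuous_within_itv.
Qed.

End CircleIntegrals.

(** * Green's formula for the mean over the unit circle *)

Section MeanIdentity.
Variable R : realType.
Local Notation plane := (measurableTypeR R * measurableTypeR R)%type.
Local Notation mu := (@lebesgue_measure R).
Local Notation B1 := (@unit_disc R).
Local Notation nu := (@leb2 R).
Local Notation mfun D f := (measurable_fun (D : set plane) (f : plane -> R)).
Implicit Types (A B : array R) (z : R * R).

(* First component of ((x A - y B) / |z|^2, (y A + x B) / |z|^2), the field whose
   divergence is integrated in [radial_mean]; the second one is obtained by
   exchanging the coordinates. *)
Definition flux A B z : R := (ev A z * z.1 - ev B z * z.2) * (sqn z)^-1.

Definition dflux A B z : R :=
  (ev (dX A) z * z.1 + ev A z - ev (dX B) z * z.2) * (sqn z)^-1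
  - (2 * z.1) * (ev A z * z.1 - ev B z * z.2) * (sqn z) ^-1 ^+ 2.

Lemma sqn_le1_obox z : sqn z <= 1 -> obox 2 z.
Proof.
rewrite /sqn => H; have H1 := sqr_ge0 z.1; have H2 := sqr_ge0 z.2.
by split; rewrite ltr_norml; apply/andP; split; nra.
Qed.

Lemma is_derive_flux A B (x y : R) : an 2 A -> an 2 B -> y != 0 -> x ^+ 2 + y ^+ 2 <= 1 ->
  is_derive x 1 (fun t => flux A B (t, y)) (dflux A B (x, y)).
Proof.
move=> aA aB y0 xy; have [/= x2 y2] := @sqn_le1_obox (x, y) xy.
have r1 : 1 < 2 :> R by lra.
have q0 : sqn (x, y) != 0.
  by rewrite gt_eqF // /sqn /= ltr_wpDl ?sqr_ge0 // exprn_even_gt0.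
have dA : is_derive x 1 (fun t => ev A (t, y)) (ev (dX A) (x, y)).
  by apply: is_derive_slice1; apply: (is_derive_evX r1 aA).
have dB : is_derive x 1 (fun t => ev B (t, y)) (ev (dX B) (x, y)).
  by apply: is_derive_slice1; apply: (is_derive_evX r1 aB).
have dq : is_derive x 1 (fun t => sqn (t, y)) (2 * x).
  by rewrite /sqn /=; apply: is_derive_eq; rewrite /GRing.scale /=; ring.
have dV : is_derive x 1 (fun t => (sqn (t, y))^-1) (- (sqn (x, y)) ^- 2 *: (2 * x)).
  exact: (@is_deriveV R (fun t : R => sqn (t, y)) x (2 * x) 1 q0 dq).
rewrite /flux /dflux /=; apply: is_derive_eq.
by rewrite /GRing.scale /= exprVn; ring.
Qed.

Lemma slice1_continuous A (x y : R) : an 2 A -> `|x| < 2 -> `|y| < 2 ->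
  {for x, continuous (fun t : R => ev A (t, y))}.
Proof.
move=> aA x2 y2; apply: (@is_derive1_continuous _ _ _ (ev (dX A) (x, y))).
by apply: is_derive_slice1; apply: (is_derive_evX (ltr1n R 2) aA).
Qed.

Lemma dflux_slice_continuous A B (x y : R) : an 2 A -> an 2 B -> y != 0 ->
  x ^+ 2 + y ^+ 2 <= 1 -> {for x, continuous (fun t : R => dflux A B (t, y))}.
Proof.
move=> aA aB y0 xy; have [/= x2 y2] := @sqn_le1_obox (x, y) xy.
have q0 : sqn (x, y) != 0.
  by rewrite gt_eqF // /sqn /= ltr_wpDl ?sqr_ge0 // exprn_even_gt0.
have cA := slice1_continuous aA x2 y2; have cB := slice1_continuous aB x2 y2.
have cXA := slice1_continuous (an_dX aA) x2 y2.
have cXB := slice1_continuous (an_dX aB) x2 y2.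
have cid : {for x, continuous (fun t : R => t)} by exact: cvg_id.
have cc (k : R) : {for x, continuous (fun _ : R => k)} by exact: cvg_cst.
have cM (f g : R -> R) : {for x, continuous f} -> {for x, continuous g} ->
    {for x, continuous (fun t : R => f t * g t)} by exact: cvgM.
have cD (f g : R -> R) : {for x, continuous f} -> {for x, continuous g} ->
    {for x, continuous (fun t : R => f t + g t)} by exact: cvgD.
have csub (f g : R -> R) : {for x, continuous f} -> {for x, continuous g} ->
    {for x, continuous (fun t : R => f t - g t)} by exact: cvgB.
have cV : {for x, continuous (fun t : R => (sqn (t, y))^-1)}.
  have cq : {for x, continuous (fun t : R => t * t + y ^+ 2)}.
    by apply: cD; [exact: cM|exact: cc].
  by apply: cvgV => //; exact: cq.
have cN : {for x, continuous (fun t : R => ev A (t, y) * t - ev B (t, y) * y)}.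
  exact: (csub _ _ (cM _ _ cA cid) (cM _ _ cB (cc y))).
have cL : {for x, continuous (fun t : R =>
    ev (dX A) (t, y) * t + ev A (t, y) - ev (dX B) (t, y) * y)}.
  exact: (csub _ _ (cD _ _ (cM _ _ cXA cid) cA) (cM _ _ cXB (cc y))).
have c2 : {for x, continuous (fun t : R => 2 * t * (ev A (t, y) * t - ev B (t, y) * y))}.
  exact: (cM _ _ (cM _ _ (cc 2) cid) cN).
exact: (csub _ _ (cM _ _ cL cV) (cM _ _ c2 (cM _ _ cV cV))).
Qed.

Lemma mfun_dflux A B : an 2 A -> an 2 B -> mfun B1 (dflux A B).
Proof.
move=> aA aB; have r1 : 1 < 2 :> R by lra.
have m c : an 2 c -> mfun B1 (ev c).
  by move=> ac; apply: (mfun_ev ac r1); apply: unit_disc_obox; lra.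
have mq : mfun B1 (fun z => (sqn z)^-1) by apply: mfunV; exact: mfun_sqn.
have m1 := @mfun_fst R B1; have m2 := @mfun_snd R B1.
have mA := m _ aA; have mB := m _ aB; have mXA := m _ (an_dX aA); have mXB := m _ (an_dX aB).
have mN : mfun B1 (fun z => ev A z * z.1 - ev B z * z.2).
  by apply: mfunB; apply: mfunM.
apply: mfunB.
  by apply: mfunM => //; apply: mfunB; [apply: mfunD => //|]; apply: mfunM.
apply: mfunM; last exact: mfunX.
by apply: mfunM => //; apply: mfunM.
Qed.

(** Vanishing at the origin, A and B are O(|z|) there, so that each term of the derivative is O(1 /
    |z|). *)
Lemma dflux_bound A B : an 2 A -> an 2 B -> A 0%N 0%N = 0 -> B 0%N 0%N = 0 ->
  exists C, forall z, B1 z -> `|dflux A B z| <= C / enorm z.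
Proof.
move=> aA aB A0 B0.
have [L [L0 HL]] := ev_lipschitz (lexx 1) (ltr1n R 2) aA.
have [M [M0 HM]] := ev_lipschitz (lexx 1) (ltr1n R 2) aB.
have [K HK] : absconv 1 (dX A) by apply: an_dX aA _ _ _; lra.
have [N HN] : absconv 1 (dX B) by apply: an_dX aB _ _ _; lra.
exists (K + 2 * L + N + 4 * (L + M)) => z Bz.
have [z1 z2] := unit_disc_abs Bz.
have bz : inbox 1 z by split; exact: ltW.
have b0 : inbox 1 ((0, 0) : R * R) by split; rewrite normr0.
set r := enorm z.
have r0 : 0 <= r by exact: sqrtr_ge0.
have xr : `|z.1| <= r.
  by rewrite -sqrtr_sqr; apply: ler_wsqrtr; rewrite lerDl sqr_ge0.
have yr : `|z.2| <= r.
  by rewrite -sqrtr_sqr; apply: ler_wsqrtr; rewrite lerDr sqr_ge0.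
have qE : sqn z = r ^+ 2 by rewrite sqr_enorm.
have [r_eq0|rn0] := eqVneq r 0.
  by rewrite /dflux qE r_eq0 expr0n /= invr0 expr0n /= !mulr0 subrr normr0.
have rp : 0 < r by rewrite lt_neqAle eq_sym rn0.
have hA : `|ev A z| <= 2 * L * r.
  have := HL z (0, 0) bz b0; rewrite ev0 A0 !subr0 => /le_trans; apply.
  nra.
have hB : `|ev B z| <= 2 * M * r.
  have := HM z (0, 0) bz b0; rewrite ev0 B0 !subr0 => /le_trans; apply.
  nra.
have hXA := ev_le bz HK; have hXB := ev_le bz HN.
have n1 : `|ev (dX A) z * z.1 + ev A z - ev (dX B) z * z.2| <= (K + 2 * L + N) * r.
  apply: le_trans (ler_normB _ _) _; apply: le_trans (lerD (ler_normD _ _) (lexx _)) _.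
  rewrite !normrM.
  have := ler_pM (normr_ge0 _) (normr_ge0 _) hXA xr.
  have := ler_pM (normr_ge0 _) (normr_ge0 _) hXB yr.
  lra.
have n2 : `|ev A z * z.1 - ev B z * z.2| <= 2 * (L + M) * r ^+ 2.
  apply: le_trans (ler_normB _ _) _; rewrite !normrM.
  have := ler_pM (normr_ge0 _) (normr_ge0 _) hA xr.
  have := ler_pM (normr_ge0 _) (normr_ge0 _) hB yr.
  lra.
rewrite /dflux qE; apply: le_trans (ler_normB _ _) _.
have p2 : 0 <= r ^- 2 by rewrite invr_ge0 exprn_ge0.
rewrite [X in X + _]normrM (ger0_norm p2) [X in _ + X]normrM.
rewrite (ger0_norm (exprn_ge0 2 p2)) (normrM (2 * z.1)) (normrM 2) normr_nat.
have -> : (K + 2 * L + N + 4 * (L + M)) / r =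
    (K + 2 * L + N) * r * r ^- 2 + 2 * r * (2 * (L + M) * r ^+ 2) * r ^- 2 ^+ 2.
  by field.
apply: lerD; first by rewrite ler_wpM2r.
rewrite ler_wpM2r ?exprn_ge0 //.
by apply: ler_pM; rewrite ?mulr_ge0 // ler_wpM2l.
Qed.

Lemma flux_continuous A B z : an 2 A -> an 2 B -> sqn z = 1 ->
  {for z, continuous (flux A B)}.
Proof.
move=> aA aB z1; have z2 : obox 2 z by apply: sqn_le1_obox; rewrite z1.
have r1 : 1 < 2 :> R by lra.
have cA : ev A t @[t --> z] --> ev A z by exact: (continuous_ev r1 aA z2).
have cB : ev B t @[t --> z] --> ev B z by exact: (continuous_ev r1 aB z2).
have c1 : t.1 @[t --> z] --> z.1 by exact: cvg_fst.
have c2 : t.2 @[t --> z] --> z.2 by exact: cvg_snd.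
apply: cvgM; first by apply: cvgB; apply: cvgM.
apply: cvgV; first by rewrite z1 oner_eq0.
by apply: cvgD; apply: cvgM.
Qed.

Lemma flux_graph_continuous A B (e y : R) : an 2 A -> an 2 B -> e ^+ 2 = 1 -> -1 <= y <= 1 ->
  {for y, continuous (fun y : R => flux A B (e * Num.sqrt (1 - y ^+ 2), y))}.
Proof.
move=> aA aB e1 y1.
have y2 : 0 <= 1 - y ^+ 2 by move: y1 => /andP[? ?]; nra.
have z1 : sqn (e * Num.sqrt (1 - y ^+ 2), y) = 1.
  by rewrite /sqn /= exprMn e1 mul1r sqr_sqrtr // subrK.
have cz : (e * Num.sqrt (1 - t ^+ 2), t) @[t --> y] -->
    ((e * Num.sqrt (1 - y ^+ 2), y) : R * R).
  apply: (@cvg_pair _ _ _ _ (nbhs (e * Num.sqrt (1 - y ^+ 2))) (nbhs y)); last exact: cvg_id.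
  apply: cvgMl_tmp.
  apply: (continuous_comp (f := fun t : R => 1 - t ^+ 2)); last exact: sqrt_continuous.
  by apply: cvgB; [exact: cvg_cst|exact: exprn_continuous].
exact: (cvg_comp _ _ cz (flux_continuous aA aB z1)).
Qed.

Lemma flux_circle_continuous A B (p : R -> R * R) (t : R) : an 2 A -> an 2 B ->
  sqn (p t) = 1 -> p t' @[t' --> t] --> p t -> {for t, continuous (fun t : R => flux A B (p t))}.
Proof.
by move=> aA aB pt cp; exact: (cvg_comp _ _ cp (flux_continuous aA aB pt)).
Qed.

(** With y = sin t the ends of the chord are (cos t, sin t) and (- cos t, sin t). *)
Lemma integral_dflux A B : an 2 A -> an 2 B -> A 0%N 0%N = 0 -> B 0%N 0%N = 0 ->
  \int[nu]_(z in B1) dflux A B z = \int[mu]_(t in `[- (pi / 2), pi / 2])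
    ((flux A B (cos t, sin t) - flux A B (- cos t, sin t)) * cos t).
Proof.
move=> aA aB A0 B0; have [C HC] := dflux_bound aA aB A0 B0.
have cH (y : R) : -1 <= y <= 1 -> {for y, continuous (fun y : R =>
    flux A B (Num.sqrt (1 - y ^+ 2), y) - flux A B (- Num.sqrt (1 - y ^+ 2), y))}.
  move=> y1; have c1 := flux_graph_continuous aA aB (expr1n _ 2) y1.
  have e1 : (-1) ^+ 2 = 1 :> R by rewrite sqrrN expr1n.
  have c2 := flux_graph_continuous aA aB e1 y1.
  rewrite (_ : (fun y : R => _) = (fun y : R => flux A B (1 * Num.sqrt (1 - y ^+ 2), y) -
     flux A B (-1 * Num.sqrt (1 - y ^+ 2), y))); last first.
    by apply/funext => t; rewrite mul1r mulN1r.
  by apply: cvgB; [exact: c1|exact: c2].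
rewrite /Rintegral; congr fine.
rewrite (integral_disc_dx (F := flux A B) (mfun_dflux aA aB) HC
  (fun x y y0 xy => is_derive_flux aA aB y0 xy)
  (fun x y y0 xy => dflux_slice_continuous aA aB y0 xy) cH).
rewrite integral_sin_substitution //; apply: eq_integral => t.
rewrite inE /= in_itv /= => tI; congr (_ * _)%:E.
have -> : Num.sqrt (1 - sin t ^+ 2) = cos t; last by [].
rewrite -(cos2Dsin2 t) addrK sqrtr_sqr ger0_norm //.
exact: cos_ge0_pihalf.
Qed.

Lemma an_opp_transpose B : an 2 B -> an 2 (- transpose B).
Proof. by move=> aB; apply: anN; exact: an_transpose. Qed.

Lemma ev_swap A z : ev (transpose A) (swap z) = ev A z.
Proof. exact: ev_transpose. Qed.

Lemma ev_swapN A z : an 2 A -> obox 2 z -> ev (- transpose A) (swap z) = - ev A z.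
Proof.
move=> aA z2; rewrite (evN_an (ltr1n R 2) (an_transpose aA)) ?ev_swap //.
by case: z2.
Qed.

Lemma sqn_swap z : sqn (swap z) = sqn z.
Proof. by rewrite /sqn addrC. Qed.

Lemma enorm_swap z : enorm (swap z) = enorm z.
Proof. by rewrite /enorm addrC. Qed.

Lemma sqn_circle (t : R) : sqn (cos t, sin t) = 1.
Proof. exact: cos2Dsin2. Qed.

(** The divergence theorem for the field described at [flux]: its normal component on the unit
    circle is A, and z / |z|^2 and z^perp / |z|^2 are divergence free, so only derivatives of A and
    B remain inside. *)
Lemma radial_mean A B : an 2 A -> an 2 B -> A 0%N 0%N = 0 -> B 0%N 0%N = 0 ->
  \int[nu]_(z in B1) ((z.1 * ev (dX A) z + z.2 * ev (dY A) z
     + z.1 * ev (dY B) z - z.2 * ev (dX B) z) * (sqn z)^-1) =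
  \int[mu]_(t in `[0, 2 * pi]) ev A (cos t, sin t).
Proof.
move=> aA aB A0 B0; have r1 : 1 < 2 :> R by lra.
have mB := @measurable_unit_disc R.
have aA' := an_transpose aA; have aB' := an_opp_transpose aB.
have B0' : (- transpose B) 0%N 0%N = 0 by rewrite -[LHS]/(- B 0%N 0%N) B0 oppr0.
have [C HC] := dflux_bound aA aB A0 B0.
have [C' HC'] := dflux_bound aA' aB' A0 B0'.
have m1 := mfun_dflux aA aB; have m2 := mfun_dflux aA' aB'.
have i1 := integrable_inv_enorm m1 HC; have i2 := integrable_inv_enorm m2 HC'.
(* The y-derivative of the second component of the field; exchanging the coordinates turns it into a
   [dflux]. *)
pose g z := (ev (dY A) z * z.2 + ev A z + ev (dY B) z * z.1) * (sqn z)^-1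
  - (2 * z.2) * (ev A z * z.2 + ev B z * z.1) * (sqn z)^-1 ^+ 2.
have gE z : obox 2 z -> dflux (transpose A) (- transpose B) (swap z) = g z.
  move=> z2; rewrite /dflux /g sqn_swap (ev_swapN aB z2) (ev_swap A).
  have -> : ev (dX (transpose A)) (swap z) = ev (dY A) z by exact: (ev_swap (dY A)).
  have -> : ev (dX (- transpose B)) (swap z) = - ev (dY B) z.
    have -> : dX (- transpose B) = - transpose (dY B) by rewrite dXN.
    by rewrite ev_swapN //; exact: an_dY.
  by rewrite /=; ring.
have mev c : an 2 c -> mfun B1 (ev c).
  by move=> ac; apply: (mfun_ev ac r1); apply: unit_disc_obox; lra.
have mf1 := @mfun_fst R B1; have mf2 := @mfun_snd R B1.
have mg : mfun B1 g.
  have mq : mfun B1 (fun z => (sqn z)^-1) by apply: mfunV; exact: mfun_sqn.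
  have mA := mev _ aA; have mB' := mev _ aB.
  have mYA := mev _ (an_dY aA); have mYB := mev _ (an_dY aB).
  apply: mfunB.
    by apply: mfunM => //; apply: mfunD; [apply: mfunD => //|]; apply: mfunM.
  apply: mfunM; last exact: mfunX.
  by apply: mfunM; [exact: mfunM|apply: mfunD; apply: mfunM].
have swB z : B1 z -> B1 (swap z) by rewrite unit_disc_swap.
have gC z : B1 z -> `|g z| <= C' / enorm z.
  move=> Bz; rewrite -gE; last by apply: unit_disc_obox Bz; lra.
  by rewrite -enorm_swap; apply: HC'; exact: swB.
have ig := integrable_inv_enorm mg gC.
have Ig : \int[nu]_(z in B1) g z = \int[nu]_(z in B1) dflux (transpose A) (- transpose B) z.
  rewrite /Rintegral; congr fine.
  have ig' : nu.-integrable B1 (EFin \o (dflux (transpose A) (- transpose B) \o @swap R)).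
    apply: (eq_integrable mB _ _ _ ig) => z; rewrite inE => Bz /=; rewrite gE //.
    by apply: unit_disc_obox Bz; lra.
  rewrite -(integral_disc_swap i2 ig'); apply: eq_integral => z; rewrite inE => Bz.
  by rewrite gE //; apply: unit_disc_obox Bz; lra.
transitivity (\int[nu]_(z in B1) (dflux A B z + g z)).
  apply: eq_Rintegral => z _; rewrite /dflux /g.
  (* At the origin both sides vanish because the inverse of 0 is 0. *)
  have [q0|q0] := eqVneq (sqn z) 0; first by rewrite q0 invr0 !mulr0 expr0n /= !mulr0 subrr addr0.
  rewrite /sqn in q0 *; field; exact: q0.
rewrite RintegralD // Ig (integral_dflux aA aB A0 B0) (integral_dflux aA' aB' A0 B0').
pose f1 t := flux A B (cos t, sin t) * cos t.
pose f2 t := flux (transpose A) (- transpose B) (sin t, cos t) * sin t.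
have cc (t : R) : (cos t', sin t') @[t' --> t] --> ((cos t, sin t) : R * R).
  exact: circle_pt_continuous.
have cs (t : R) : (sin t', cos t') @[t' --> t] --> ((sin t, cos t) : R * R).
  by apply: (@cvg_pair _ _ _ _ (nbhs (sin t)) (nbhs (cos t)));
    [exact: continuous_sin|exact: continuous_cos].
have cf1 : continuous f1.
  move=> t; apply: cvgM; last exact: continuous_cos.
  by apply: (flux_circle_continuous aA aB _ (cc t)); exact: sqn_circle.
have cf2 : continuous f2.
  move=> t; apply: cvgM; last exact: continuous_sin.
  by apply: (flux_circle_continuous aA' aB' _ (cs t)); rewrite /sqn /= addrC; exact: cos2Dsin2.
have s2 (t : R) : sin (t + 2 * pi) = sin t by rewrite mulr_natl sinD2pi.
have c2 (t : R) : cos (t + 2 * pi) = cos t by rewrite mulr_natl cosD2pi.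
have p1 t : f1 (t + 2 * pi) = f1 t by rewrite /f1 s2 c2.
have p2 t : f2 (t + 2 * pi) = f2 t by rewrite /f2 s2 c2.
have spi (t : R) : sin (pi - t) = sin t by rewrite sinB sinpi cospi; ring.
have cpi (t : R) : cos (pi - t) = - cos t by rewrite cosB sinpi cospi; ring.
have sh (t : R) : sin (pi / 2 - t) = cos t by rewrite sinB sin_pihalf cos_pihalf; ring.
have ch (t : R) : cos (pi / 2 - t) = sin t by rewrite cosB sin_pihalf cos_pihalf; ring.
have sh' (t : R) : sin (t - pi / 2) = - cos t by rewrite sinB sin_pihalf cos_pihalf; ring.
have ch' (t : R) : cos (t - pi / 2) = sin t by rewrite cosB sin_pihalf cos_pihalf; ring.
transitivity (\int[mu]_(t in `[- (pi / 2), pi / 2])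
     (f1 t + f1 (pi - t) + f2 (pi / 2 - t) + f2 (t - pi / 2))).
  have cf (f : R -> R) (k c : R) : continuous f -> continuous (fun t : R => f (k + c * t)).
    move=> ff x; apply: (continuous_comp (f := fun t : R => k + c * t)); last exact: ff.
    by apply: cvgD; [exact: cvg_cst|apply: cvgMl_tmp; exact: cvg_id].
  have E1 : (fun t : R => (flux A B (cos t, sin t) - flux A B (- cos t, sin t)) * cos t) =
      (fun t : R => f1 t + f1 (pi + (-1) * t)).
    by apply/funext => t; rewrite mulN1r /f1 spi cpi; ring.
  have E2 : (fun t : R => (flux (transpose A) (- transpose B) (cos t, sin t)
      - flux (transpose A) (- transpose B) (- cos t, sin t)) * cos t) =
      (fun t : R => f2 (pi / 2 + (-1) * t) + f2 (- (pi / 2) + 1 * t)).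
    apply/funext => t; rewrite mulN1r mul1r [- (pi / 2) + t]addrC /f2 sh ch sh' ch'.
    ring.
  have C1 : continuous (fun t : R => f1 t + f1 (pi + (-1) * t)).
    by move=> t; apply: cvgD; [exact: cf1|exact: cf].
  have C2 : continuous (fun t : R => f2 (pi / 2 + (-1) * t) + f2 (- (pi / 2) + 1 * t)).
    by move=> t; apply: cvgD; exact: cf.
  rewrite E1 E2 -RintegralD //; [|exact: itv_continuous_integrable..].
  by apply: eq_Rintegral => t _; rewrite !mulN1r mul1r [- (pi / 2) + t]addrC addrA.
rewrite integral_rotations //; apply: eq_Rintegral => t _; rewrite /f1 /f2 /flux.
have q1 : sqn (sin t, cos t) = 1 by rewrite /sqn /= addrC; exact: cos2Dsin2.
rewrite q1 sqn_circle invr1 !mulr1 /=.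
have b2 : obox 2 ((cos t, sin t) : R * R) by apply: sqn_le1_obox; rewrite sqn_circle.
rewrite -[(sin t, cos t)]/(swap (cos t, sin t)) ev_swap (ev_swapN aB b2).
rewrite -[RHS]mulr1 -[X in _ = _ * X](cos2Dsin2 t); ring.
Qed.

End MeanIdentity.

(** * The profile F: its square integral over the disc and its moment *)

Section LogarithmicProfile.
Variable R : realType.
Local Notation plane := (measurableTypeR R * measurableTypeR R)%type.
Local Notation mu := (@lebesgue_measure R).
Local Notation B1 := (@unit_disc R).
Local Notation nu := (@leb2 R).
Local Notation mfun D f := (measurable_fun (D : set plane) (f : plane -> R)).
Implicit Types (z : R * R) (t : R).

(** Meant for functions of |x|, whose formula for a primitive holds only on x >= 0. For a primitive
    P of f on the whole interval, P(x) + P(- x) is constant by evenness. *)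
Lemma even_FTC (f Phi : R -> R) : continuous f -> (forall x, f (- x) = f x) ->
  (forall x : R, 0 <= x <= 1 -> is_derive x 1 Phi (f x)) ->
  (\int[mu]_(x in `[(-1)%R, 1%R]) (f x)%:E = (2 * (Phi 1 - Phi 0))%:E)%E.
Proof.
move=> cf evf dPhi; have [P dP] := continuous_primitive 2 cf.
have ltN11 : -1 < 1 :> R by lra.
have d11 (x : R) : -1 <= x <= 1 -> is_derive x 1 P (f x).
  by move=> x1; apply: dP; rewrite ltr_norml; lra.
rewrite (FTC_closed ltN11 d11) => [|x _]; last exact: cf.
have n1 : `|1 : R| < 2 by rewrite normr1; lra.
have n0 : `|0 : R| < 2 by rewrite normr0; lra.
have H1 : P 1 + P (0 + (-1) * 1) = P 0 + P (0 + (-1) * 0).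
  apply: (@mvt_eq R (fun x => P x + P (0 + (-1) * x)) 2 1 0 n1 n0) => x x2.
  have d1 := dP x x2.
  have d2 : is_derive x 1 (fun x : R => P (0 + (-1) * x)) (-1 * f (0 + (-1) * x)).
    by apply: is_derive_comp_affine; apply: dP; rewrite add0r mulN1r normrN.
  by apply: is_derive_eq; rewrite add0r !mulN1r evf subrr.
have H2 : P 1 - Phi 1 = P 0 - Phi 0.
  have dD (x : R) : 0 <= x <= 1 -> is_derive x 1 (fun x : R => P x - Phi x) 0.
    move=> x01; have d1 := dPhi x x01.
    have d2 : is_derive x 1 P (f x) by apply: d11; lra.
    by apply: is_derive_eq; rewrite subrr.
  have [||c _] := @MVT_segment R (fun x : R => P x - Phi x) (fun=> 0) 0 1 ler01.
  - by move=> x; rewrite in_itv /= => /andP[/ltW x0 /ltW x1]; apply: dD; rewrite x0.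
  - apply: derivable_within_continuous => x; rewrite in_itv /= => x01.
    by have [] := dD x x01.
  - by rewrite mul0r; lra.
congr (_%:E); move: H1; rewrite !add0r mulN1r mulr0 => H1; lra.
Qed.

Definition bump (j : nat) t : R := (1 - t ^+ 2) ^+ (16 ^ j).

Lemma bump_ge0 j t : t ^+ 2 <= 1 -> 0 <= bump j t.
Proof. by move=> t1; rewrite exprn_ge0 // subr_ge0. Qed.

Lemma bump_le1 j t : t ^+ 2 <= 1 -> bump j t <= 1.
Proof. by move=> t1; rewrite exprn_ile1 ?subr_ge0 // gerBl sqr_ge0. Qed.

Lemma bernoulli_ge (u : R) N : 0 <= u <= 1 -> 1 - N%:R * u <= (1 - u) ^+ N.
Proof.
move=> /andP[u0 u1]; elim: N => [|N IH]; first by rewrite mul0r subr0 expr0.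
rewrite exprS -natr1; apply: le_trans (ler_wpM2l _ IH); last lra.
have : 0 <= u * (N%:R * u) by rewrite !mulr_ge0.
nra.
Qed.

Lemma bernoulli_le (u : R) N : 0 <= u <= 1 -> (1 - u) ^+ N * (1 + N%:R * u) <= 1.
Proof.
move=> /andP[u0 u1]; elim: N => [|N IH]; first by rewrite mul0r addr0 expr0 mulr1.
rewrite exprS -natr1; have p0 : 0 <= (1 - u) ^+ N by rewrite exprn_ge0 // subr_ge0.
apply: le_trans IH; rewrite mulrAC [leLHS]mulrC ler_wpM2l //.
have : 0 <= N%:R * u by rewrite mulr_ge0.
nra.
Qed.

Lemma bump_lower j t : 16 ^+ j.+1 * t ^+ 2 <= 1 -> 1 / 2 <= bump j t.
Proof.
move=> jt; have p1 : 1 <= 16 ^+ j :> R by rewrite exprn_ege1 //; lra.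
have t0 := sqr_ge0 t.
have t1 : 0 <= t ^+ 2 <= 1 by rewrite t0 /=; move: jt; rewrite exprS; nra.
apply: le_trans (bernoulli_ge (16 ^ j) t1).
by move: jt; rewrite natrX exprS; lra.
Qed.

(** A majorant of the bumps in x y whose iterated integrals are elementary. *)
Definition hat (K x y : R) : R := 2 / (1 + K * (`|x| * `|y|)) ^+ 2.

(** With u = |x y| and K = 4^j, Bernoulli gives (1 - u^2)^(K^2) <= 1 / (1 + K^2 u^2), and (1 + K
    u)^2 <= 2 (1 + K^2 u^2). *)
Lemma bump_hat j (x y : R) : `|x| <= 1 -> `|y| <= 1 ->
  bump j (x * y) <= hat (4 ^+ j) x y.
Proof.
move=> x1 y1.
have u0 : 0 <= `|x| * `|y| by rewrite mulr_ge0.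
have u1 : `|x| * `|y| <= 1 by rewrite -[leRHS]mulr1 ler_pM.
have xyE : (x * y) ^+ 2 = (`|x| * `|y|) ^+ 2 by rewrite -normrM real_normK // num_real.
set u := `|x| * `|y| in u0 u1 xyE *.
have u2 : 0 <= u ^+ 2 <= 1 by rewrite sqr_ge0 exprn_ile1.
have K0 : 0 <= 4 ^+ j :> R by rewrite exprn_ge0.
have KE : (16 ^ j)%:R = (4 ^+ j) ^+ 2 :> R.
  by rewrite natrX -exprM mulnC exprM; congr (_ ^+ _); rewrite expr2 -natrM.
rewrite /hat -/u ler_pdivlMr; last by rewrite exprn_gt0 // ltr_pwDl // mulr_ge0.
have := bernoulli_le (16 ^ j) u2; rewrite -xyE -/(bump j (x * y)) KE xyE => H.
have b0 : 0 <= bump j (x * y) by apply: bump_ge0; rewrite xyE; case/andP: u2.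
have : 0 <= bump j (x * y) * (1 - 4 ^+ j * u) ^+ 2 by rewrite mulr_ge0 // sqr_ge0.
nra.
Qed.

Lemma norm_continuous1 : continuous (fun x : R => `|x|).
Proof. by move=> x; exact: norm_continuous. Qed.

Lemma integral_hat_inner (K x : R) : 0 <= K ->
  (\int[mu]_(y in `[(-1)%R, 1%R]) (hat K x y)%:E = (4 / (1 + K * `|x|))%:E)%E.
Proof.
move=> K0; set k := K * `|x|; have k0 : 0 <= k by rewrite mulr_ge0.
have pos (y : R) : 0 <= y -> 0 < 1 + k * y by move=> y0; rewrite ltr_pwDl // mulr_ge0.
have cf : continuous (fun y : R => hat K x y).
  move=> y; apply: cvgMl_tmp; apply: cvgV.
    by rewrite /= expf_neq0 // gt_eqF // mulrA; exact: pos.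
  have cX : 1 + K * (`|x| * `|t|) @[t --> y] --> 1 + K * (`|x| * `|y|).
    apply: cvgD; first exact: cvg_cst.
    by apply: cvgMl_tmp; apply: cvgMl_tmp; exact: norm_continuous1.
  exact: (cvgM cX cX).
have ef (y : R) : hat K x (- y) = hat K x y by rewrite /hat normrN.
have df (y : R) : 0 <= y <= 1 ->
    is_derive y 1 (fun y : R => 2 * (y * (1 + k * y)^-1)) (hat K x y).
  move=> /andP[y0 y1]; have p := pos y y0.
  have d1 : is_derive y 1 (fun y : R => 1 + k * y) k.
    by apply: is_derive_eq; rewrite /GRing.scale /=; ring.
  have n0 : 1 + k * y != 0 by rewrite gt_eqF.
  have d2 := @is_deriveV R (fun y : R => 1 + k * y) y k 1 n0 d1.
  apply: is_derive_eq; rewrite /hat (ger0_norm y0) mulrA -/k /GRing.scale /=.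
  by field.
rewrite (even_FTC cf ef df); congr (_%:E).
by rewrite mul0r mulr0 subr0 mulr1 mul1r mulrA -natrM.
Qed.

Lemma integral_hat_outer (K : R) : 0 < K ->
  (\int[mu]_(x in `[(-1)%R, 1%R]) (4 / (1 + K * `|x|))%:E = (8 * ln (1 + K) / K)%:E)%E.
Proof.
move=> K0; have pos (y : R) : 0 <= y -> 0 < 1 + K * y.
  by move=> y0; rewrite ltr_pwDl // mulr_ge0 // ltW.
have cf : continuous (fun x : R => 4 / (1 + K * `|x|)).
  move=> y; apply: cvgMl_tmp; apply: cvgV; first by rewrite /= gt_eqF // pos.
  apply: cvgD; first exact: cvg_cst.
  by apply: cvgMl_tmp; exact: norm_continuous1.
have ef (y : R) : 4 / (1 + K * `|- y|) = 4 / (1 + K * `|y|) by rewrite normrN.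
have df (y : R) : 0 <= y <= 1 ->
    is_derive y 1 (fun x : R => 4 * (ln (1 + K * x) / K)) (4 / (1 + K * `|y|)).
  move=> /andP[y0 y1]; have p := pos y y0.
  have d1 : is_derive y 1 (fun y : R => 1 + K * y) K.
    by apply: is_derive_eq; rewrite /GRing.scale /=; ring.
  have d2 := is_derive1_ln p.
  have d3 := @is_derive1_comp R (@ln R) (fun y : R => 1 + K * y) y _ _ d2 d1.
  have d4 : is_derive y 1 (fun y : R => ln (1 + K * y)) ((1 + K * y)^-1 * K) by exact: d3.
  apply: is_derive_eq; rewrite (ger0_norm y0) /GRing.scale /=.
  by field; rewrite !gt_eqF.
rewrite (even_FTC cf ef df); congr (_%:E).
by rewrite mulr0 addr0 ln1 mul0r mulr0 subr0 mulr1; ring.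
Qed.

Lemma mfun_hat D (K : R) : mfun D (fun z => hat K z.1 z.2).
Proof.
apply: mfunM => //; apply: mfunV; apply: mfunX; apply: mfunD => //; apply: mfunM => //.
by apply: mfunM; apply: measurableT_comp; [|exact: mfun_fst| |exact: mfun_snd].
Qed.

Lemma hat_ge0 (K x y : R) : 0 <= hat K x y.
Proof. by rewrite divr_ge0 // sqr_ge0. Qed.

(** The disc is enlarged to the square, where Tonelli applies. The logarithm reflects the area of
    the region |x y| <= 1 / K, which is of order ln K / K. *)
Lemma integral_hat (K : R) : 0 < K ->
  (\int[nu]_(z in B1) (hat K z.1 z.2)%:E <= (8 * ln (1 + K) / K)%:E)%E.
Proof.
move=> K0; have mB := @measurable_unit_disc R.
pose Q : set plane := [set z | -1 <= z.1 <= 1 /\ -1 <= z.2 <= 1].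
have mQ : measurable Q by exact: measurable_box.
apply: (@le_trans _ _ (\int[nu]_(z in Q) (hat K z.1 z.2)%:E)%E).
  apply: ge0_subset_integral => //.
  - by apply/measurable_EFinP; exact: mfun_hat.
  - by move=> z _; rewrite lee_fin hat_ge0.
  - by move=> z /unit_disc_abs [/ltW z1 /ltW z2]; split; rewrite -ler_norml.
rewrite integral_mkcond.
pose h : plane -> \bar R := (fun z : plane => (hat K z.1 z.2)%:E) \_ Q.
have mh : measurable_fun setT h.
  by apply/(measurable_restrictT _ _).1 => //; apply/measurable_EFinP; exact: mfun_hat.
have h0 z : (0 <= h z)%E by rewrite /h patchE; case: ifP => // _; rewrite lee_fin hat_ge0.
have -> : (\int[nu]_z ((fun z : plane => (hat K z.1 z.2)%:E) \_ Q) z =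
  \int[mu]_x \int[mu]_y h (x, y))%E by exact: (fubini_tonelli1 h mh h0).
rewrite -(integral_hat_outer K0) [leRHS]integral_mkcond le_eqVlt; apply/orP; left; apply/eqP.
apply: eq_integral => x _; rewrite [RHS]patchE; case: ifPn => [|] xI.
  rewrite -(integral_hat_inner x (ltW K0)) [RHS]integral_mkcond; apply: eq_integral => y _.
  rewrite /h !patchE; have -> : ((x, y) \in Q) = (y \in `[(-1)%R, 1%R]%classic) => //.
  move: xI; rewrite inE /= in_itv /= => xI.
  by apply/idP/idP; rewrite !inE /Q /= in_itv /= => // -[].
rewrite integral0_eq // => y _; rewrite /h patchE memNset // => -[/= x1 _].
by move: xI; rewrite notin_setE /= in_itv.
Qed.

Definition height (j : nat) : R := 2 ^+ j / j.+1%:R.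
Definition profile J t : R := \sum_(j < J) height j * bump j t.
Definition harmonic_sum J : R := \sum_(j < J) (j.+1%:R)^-1.
Definition height_sum J : R := \sum_(j < J) height j.

Lemma height_ge0 j : 0 <= height j.
Proof. by rewrite divr_ge0 ?exprn_ge0. Qed.

Lemma profile_ge0 J t : t ^+ 2 <= 1 -> 0 <= profile J t.
Proof. by move=> t1; apply: sumr_ge0 => j _; rewrite mulr_ge0 ?height_ge0 ?bump_ge0. Qed.

Lemma profile_le J t : t ^+ 2 <= 1 -> profile J t <= height_sum J.
Proof. by move=> t1; apply: ler_sum => j _; rewrite ler_piMr ?height_ge0 ?bump_le1. Qed.

(** Makes the square linear in the bumps. Adding the term h b to F changes the square by 2 F h b +
    (h b)^2, where F is at most the sum of its heights and b^2 <= b. *)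
Lemma profile_sqr J t : t ^+ 2 <= 1 ->
  profile J t ^+ 2 <= \sum_(j < J) 2 * height j * height_sum j.+1 * bump j t.
Proof.
move=> t1; elim: J => [|J IH]; first by rewrite /profile !big_ord0 expr0n.
rewrite /profile big_ord_recr [leRHS]big_ord_recr /= -/(profile J t).
have p0 := profile_ge0 J t1; have pl := profile_le J t1.
have h0 := height_ge0 J; have b0 := bump_ge0 J t1; have b1 := bump_le1 J t1.
rewrite sqrrD -addrA; apply: lerD; first exact: IH.
rewrite /height_sum big_ord_recr /= -/(height_sum J).
have e1 : profile J t * (height J * bump J t) <= height_sum J * (height J * bump J t).
  by rewrite ler_wpM2r // mulr_ge0.
have e2 : (height J * bump J t) ^+ 2 <= height J ^+ 2 * bump J t.
  by rewrite exprMn ler_wpM2l ?sqr_ge0 // expr2 ler_piMr.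
have e3 : 0 <= height J ^+ 2 * bump J t by rewrite mulr_ge0 ?sqr_ge0.
lra.
Qed.

Lemma ln2n_le n : ln (1 + 4 ^+ n) <= (2 * n).+1%:R :> R.
Proof.
have p4 : 1 <= 4 ^+ n :> R by rewrite exprn_ege1 //; lra.
apply: (@le_trans _ _ (ln (2 ^+ (2 * n).+1))).
  rewrite ler_ln ?posrE; [|lra|by rewrite exprn_gt0].
  by rewrite exprS exprM (_ : 2 ^+ 2 = 4 :> R); [lra|rewrite expr2 -natrM].
rewrite lnXn; last by lra.
rewrite -(mulr_natl (ln 2)) ler_piMr //.
have := @le_ln1Dx R 1; rewrite (_ : 1 + 1 = 2 :> R) //; apply; lra.
Qed.

(** Interchanging the sums, height i meets the geometric sum 2 2^-i - 2 2^-J, and 2^-i [height i] =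
    1 / (i + 1). *)
Lemma geometric_swap J :
  \sum_(j < J) 2 ^- j * height_sum j.+1 = 2 * harmonic_sum J - 2 * 2 ^- J * height_sum J :> R.
Proof.
elim: J => [|J IH]; first by rewrite /harmonic_sum /height_sum !big_ord0; ring.
rewrite big_ord_recr /= IH /harmonic_sum /height_sum !big_ord_recr /=.
rewrite -/(harmonic_sum J) -/(height_sum J) /height exprS.
by field; rewrite expf_neq0 // nat1r pnatr_eq0.
Qed.

Lemma bump_mfun j : mfun B1 (fun z => bump j (z.1 * z.2)).
Proof.
apply: mfunX; apply: mfunB => //; apply: mfunX.
by apply: mfunM; [exact: mfun_fst|exact: mfun_snd].
Qed.

Lemma profile_mfun J : mfun B1 (fun z => profile J (z.1 * z.2)).
Proof. by apply: measurable_sum => j; apply: mfunM => //; exact: bump_mfun. Qed.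

Lemma unit_disc_prod z : B1 z -> (z.1 * z.2) ^+ 2 <= 1.
Proof.
move=> /unit_disc_abs [/ltW z1 /ltW z2].
rewrite -[leLHS]real_normK ?num_real // normrM exprn_ile1 ?mulr_ge0 //.
by rewrite -[leRHS]mulr1 ler_pM.
Qed.

(** The logarithm ln (1 + 4^j) <= 2 (j + 1) cancels the denominator of [height j]; the j-th term
    becomes 32 2^-j [height_sum j.+1], and [geometric_swap] yields 64 S. *)
Lemma integral_profile_sqr J :
  (\int[nu]_(z in B1) (profile J (z.1 * z.2) ^+ 2)%:E <= (64 * harmonic_sum J)%:E)%E.
Proof.
have mB := @measurable_unit_disc R.
have c0 j : 0 <= 2 * height j * height_sum j.+1.
  by rewrite !mulr_ge0 ?height_ge0 // sumr_ge0 // => i _; exact: height_ge0.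
apply: (@le_trans _ _ (\int[nu]_(z in B1)
    \sum_(j < J) ((2 * height j * height_sum j.+1)%:E * (hat (4 ^+ j) z.1 z.2)%:E))%E).
  apply: ge0_le_integral => //.
  - by move=> z _; rewrite lee_fin sqr_ge0.
  - by apply/measurable_EFinP; apply: mfunX; exact: profile_mfun.
  - apply: emeasurable_sum => j; apply/measurable_EFinP; apply: mfunM => //.
    exact: mfun_hat.
  - move=> z Bz; under eq_bigr do rewrite -EFinM.
    rewrite sumEFin lee_fin; apply: le_trans (profile_sqr J (unit_disc_prod Bz)) _.
    apply: ler_sum => j _; rewrite ler_wpM2l //.
    by have [/ltW z1 /ltW z2] := unit_disc_abs Bz; exact: bump_hat.
rewrite ge0_integral_sum //; last 2 first.
- move=> j; apply/measurable_EFinP; apply: mfunM => //; exact: mfun_hat.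
- by move=> j z _; rewrite -EFinM lee_fin mulr_ge0 ?hat_ge0.
apply: (@le_trans _ _ (\sum_(j < J) (32 * (2 ^- j * height_sum j.+1))%:E)%E).
  apply: lee_sum => j _.
  rewrite ge0_integralZl ?lee_fin //.
  - have K0 : 0 < 4 ^+ j :> R by rewrite exprn_gt0.
    apply: le_trans (lee_wpmul2l _ (integral_hat K0)) _; first by rewrite lee_fin.
    rewrite -EFinM lee_fin.
    apply: (@le_trans _ _ (2 * height j * height_sum j.+1 * (8 * (2 * j.+1%:R) / 4 ^+ j))).
      rewrite ler_wpM2l // ler_wpM2r ?invr_ge0 ?(ltW K0) // ler_wpM2l //.
      apply: le_trans (ln2n_le j) _; rewrite -natrM ler_nat; lia.
    rewrite le_eqVlt; apply/orP; left; apply/eqP.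
    have -> : 4 ^+ j = 2 ^+ j * 2 ^+ j :> R by rewrite -exprMn -natrM.
    by rewrite /height; field; rewrite expf_neq0 // nat1r pnatr_eq0.
  - by apply/measurable_EFinP; exact: mfun_hat.
  - by move=> z _; rewrite lee_fin hat_ge0.
rewrite sumEFin lee_fin -mulr_sumr geometric_swap.
have : 0 <= 2 * 2 ^- J * height_sum J.
  by rewrite !mulr_ge0 ?invr_ge0 ?exprn_ge0 // sumr_ge0 // => i _; exact: height_ge0.
lra.
Qed.

(** A piece of the first quadrant at distance about 2^-j from the origin where x y <= 4^-(j+1), so
    that the j-th bump is at least 1 / 2. *)
Let cell j : set plane :=
  [set z | 0 <= z.1 <= 2 ^- j.+1 /\ 2 ^- j.+2 <= z.2 <= 2 ^- j.+1].

Lemma cell_disc j : cell j `<=` B1.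
Proof.
move=> z [/andP[a b] /andP[c d]]; rewrite unit_discE /= /sqn.
have h : 2 ^- j.+1 <= 1 / 2 :> R.
  rewrite exprS invfM div1r ler_piMr // invf_le1 ?exprn_gt0 //.
  by rewrite exprn_ege1 //; lra.
have p0 : 0 <= 2 ^- j.+2 :> R by rewrite invr_ge0 exprn_ge0.
nra.
Qed.

Lemma normr_fst_enorm z : `|z.1| <= enorm z.
Proof. by rewrite -sqrtr_sqr; apply: ler_wsqrtr; rewrite lerDl sqr_ge0. Qed.

Lemma normr_snd_enorm z : `|z.2| <= enorm z.
Proof. by rewrite -sqrtr_sqr; apply: ler_wsqrtr; rewrite lerDr sqr_ge0. Qed.

Lemma kernel_bound (b c C : R) z : `|b| <= C -> `|c| <= enorm z ->
  `|b * c * (sqn z)^-1| <= C / enorm z.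
Proof.
move=> bC cz; have [e0|en0] := eqVneq (enorm z) 0.
  by rewrite -sqr_enorm e0 expr0n /= invr0 !mulr0 normr0.
have ep : 0 < enorm z by rewrite lt_neqAle eq_sym en0 sqrtr_ge0.
have i0 : 0 <= (enorm z ^+ 2)^-1 by rewrite invr_ge0 sqr_ge0.
rewrite -sqr_enorm normrM normrM (ger0_norm i0).
have -> : C / enorm z = C * enorm z * enorm z ^- 2 by field.
by rewrite ler_wpM2r // ler_pM.
Qed.

(** As G(y) y >= 0 nothing cancels, and the j-th term may be restricted to [cell j]. There the bump
    and G are at least 1 / 2 and y / |z|^2 >= 2^j / 2; with the area 4^-j / 8 of the cell this gives
    1 / (64 (j + 1)). *)
Lemma integral_profile_lower J (G : R -> R) (p : R) : 0 <= p ->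
  mfun B1 (fun z => G z.2) ->
  (forall y : R, `|y| < 1 -> 0 <= G y * y) -> (forall y : R, `|y| < 1 -> `|G y| <= p) ->
  (forall y : R, 2 ^- J.+1 <= y -> y < 1 -> 1 / 2 <= G y) ->
  harmonic_sum J / 64 <=
  \int[nu]_(z in B1) (profile J (z.1 * z.2) * G z.2 * z.2 * (sqn z)^-1).
Proof.
move=> p0 mG Gy Gp Gl; have mB := @measurable_unit_disc R.
have mf : mfun B1 (fun z => profile J (z.1 * z.2) * G z.2 * z.2 * (sqn z)^-1).
  apply: mfunM; last by apply: mfunV; exact: mfun_sqn.
  by apply: mfunM; [apply: mfunM => //; exact: profile_mfun|exact: mfun_snd].
have fC z : B1 z -> `|profile J (z.1 * z.2) * G z.2 * z.2 * (sqn z)^-1| <=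
    height_sum J * p / enorm z.
  move=> Bz; have [z1 z2] := unit_disc_abs Bz.
  have P0 := profile_ge0 J (unit_disc_prod Bz); have P1 := profile_le J (unit_disc_prod Bz).
  by apply: kernel_bound (normr_snd_enorm z); rewrite normrM (ger0_norm P0) ler_pM // Gp.
have fi := integrable_inv_enorm mf fC.
rewrite /Rintegral -lee_fin fineK; last exact: integrable_fin_num.
pose w j : R := height j * 2 ^+ j / 8.
have w0 j : 0 <= w j by rewrite divr_ge0 // mulr_ge0 ?height_ge0 ?exprn_ge0.
have mc j : measurable (cell j) by exact: measurable_box.
have m1 j : mfun B1 (\1_(cell j)) by exact: measurable_indic.
apply: (@le_trans _ _ (\int[nu]_(z in B1)
    \sum_(j < J) ((w j)%:E * (\1_(cell j) z)%:E))%E); last first.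
  apply: ge0_le_integral => //.
  - by move=> z _; apply: sume_ge0 => j _; rewrite -EFinM lee_fin mulr_ge0.
  - by apply: emeasurable_sum => j; apply/measurable_EFinP; apply: mfunM.
  - exact/measurable_EFinP.
  - move=> z Bz; under eq_bigr do rewrite -EFinM.
    have [z1 z2] := unit_disc_abs Bz.
    rewrite sumEFin lee_fin /profile !mulr_suml; apply: ler_sum => j _.
    have b0 := bump_ge0 j (unit_disc_prod Bz); have h0 := height_ge0 j.
    have Gy0 := Gy _ z2.
    rewrite indicE; case: (boolP (z \in cell j)) => [cz|_] /=; last first.
      rewrite mulr0 mulr_ge0 ?invr_ge0 ?sqn_ge0 //.
      by rewrite -mulrA mulr_ge0 // mulr_ge0.
    rewrite mulr1 /w; have := cz; rewrite inE => -[/andP[x0 xd] /andP[yd' yd]].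
    have d0 : 0 < 2 ^- j.+1 :> R by rewrite invr_gt0 exprn_gt0.
    have dh : 2 ^- j.+2 = 2 ^- j.+1 / 2 :> R by rewrite (exprS 2 j.+1) invfM mulrC.
    have bh : 1 / 2 <= bump j (z.1 * z.2).
      apply: bump_lower.
      have -> : 16 = (2 ^+ 2) ^+ 2 :> R by rewrite -!natrX.
      rewrite exprAC -exprMn exprn_ile1 //.
        by rewrite !mulr_ge0 // ?exprn_ge0 // (le_trans _ yd') // dh; lra.
      rewrite (exprAC 2 2) expr2 mulrACA.
      have qx : 2 ^+ j.+1 * z.1 <= 1 by rewrite mulrC -ler_pdivlMr ?exprn_gt0 // div1r.
      have qy : 2 ^+ j.+1 * z.2 <= 1 by rewrite mulrC -ler_pdivlMr ?exprn_gt0 // div1r.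
      have y0 : 0 <= z.2 by lra.
      by rewrite -[leRHS]mulr1 ler_pM // mulr_ge0 // exprn_ge0.
    (* The lowest cell, j = J - 1, starts at y = 2^-(J+1), whence the threshold in the hypothesis on
       G. *)
    have Gh : 1 / 2 <= G z.2.
      apply: Gl; last by move: z2; rewrite ltr_norml => /andP[].
      apply: le_trans yd'; rewrite lef_pV2 ?posrE ?exprn_gt0 //.
      have := ltn_ord j; rewrite -2!ltnS => jJ.
      by apply: ler_weXn2l => //; rewrite ler1n.
    have yq : 2 ^+ j / 2 <= z.2 * (sqn z)^-1.
      have q2 : 2 ^+ j * 2 ^- j.+1 = 1 / 2 :> R.
        by rewrite exprS; field; rewrite expf_neq0.
      have q0 : 0 < sqn z by rewrite /sqn; nra.
      rewrite ler_pdivlMr // /sqn.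
      have e1 : 2 ^+ j * z.1 ^+ 2 <= 2 ^- j.+1 / 2.
        apply: (@le_trans _ _ (2 ^+ j * (2 ^- j.+1 * 2 ^- j.+1))); last by rewrite mulrA q2; lra.
        by rewrite ler_wpM2l ?exprn_ge0 // expr2 ler_pM.
      have e2 : 2 ^+ j * z.2 ^+ 2 <= 2 ^- j.+1 / 2.
        apply: (@le_trans _ _ (2 ^+ j * (2 ^- j.+1 * 2 ^- j.+1))); last by rewrite mulrA q2; lra.
        by rewrite ler_wpM2l ?exprn_ge0 // expr2 ler_pM //; lra.
      lra.
    have -> : height j * 2 ^+ j / 8 = height j * (1 / 2) * (1 / 2) * (2 ^+ j / 2) by field.
    rewrite -(mulrA _ z.2); have p2 : 0 <= 2 ^+ j :> R by rewrite exprn_ge0.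
    have q2 : 0 <= 1 / 2 :> R by lra.
    apply: ler_pM => //; first by rewrite !mulr_ge0.
    by apply: ler_pM => //; [rewrite mulr_ge0|rewrite ler_wpM2l].
rewrite ge0_integral_sum //; last 2 first.
- by move=> j; apply/measurable_EFinP; apply: mfunM.
- by move=> j z _; rewrite -EFinM lee_fin mulr_ge0.
rewrite /harmonic_sum mulr_suml -sumEFin; apply: lee_sum => j _.
rewrite ge0_integralZl ?lee_fin //; last first.
  by apply/measurable_EFinP; exact: m1.
rewrite integral_indic // setIidl; last exact: cell_disc.
have d0 : 0 < 2 ^- j.+1 :> R by rewrite invr_gt0 exprn_gt0.
have dh : 2 ^- j.+2 = 2 ^- j.+1 / 2 :> R by rewrite (exprS 2 j.+1) invfM mulrC.
rewrite leb2_box; [|lra|lra].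
rewrite -EFinM lee_fin le_eqVlt; apply/orP; left; apply/eqP.
by rewrite /w /height dh exprS; field; rewrite expf_neq0 // nat1r pnatr_eq0.
Qed.

End LogarithmicProfile.

(** * Solutions of the linearised equation close to F(x y) G(y) *)

Section Construction.
Variable R : realType.
Implicit Types (c e h om : array R) (z : R * R).

(** The modes (k, k) all solve the same linear equation and can be superposed. C depends on the
    polynomial but not on s, so that s may be chosen afterwards. *)
Lemma polynomial_solution (a : nat -> R) n : exists2 C, 0 <= C & forall s : R, 1 <= s ->
  exists e, [/\ forall r, an r e, lap e = s ^+ 2 *: mixed e & forall z, inbox 1 z ->
    `|ev e z - (\sum_(k < n) a k * (z.1 * z.2) ^+ k) * ev (primitive_array s) (0, z.2)| <= C / s].
Proof.
elim: n => [|n [C C0 IH]].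
  exists 0 => // s s1; exists (fun _ _ => 0); split=> [r||z z1]; first exact: an0.
    apply/funext => i; apply/funext => j; rewrite -[RHS]/(s ^+ 2 * ((i%:R - j%:R) * 0)).
    by rewrite /lap /dX /dY !mulr0 addr0.
  by rewrite big_ord0 !mul0r ev_zero subr0 normr0.
have [D D0 HD] := mode_bound R n n.
exists (C + `|a n| * D); first by rewrite addr_ge0 // mulr_ge0.
move=> s s1; have [e [an_e lap_e ev_e]] := IH s s1.
have sn0 : s != 0 by apply/eqP => s0; lra.
exists (e + a n *: mode s n n); split => [r||z z1].
- by apply: anD => //; apply: anZ; exact: an_mode.
- rewrite lapD lapZ lap_e lap_mode //.
  apply/funext => i; apply/funext => j.
  rewrite -[LHS]/(s ^+ 2 * ((i%:R - j%:R) * e i j)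
    + a n * (s ^+ 2 * ((i%:R - j%:R) * mode s n n i j))).
  rewrite -[RHS]/(s ^+ 2 * ((i%:R - j%:R) * (e i j + a n * mode s n n i j))).
  ring.
- have r2 : 1 < 2 :> R by lra.
  have zr := inbox1_obox z1.
  have am : an 2 (mode s n n) by exact: an_mode.
  rewrite (evD_an r2) //; [|exact: anZ].
  rewrite (evZ_an _ r2) // big_ord_recr /=.
  have [_ H _] := HD s z s1 z1; have H' := ev_e z z1.
  set G := ev (primitive_array s) _ in H H' *; set S := \sum_(i < n) _ in H' *.
  have -> : ev e z + a n * ev (mode s n n) z - (S + a n * (z.1 * z.2) ^+ n) * G =
    (ev e z - S * G) + a n * (ev (mode s n n) z - z.1 ^+ n * z.2 ^+ n * G) by rewrite exprMn; ring.
  apply: le_trans (ler_normD _ _) _; rewrite mulrDl; apply: lerD => //.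
  by rewrite normrM -(mulrA _ D) ler_wpM2l.
Qed.

Lemma linear_solution J (eta : R) : 0 < eta -> exists s e,
  [/\ 1 <= s, 2 ^+ J.+1 <= s, forall r, an r e, lap e = s ^+ 2 *: mixed e &
   forall z, inbox 1 z -> `|ev e z - profile J (z.1 * z.2) * ev (primitive_array s) (0, z.2)| <= eta].
Proof.
move=> eta0; pose p : {poly R} := \sum_(j < J) height R j *: (1 - 'X^2) ^+ (16 ^ j).
have pE t : profile J t = \sum_(k < size p) p`_k * t ^+ k.
  rewrite -horner_coef /p horner_sum; apply: eq_bigr => j _.
  by rewrite /bump !hornerE.
have [C C0 HC] := polynomial_solution (fun k => p`_k) (size p).
(* The first bound makes the layer around y = 0 thinner than every cell; the second makes the error
   C / s at most eta. *)
pose s := Num.max (2 ^+ J.+1) (C / eta).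
have sJ : 2 ^+ J.+1 <= s by rewrite le_max lexx.
have s1 : 1 <= s by apply: le_trans sJ; rewrite exprn_ege1 //; lra.
have [e [e1 e2 e3]] := HC s s1.
exists s, e; split=> // z z1; rewrite pE; apply: le_trans (e3 z z1) _.
rewrite ler_pdivrMr; last by lra.
by rewrite mulrC -ler_pdivrMr // le_max lexx orbT.
Qed.

End Construction.

(** * Steady flows whose vorticity is close to the profile *)

Section SteadyFlow.
Variable R : realType.
Implicit Types (c e h om : array R) (z : R * R).

Definition saddle : array R := mX (mY (unit_array R)).

Lemma dX_saddle : dX saddle = mY (unit_array R).
Proof.
apply/funext => i; apply/funext => -[|j]; rewrite /dX /saddle /=; first by rewrite mulr0.
by rewrite /unit_array; case: i => [|i] /=; rewrite ?mul1r ?mulr0.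
Qed.

Lemma dY_saddle : dY saddle = mX (unit_array R).
Proof.
apply/funext => -[|i]; apply/funext => j; rewrite /dY /saddle /=; first by rewrite mulr0.
by rewrite /unit_array; case: j => [|j] /=; rewrite ?mul1r ?andbF ?mulr0.
Qed.

Lemma lap_saddle : lap saddle = (fun _ _ => 0).
Proof.
rewrite lapE dX_saddle dY_saddle; apply/funext => i; apply/funext => j.
rewrite -[LHS]/(i.+1%:R * mY (unit_array R) i.+1 j + j.+1%:R * mX (unit_array R) i j.+1).
by case: i j => [|i] [|j] /=; rewrite /unit_array /= ?andbF ?mulr0 addr0.
Qed.

Lemma mixedD c d : mixed (c + d) = mixed c + mixed d.
Proof.
apply/funext => i; apply/funext => j.
exact: (mulrDr (i%:R - j%:R) (c i j) (d i j)).
Qed.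

Lemma mixedZ k c : mixed (k *: c) = k *: mixed c.
Proof.
apply/funext => i; apply/funext => j.
exact: (mulrCA (i%:R - j%:R) k (c i j)).
Qed.

Definition stream (a : R) om : array R := a *: saddle + ilap om.

Lemma an_saddle r : an r saddle.
Proof. by apply: an_mX; apply: an_mY; exact: an_unit_array. Qed.

Lemma an_stream r a om : an r om -> an r (stream a om).
Proof. by move=> omr; apply: anD; [apply: anZ; exact: an_saddle|exact: an_ilap]. Qed.

Lemma lap_stream a om : lap (stream a om) = om.
Proof.
rewrite lapD lapZ lap_saddle ilapK; apply/funext => i; apply/funext => j.
by rewrite -[LHS]/(a * 0 + om i j) mulr0 add0r.
Qed.

(** The strain in [stream] produces the term with [mixed om], and [ilap om] produces [nonlin om]. *)
Lemma stream_vorticity_equation r a om z : 1 < r -> an r om ->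
  lap om = a *: mixed om + nonlin om -> obox r z ->
  ev (lap om) z = ev (dY (stream a om)) z * ev (dX om) z - ev (dX (stream a om)) z * ev (dY om) z.
Proof.
move=> r1 omr -> rz; have Lr := an_ilap omr.
have ur := @an_unit_array R r.
have dXr := an_dX omr; have dYr := an_dY omr.
have mr : an r (mixed om) by rewrite mixedE; apply: anB; [exact: an_mX|exact: an_mY].
have nr : an r (nonlin om).
  by apply: anB; apply: an_conv => //; [exact: an_dY|exact: an_dX].
rewrite /stream dXD dYD dXZ dYZ dX_saddle dY_saddle.
rewrite (evD_an r1 (anZ a mr) nr rz) (evZ_an a r1 mr rz).
rewrite mixedE (evB_an r1 (an_mX dXr) (an_mY dYr) rz) (ev_mX_an r1 dXr rz) (ev_mY_an r1 dYr rz).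
rewrite (evB_an r1 (an_conv (an_dY Lr) dXr) (an_conv (an_dX Lr) dYr) rz).
rewrite (ev_conv_an r1 (an_dY Lr) dXr rz) (ev_conv_an r1 (an_dX Lr) dYr rz).
rewrite (evD_an r1 (anZ a (an_mX ur)) (an_dY Lr) rz) (evD_an r1 (anZ a (an_mY ur)) (an_dX Lr) rz).
rewrite (evZ_an a r1 (an_mX ur) rz) (evZ_an a r1 (an_mY ur) rz).
rewrite (ev_mX_an r1 ur rz) (ev_mY_an r1 ur rz) ev_unit_array.
ring.
Qed.

(** Half of the error is allotted to e and half to h. The linear solution e, and with it a = s^2, is
    fixed before eps. *)
Lemma steady_vorticity J (eta : R) : 0 < eta -> exists (a s eps : R) om,
  [/\ 1 <= s, 2 ^+ J.+1 <= s, 0 < eps & an 2 om] /\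
  [/\ lap om = a *: mixed om + nonlin om &
   forall z, inbox 1 z ->
     `|ev om z - eps * (profile J (z.1 * z.2) * ev (primitive_array s) (0, z.2))| <= eta * eps].
Proof.
move=> eta0; have e20 : 0 < eta / 2 by lra.
have [s [e [s1 sJ an_e lap_e ev_e]]] := linear_solution J e20.
have s2 : 1 <= s ^+ 2 by rewrite exprn_ege1.
have e2 : absconv 2 e by apply: (an_e 4); lra.
have [eps e0 H] := nonlinear_correction s2 e20 e2.
have [h [hE h2 ev_h]] := H eps e0 (lexx _).
have an_h : an 2 h by move=> t t0 t2; apply: absconv_le (ltW t0) (ltW t2) h2.
exists (s ^+ 2), s, eps, (eps *: e + h); split; split=> //.
- by apply: anD => //; apply: anZ.
- rewrite lapD lapZ lap_e -{1}hE ilapK mixedD mixedZ scalerDr addrA !scalerA.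
  by rewrite (mulrC eps).
- move=> z z1; have zr := inbox1_obox z1; have r1 : 1 < 2 :> R by lra.
  rewrite (evD_an r1 (anZ eps (an_e 2)) an_h zr) (evZ_an eps r1 (an_e 2) zr).
  have H1 := ev_e z z1; have H2 := ev_h z z1.
  set P := profile _ _ * _ in H1 *.
  have -> : eps * ev e z + ev h z - eps * P = eps * (ev e z - P) + ev h z by ring.
  apply: le_trans (ler_normD _ _) _; rewrite normrM gtr0_norm //.
  have := ler_wpM2l (ltW e0) H1; lra.
Qed.

End SteadyFlow.

(** * The moment from below and the L2 norm from above *)

Section Estimates.
Variable R : realType.
Local Notation plane := (measurableTypeR R * measurableTypeR R)%type.
Local Notation mu := (@lebesgue_measure R).
Local Notation B1 := (@unit_disc R).
Local Notation nu := (@leb2 R).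
Local Notation mfun D f := (measurable_fun (D : set plane) (f : plane -> R)).
Implicit Types (z : R * R) (c om : array R).

Lemma harmonic_sum_ge1 J : 1 <= harmonic_sum R J.+1.
Proof.
by rewrite /harmonic_sum big_ord_recl /= invr1 lerDl sumr_ge0.
Qed.

Lemma unit_disc_inbox1 z : B1 z -> inbox 1 z.
Proof. by move=> /unit_disc_abs [/ltW z1 /ltW z2]; split. Qed.

Lemma unit_disc_obox2 : B1 `<=` obox 2.
Proof. by move=> z /unit_disc_inbox1; exact: inbox1_obox. Qed.

Lemma ev_bounded c : an 2 c -> exists2 C, 0 <= C & forall z, B1 z -> `|ev c z| <= C.
Proof.
move=> cr; have [B cB] : absconv 1 c by apply: cr; lra.
exists B; first by have := cB 0%N; rewrite /series /= big_nil.
by move=> z /unit_disc_inbox1 z1; exact: ev_le z1 cB.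
Qed.

Lemma vorticity_estimates J : exists (a eps : R) om,
  [/\ an 2 om, lap om = a *: mixed om + nonlin om, 0 < eps,
   eps * (harmonic_sum R J.+1 / 128) <= \int[nu]_(z in B1) (ev om z * z.2 * (sqn z)^-1) &
   (\int[nu]_(z in B1) (ev om z ^+ 2)%:E <=
     (eps ^+ 2 * ((128 * pi ^+ 2 + 8) * harmonic_sum R J.+1))%:E)%E].
Proof.
have mB := @measurable_unit_disc R; have r1 : 1 < 2 :> R by lra.
(* The remainder changes the moment by at most 16 eta eps = eps / 128, which is at most half of the
   main part eps S / 64 because S >= 1. *)
pose eta : R := 1 / 2048; have eta0 : 0 < eta by rewrite /eta; lra.
have [a [s [eps [om [[s1 sJ e0 omr] [lap_om ev_om]]]]]] := steady_vorticity J.+1 eta0.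
exists a, eps, om; set S := harmonic_sum R J.+1.
have S1 : 1 <= S := harmonic_sum_ge1 J.
pose G (y : R) := ev (primitive_array s) (0, y).
have Gp (y : R) : `|y| < 1 -> `|G y| <= pi by move=> y1; apply: Gam_bound => //; lra.
have mG : mfun B1 (fun z => G z.2).
  rewrite (_ : (fun z => _) = ev (primitive_array s)).
    by apply: (mfun_ev (an_primitive_array s (r := 2)) r1); exact: unit_disc_obox2.
  by apply/funext => z; rewrite [RHS]ev_only_y // => i j; rewrite /primitive_array /= mul0r.
have mF := @profile_mfun R J.+1.
have mo : mfun B1 (ev om) by apply: (mfun_ev omr r1); exact: unit_disc_obox2.
pose r z := ev om z - eps * (profile J.+1 (z.1 * z.2) * G z.2).
have mr : mfun B1 r by apply: mfunB => //; apply: mfunM => //; exact: mfunM.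
have rb z : B1 z -> `|r z| <= eta * eps by move=> /unit_disc_inbox1; exact: ev_om.
have Fp z : B1 z -> 0 <= profile J.+1 (z.1 * z.2) <= height_sum R J.+1.
  by move=> Bz; rewrite profile_ge0 ?profile_le //; exact: unit_disc_prod.
split=> //.
- have ik : mfun B1 (fun z => (sqn z)^-1) by apply: mfunV; exact: mfun_sqn.
  have my : mfun B1 (fun z => z.2) by exact: mfun_snd.
  pose f1 z := profile J.+1 (z.1 * z.2) * G z.2 * z.2 * (sqn z)^-1.
  pose f2 z := r z * z.2 * (sqn z)^-1.
  have m1 : mfun B1 f1 by do 3 apply: mfunM => //.
  have m2 : mfun B1 f2 by do 2 apply: mfunM => //.
  have b2 z : B1 z -> `|f2 z| <= eta * eps / enorm z.
    by move=> /rb rz; exact: kernel_bound (normr_snd_enorm z).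
  have i1 : nu.-integrable B1 (EFin \o f1).
    apply: (@integrable_inv_enorm _ f1 (height_sum R J.+1 * pi)) => // z Bz.
    apply: kernel_bound (normr_snd_enorm z); have /andP[F0 F1] := Fp z Bz.
    have [_ /Gp Gz] := unit_disc_abs Bz.
    by rewrite normrM (ger0_norm F0) ler_pM.
  have i2 := integrable_inv_enorm m2 b2.
  rewrite (_ : \int[nu]_(z in B1) _ = \int[nu]_(z in B1) (eps * f1 z + f2 z)); last first.
    by apply: eq_Rintegral => z _; rewrite /f1 /f2 /r; ring.
  have i1' : nu.-integrable B1 (EFin \o (fun z => eps * f1 z)).
    rewrite (_ : _ \o _ = (fun z => eps%:E * (f1 z)%:E)%E); last exact/funext.
    exact: integrableZl.
  rewrite RintegralD //.
  rewrite RintegralZl //.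
  have h0 : 0 <= eta * eps by rewrite mulr_ge0 ?ltW.
  have := Rintegral_inv_enorm_le h0 m2 b2; rewrite ler_norml => /andP[lo _].
  have low := @integral_profile_lower R J.+1 G pi (pi_ge0 R) mG.
  have low1 : S / 64 <= \int[nu]_(z in B1) f1 z.
    apply: low => //.
    + by move=> y y1; apply: Gam_mul_ge0 => //; lra.
    + have p0 : 0 < 2 ^+ J.+2 :> R by rewrite exprn_gt0.
      move=> y yl y1; have y0 : 0 < y by apply: lt_le_trans yl; rewrite invr_gt0.
      apply: Gam_lower => //; first by rewrite ger0_norm; lra.
      have s0 : 0 < s by lra.
      by rewrite -(ler_pdivrMl _ _ s0) mulr1; apply: le_trans yl; rewrite lef_pV2 ?posrE.
  have := ler_wpM2l (ltW e0) low1; have := ler_wpM2l (ltW e0) S1.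
  rewrite /eta in lo *; lra.
(* From (P + r)^2 <= 2 P^2 + 2 r^2 with |G| <= pi and |r| <= eps; the constant part 2 eps^2 over an
   area of at most 4 becomes 8 eps^2 S, as S >= 1. *)
- apply: (@le_trans _ _ (\int[nu]_(z in B1)
    ((2 * pi ^+ 2 * eps ^+ 2)%:E * (profile J.+1 (z.1 * z.2) ^+ 2)%:E + (2 * eps ^+ 2)%:E))%E).
    apply: ge0_le_integral => //.
    + by move=> z _; rewrite lee_fin sqr_ge0.
    + by apply/measurable_EFinP; exact: mfunX.
    + by apply/measurable_EFinP; apply: mfunD => //; apply: mfunM => //; exact: mfunX.
    + move=> z Bz; rewrite -EFinM -EFinD lee_fin.
      have /andP[F0 F1] := Fp z Bz; have rz := rb z Bz.
      have [_ /Gp Gz] := unit_disc_abs Bz.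
      have -> : ev om z = eps * (profile J.+1 (z.1 * z.2) * G z.2) + r z by rewrite /r; ring.
      have P2 : (profile J.+1 (z.1 * z.2) * G z.2) ^+ 2 <= pi ^+ 2 * profile J.+1 (z.1 * z.2) ^+ 2.
        rewrite exprMn mulrC ler_wpM2r ?sqr_ge0 // -(real_normK (num_real (G _))).
        by rewrite lerXn2r ?nnegrE ?pi_ge0.
      have R2 : r z ^+ 2 <= eps ^+ 2.
        rewrite -(real_normK (num_real (r z))) lerXn2r ?nnegrE ?(ltW e0) //.
        by apply: le_trans rz _; rewrite /eta; lra.
      have := ler_wpM2l (sqr_ge0 eps) P2.
      have := sqr_ge0 (eps * (profile J.+1 (z.1 * z.2) * G z.2) - r z).
      move: (profile _ _ * G _) (profile _ _ ^+ 2) P2 R2 => P Q P2 R2.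
      lra.
  have c0 : 0 <= 2 * pi ^+ 2 * eps ^+ 2.
    have := mulr_ge0 (sqr_ge0 (pi : R)) (sqr_ge0 eps); lra.
  have c1 : 0 <= 2 * eps ^+ 2 by have := sqr_ge0 eps; lra.
  have mF2 : measurable_fun B1 (fun z => (profile J.+1 (z.1 * z.2) ^+ 2)%:E).
    by apply/measurable_EFinP; exact: mfunX.
  have F20 z : B1 z -> (0 <= (profile J.+1 (z.1 * z.2) ^+ 2)%:E)%E.
    by rewrite lee_fin sqr_ge0.
  rewrite ge0_integralD //; last 2 first.
  + by move=> z Bz; rewrite mule_ge0 ?F20 // lee_fin.
  + by apply: emeasurable_funM.
  rewrite ge0_integralZl ?lee_fin // integral_cst //.
  move: c0 c1; rewrite -2!lee_fin => c0 c1.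
  apply: le_trans (leeD (lee_wpmul2l c0 (integral_profile_sqr R J.+1))
    (lee_wpmul2l c1 (leb2_unit_disc R))) _.
  rewrite -!EFinM -EFinD lee_fin -/S.
  have := ler_wpM2l (sqr_ge0 eps) S1; lra.
Qed.

End Estimates.

(** * The mean value identity for divergence-free fields *)

Section MeanField.
Variable R : realType.
Local Notation plane := (measurableTypeR R * measurableTypeR R)%type.
Local Notation mu := (@lebesgue_measure R).
Local Notation B1 := (@unit_disc R).
Local Notation nu := (@leb2 R).
Implicit Types (z : R * R) (W : array R).

(** Subtracting the value at the origin provides the vanishing that [radial_mean] requires, and the
    mean becomes the difference of the two means. *)
Definition center W : array R := W - W 0%N 0%N *: unit_array R.

Lemma center0 W : center W 0%N 0%N = 0.
Proof.
by rewrite -[LHS]/(W 0%N 0%N - W 0%N 0%N * unit_array R 0%N 0%N) mulr1 subrr.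
Qed.

Lemma an_center r W : an r W -> an r (center W).
Proof. by move=> aW; apply: anB => //; apply: anZ; exact: an_unit_array. Qed.

Lemma ev_center W z : an 2 W -> obox 2 z -> ev (center W) z = ev W z - ev W (0, 0).
Proof.
move=> aW z2; have r1 : 1 < 2 :> R by lra.
have au := @an_unit_array R 2.
by rewrite (evB_an r1 aW (anZ _ au) z2) (evZ_an _ r1 au z2) ev_unit_array mulr1 ev0.
Qed.

Lemma dX_unit_array : dX (unit_array R) = (fun _ _ => 0).
Proof. by apply/funext => i; apply/funext => j; rewrite /dX /unit_array /= mulr0. Qed.

Lemma dY_unit_array : dY (unit_array R) = (fun _ _ => 0).
Proof. by apply/funext => i; apply/funext => j; rewrite /dY /unit_array /= andbF mulr0. Qed.

Lemma dX_center W : dX (center W) = dX W.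
Proof.
rewrite dXB dXZ dX_unit_array; apply/funext => i; apply/funext => j.
by rewrite -[LHS]/(dX W i j - W 0%N 0%N * 0) mulr0 subr0.
Qed.

Lemma dY_center W : dY (center W) = dY W.
Proof.
rewrite dYB dYZ dY_unit_array; apply/funext => i; apply/funext => j.
by rewrite -[LHS]/(dY W i j - W 0%N 0%N * 0) mulr0 subr0.
Qed.

Lemma circle_obox2 (t : R) : obox 2 ((cos t, sin t) : R * R).
Proof. by apply: sqn_le1_obox; rewrite sqn_circle. Qed.

Lemma ev_comp_continuous W (p : R -> R * R) (t : R) : an 2 W -> obox 2 (p t) ->
  p t' @[t' --> t] --> p t -> {for t, continuous (fun t : R => ev W (p t))}.
Proof.
move=> aW pt cp; have r1 : 1 < 2 :> R by lra.
exact: (cvg_comp _ _ cp (continuous_ev r1 aW pt)).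
Qed.

Lemma circle_ev_continuous W : an 2 W -> continuous (fun t : R => ev W (cos t, sin t)).
Proof.
move=> aW t; apply: (@ev_comp_continuous W (fun t => (cos t, sin t))) => //.
  exact: circle_obox2.
exact: circle_pt_continuous.
Qed.

Lemma circle_mean_ev W : an 2 W ->
  circle_mean 1 (ev W) - ev W (0, 0) =
  (2 * pi)^-1 * \int[mu]_(t in `[0, 2 * pi]) ev (center W) (cos t, sin t).
Proof.
move=> aW; rewrite /circle_mean mulr1.
have p0 : 0 < pi :> R by exact: pi_gt0.
under eq_Rintegral do rewrite /circle_pt !mul1r mulr1.
under [in RHS]eq_Rintegral => t _ do rewrite (ev_center aW (circle_obox2 t)).
rewrite RintegralB //; last 2 first.
- exact: itv_continuous_integrable (circle_ev_continuous aW).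
- by apply: itv_continuous_integrable; exact: cst_continuous.
have mE : mu (`[0, 2 * pi]%classic : set R) = (2 * pi)%:E.
  by rewrite lebesgue_measure_itv /= lte_fin mulr_gt0 // oppr0 addr0.
rewrite Rintegral_cst // [X in fine X]mE /=.
by rewrite mulrBr (mulrCA _ (ev W (0, 0))) mulVf ?mulr1 // gt_eqF // mulr_gt0.
Qed.

Variables W1 W2 : array R.
Hypotheses (a1 : an 2 W1) (a2 : an 2 W2).
Hypothesis divergence_free : dX W1 + dY W2 = 0.

Local Notation w := (fun z => (ev W1 z, ev W2 z)).

Let vortE z : obox 2 z -> vorticity w z = ev (dY W1) z - ev (dX W2) z.
Proof.
move=> z2; have r1 : 1 < 2 :> R by lra.
by rewrite /vorticity (dy_ev r1 a1 z2) (dx_ev r1 a2 z2).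
Qed.

Let divE z : obox 2 z -> ev (dX W1) z = - ev (dY W2) z.
Proof.
move=> z2; have r1 : 1 < 2 :> R by lra.
apply/eqP; rewrite -addr_eq0 -(evD_an r1 (an_dX a1) (an_dY a2) z2) divergence_free.
by rewrite ev_zero.
Qed.

Lemma moment_integrable (k : R * R -> R) : measurable_fun (B1 : set plane) (k : plane -> R) ->
  (forall z, `|k z| <= enorm z) ->
  nu.-integrable B1 (EFin \o (fun z => vorticity w z * k z / enorm z ^+ 2)).
Proof.
move=> mk kz; have r1 : 1 < 2 :> R by lra.
have [C1 C10 b1] := ev_bounded (an_dY a1); have [C2 C20 b2] := ev_bounded (an_dX a2).
have mB := @measurable_unit_disc R.
pose f z := (ev (dY W1) z - ev (dX W2) z) * k z * (sqn z)^-1.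
have fi : nu.-integrable B1 (EFin \o f).
  apply: (@integrable_inv_enorm _ f (C1 + C2)) => [|z Bz].
    apply: mfunM; last by apply: mfunV; exact: mfun_sqn.
    apply: mfunM => //; apply: mfunB; apply: mfun_ev r1 (@unit_disc_obox2 R).
      exact: an_dY.
    exact: an_dX.
  apply: kernel_bound => //; apply: le_trans (ler_normB _ _) _.
  exact: lerD (b1 z Bz) (b2 z Bz).
apply: (eq_integrable mB _ _ _ fi) => z; rewrite inE => Bz.
by rewrite /= sqr_enorm vortE //; exact: unit_disc_obox2.
Qed.

(** [radial_mean] is used for (A, B) = (w_1, w_2) and for (w_2, - w_1), centred. The integrands are
    x div w + y omega and y div w - x omega, over |z|^2, and div w = 0. *)
Lemma mean_field_moment :
  mean_field w w 1 - mean_field w w 0 = - ((2 * pi)^-1 *: vorticity_moment w).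
Proof.
(* At r = 1 the definition takes the branch of the trace, here w itself. *)
rewrite /mean_field eqxx oner_eq0 ltxx.
rewrite -[LHS]/(circle_mean 1 (ev W1) - ev W1 (0, 0), circle_mean 1 (ev W2) - ev W2 (0, 0)).
rewrite !circle_mean_ev //.
have c1 := an_center a1; have c2 := an_center a2.
have c1N := anN c1; have c01 := center0 W1; have c02 := center0 W2.
have c01N : (- center W1) 0%N 0%N = 0 by rewrite -[LHS]/(- center W1 0%N 0%N) c01 oppr0.
rewrite -(radial_mean c1 c2 c01 c02) -(radial_mean c2 c1N c02 c01N).
rewrite -[RHS]/(- ((2 * pi)^-1 * (vorticity_moment w).1), - ((2 * pi)^-1 * (vorticity_moment w).2)).
have mB := @measurable_unit_disc R.
rewrite -!mulrN /vorticity_moment /=.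
congr (_ * _, _ * _).
- rewrite -mulN1r -RintegralZl //; last first.
    apply: (@moment_integrable (fun z => - z.2)); first by apply: mfunN; exact: mfun_snd.
    by move=> z; rewrite normrN normr_snd_enorm.
  apply: eq_Rintegral => z; rewrite inE => /unit_disc_obox2 z2.
  rewrite !dX_center !dY_center vortE // divE // sqr_enorm.
  ring.
- rewrite -mulN1r -RintegralZl //; last first.
    by apply: (@moment_integrable (fun z => z.1)); [exact: mfun_fst|exact: normr_fst_enorm].
  apply: eq_Rintegral => z; rewrite inE => /unit_disc_obox2 z2.
  have r1 : 1 < 2 :> R by lra.
  rewrite dXN dYN (evN_an r1 (an_dX c1) z2) (evN_an r1 (an_dY c1) z2).
  rewrite !dX_center !dY_center vortE // divE // sqr_enorm.
  ring.
Qed.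

Lemma mean_field_enorm :
  enorm (mean_field w w 1 - mean_field w w 0) = (2 * pi)^-1 * enorm (vorticity_moment w).
Proof.
have p0 : 0 < pi :> R by exact: pi_gt0.
have c0 : 0 <= (2 * pi : R)^-1 by rewrite invr_ge0 mulr_ge0 // ltW.
rewrite mean_field_moment /enorm /= !sqrrN !exprMn -mulrDr sqrtrM ?sqr_ge0 //.
by rewrite sqrtr_sqr ger0_norm.
Qed.

End MeanField.

(** * Traces, Dirichlet integrals and L2 norms of analytic fields *)

Section FlowFunctionals.
Variable R : realType.
Local Notation plane := (measurableTypeR R * measurableTypeR R)%type.
Local Notation mu := (@lebesgue_measure R).
Local Notation B1 := (@unit_disc R).
Local Notation nu := (@leb2 R).
Local Notation mfun D f := (measurable_fun (D : set plane) (f : plane -> R)).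
Implicit Types (z : R * R) (W : array R).

Lemma trace_ev W : an 2 W -> is_trace (ev W) (ev W).
Proof.
move=> aW; have r1 : 1 < 2 :> R by lra.
split.
  apply: measurable_funTS; apply: continuous_measurable_fun.
  rewrite (_ : (fun t : R => _) = fun t : R => ev W (cos t, sin t)).
    exact: circle_ev_continuous.
  by apply/funext => t; rewrite /circle_pt !mul1r.
exists (fun _ => ev W); split.
- move=> _; exists (obox 2); split; first exact: open_obox.
    move=> z /= z1; apply: sqn_le1_obox; rewrite -sqr_enorm.
    by rewrite exprn_ile1 ?sqrtr_ge0.
  exact: smooth_ev.
- rewrite (_ : (fun _ => _) = cst 0%E); first exact: cvg_cst.
  apply/funext => n; rewrite /H1_sqnorm.
  rewrite (_ : (fun z => ev W z - ev W z) = cst 0); last first.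
    by apply/funext => z; rewrite subrr.
  apply: integral0_eq => z _.
  by rewrite /dx /dy !derive_cst /= subrr expr0n /= !addr0.
- rewrite (_ : (fun _ => _) = cst 0%E); first exact: cvg_cst.
  by apply/funext => n; apply: integral0_eq => t _; rewrite subrr expr0n.
Qed.

Lemma bounded_integral_lty (f : R * R -> R) (C : R) : mfun B1 f ->
  (forall z, B1 z -> 0 <= f z <= C) -> (\int[nu]_(z in B1) (f z)%:E < +oo)%E.
Proof.
move=> mf fC; have mB := @measurable_unit_disc R.
apply: (@le_lt_trans _ _ (\int[nu]_(z in B1) (cst C%:E z))%E).
  apply: ge0_le_integral => //.
  - by move=> z /fC /andP[]; rewrite lee_fin.
  - exact/measurable_EFinP.
  - by move=> z /fC /andP[_]; rewrite lee_fin.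
rewrite integral_cst //.
apply: (@le_lt_trans _ _ (`|C|%:E * 4%:E)%E); last by rewrite -EFinM ltry.
apply: (@le_trans _ _ (`|C|%:E * nu B1)%E).
  by rewrite lee_wpmul2r // lee_fin ler_norm.
by rewrite lee_wpmul2l ?leb2_unit_disc // lee_fin.
Qed.

Lemma dirichlet_ev W1 W2 : an 2 W1 -> an 2 W2 ->
  (dirichlet B1 (fun z => (ev W1 z, ev W2 z)) < +oo)%E.
Proof.
move=> a1 a2; have r1 : 1 < 2 :> R by lra.
pose q z := ev (dX W1) z ^+ 2 + ev (dY W1) z ^+ 2 + ev (dX W2) z ^+ 2 + ev (dY W2) z ^+ 2.
rewrite (_ : dirichlet _ _ = \int[nu]_(z in B1) (q z)%:E)%E; last first.
  apply: eq_integral => z; rewrite inE => /unit_disc_obox2 z2.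
  by rewrite /q -(dx_ev r1 a1 z2) -(dy_ev r1 a1 z2) -(dx_ev r1 a2 z2) -(dy_ev r1 a2 z2).
have me W : an 2 W -> mfun B1 (ev W) by move=> aW; exact: mfun_ev aW r1 (@unit_disc_obox2 R).
have [C1 C10 b1] := ev_bounded (an_dX a1); have [C2 C20 b2] := ev_bounded (an_dY a1).
have [C3 C30 b3] := ev_bounded (an_dX a2); have [C4 C40 b4] := ev_bounded (an_dY a2).
apply: (@bounded_integral_lty _ (C1 ^+ 2 + C2 ^+ 2 + C3 ^+ 2 + C4 ^+ 2)) => [|z Bz].
  do 3 (apply: mfunD; last by apply: mfunX; apply: me; (exact: an_dX || exact: an_dY)).
  by apply: mfunX; apply: me; exact: an_dX.
have sq (x C : R) : 0 <= C -> `|x| <= C -> x ^+ 2 <= C ^+ 2.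
  by move=> C0 xC; rewrite -(real_normK (num_real x)) lerXn2r ?nnegrE.
have H1 := sq _ _ C10 (b1 z Bz); have H2 := sq _ _ C20 (b2 z Bz).
have H3 := sq _ _ C30 (b3 z Bz); have H4 := sq _ _ C40 (b4 z Bz).
apply/andP; split; last exact: lerD (lerD (lerD H1 H2) H3) H4.
by do 3 (apply: addr_ge0; last exact: sqr_ge0); exact: sqr_ge0.
Qed.

Lemma L2_normE (f : R * R -> R) : (\int[nu]_(z in B1) (f z ^+ 2)%:E < +oo)%E ->
  L2_norm B1 f = Num.sqrt (\int[nu]_(z in B1) (f z ^+ 2)).
Proof.
move=> foo; rewrite /L2_norm unlock /Lnorm /Rintegral.
have E : (\int[nu]_z (`|(EFin \o (f \_ B1)) z| `^ 2))%E = (\int[nu]_(z in B1) (f z ^+ 2)%:E)%E.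
  rewrite [RHS]integral_mkcond; apply: eq_integral => z _.
  rewrite /= /patch; case: ifPn => _.
    by rewrite (powR_mulrn 2) // real_normK ?num_real.
  by rewrite normr0 powR0.
rewrite E.
have f0 : (0 <= \int[nu]_(z in B1) (f z ^+ 2)%:E)%E.
  by apply: integral_ge0 => z _; rewrite lee_fin sqr_ge0.
rewrite -{1}(@fineK _ (\int[nu]_(z in B1) (f z ^+ 2)%:E)%E) ?ge0_fin_numE //.
by rewrite poweR_EFin /= powR12_sqrt // fine_ge0.
Qed.

(** Serves to exclude a vanishing vorticity: its moment would be zero, against the lower bound. *)
Lemma moment_eq0 (f k : R * R -> R) : mfun B1 f -> mfun B1 k ->
  (\int[nu]_(z in B1) (f z ^+ 2)%:E)%E = 0%E -> \int[nu]_(z in B1) (f z * k z) = 0.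
Proof.
move=> mf mk f0; have mB := @measurable_unit_disc R.
have a0 : ae_eq nu B1 (fun z => (f z ^+ 2)%:E) (cst 0%E).
  apply/ae_eq_integral_abs => //; first by apply/measurable_EFinP; exact: mfunX.
  by rewrite -f0; apply: eq_integral => z _; rewrite gee0_abs // lee_fin sqr_ge0.
rewrite /Rintegral (_ : (\int[nu]_(z in B1) (f z * k z)%:E)%E = 0%E) //.
rewrite -[RHS](integral0 nu B1); apply: ae_eq_integral => //.
  by apply/measurable_EFinP; exact: mfunM.
apply: filterS a0 => z H Bz; move: (H Bz) => /= /eqP.
by rewrite eqe expf_eq0 /= => /eqP ->; rewrite mul0r.
Qed.

End FlowFunctionals.

(** * Flows whose ratio exceeds a given bound *)

Section LargeRatio.
Variable R : realType.
Local Notation plane := (measurableTypeR R * measurableTypeR R)%type.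
Local Notation B1 := (@unit_disc R).
Local Notation nu := (@leb2 R).
Local Notation mfun D f := (measurable_fun (D : set plane) (f : plane -> R)).
Implicit Types (z : R * R).

Lemma harmonic_sum_unbounded (M : R) : exists J, M <= harmonic_sum R J.+1.
Proof.
have /cvgryPge/(_ M)[n _ H] : series (@harmonic R) @ \oo --> +oo.
  apply: nondecreasing_dvgn_lt; last exact: dvg_harmonic.
  apply/nondecreasing_seqP => n; rewrite /series /= big_nat_recr //= lerDl.
  by rewrite invr_ge0.
exists n; have := H n.+1 (leqnSn n).
by rewrite /series /= big_mkord.
Qed.

Lemma large_ratio_flow (M : R) : 0 <= M -> exists (w : R * R -> R * R) (p : R * R -> R),
  [/\ D_solution B1 w p, exists2 z, B1 z & vorticity w z != 0, is_vtrace w w,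
      enorm (mean_field w w 1 - mean_field w w 0) = (2 * pi)^-1 * enorm (vorticity_moment w) &
      M <= enorm (mean_field w w 1 - mean_field w w 0) / L2_norm B1 (vorticity w)].
Proof.
move=> M0; have r1 : 1 < 2 :> R by lra.
have mB := @measurable_unit_disc R.
have p0 : 0 < pi :> R by exact: pi_gt0.
pose K : R := 128 * pi ^+ 2 + 8.
have K0 : 0 < K by rewrite /K; have := sqr_ge0 (pi : R); lra.
(* The aim is 2 pi M sqrt I <= eps S / 128 with I <= eps^2 K S; after squaring it reads 4 pi^2 M^2 K
   128^2 <= S. *)
have [J HJ] := harmonic_sum_unbounded (4 * pi ^+ 2 * K * 128 ^+ 2 * M ^+ 2).
set S := harmonic_sum R J.+1 in HJ; have S1 : 1 <= S := harmonic_sum_ge1 R J.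
have [a [eps [om [aom lap_om e0 lower upper]]]] := vorticity_estimates R J.
pose psi := stream a om; have apsi : an 2 psi := an_stream a aom.
have veq z : obox 2 z -> ev (lap (lap psi)) z =
    ev (dY psi) z * ev (dX (lap psi)) z - ev (dX psi) z * ev (dY (lap psi)) z.
  by move=> z2; rewrite /psi lap_stream; exact: stream_vorticity_equation r1 aom lap_om z2.
pose w := stream_field psi.
have a1 : an 2 (dY psi) by exact: an_dY.
have a2 : an 2 (- dX psi) by apply: anN; exact: an_dX.
have div0 : dX (dY psi) + dY (- dX psi) = 0 by rewrite dXdY dYN addrN.
have vE z : B1 z -> vorticity w z = ev om z.
  by move=> /unit_disc_obox2 z2; rewrite (stream_vorticity r1 apsi z2) /psi lap_stream.
have E : enorm (mean_field w w 1 - mean_field w w 0) = (2 * pi)^-1 * enorm (vorticity_moment w).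
  exact: mean_field_enorm a1 a2 div0.
have mo : mfun B1 (ev om) by exact: mfun_ev aom r1 (@unit_disc_obox2 R).
have SK0 : 0 < eps * (S / 128) by rewrite mulr_gt0 // divr_gt0 //; lra.
have mom : eps * (S / 128) <= enorm (vorticity_moment w).
  (* Only the first component of the moment is used; its kernel is - y / |z|^2, hence the change of
     sign. *)
  apply: le_trans (normr_fst_enorm _); rewrite -normrN; apply: le_trans (ler_norm _).
  apply: le_trans lower _; rewrite le_eqVlt; apply/orP; left; apply/eqP.
  rewrite -mulN1r /vorticity_moment /= -RintegralZl //.
    by apply: eq_Rintegral => z; rewrite inE => /vE ->; rewrite sqr_enorm; ring.
  apply: (moment_integrable a1 a2 (k := fun z => - z.2)).
    by apply: mfunN; exact: mfun_snd.
  by move=> z; rewrite normrN normr_snd_enorm.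
have I2 : (\int[nu]_(z in B1) (vorticity w z ^+ 2)%:E = \int[nu]_(z in B1) (ev om z ^+ 2)%:E)%E.
  by apply: eq_integral => z; rewrite inE => /vE ->.
have Ioo : (\int[nu]_(z in B1) (vorticity w z ^+ 2)%:E < +oo)%E.
  by rewrite I2; apply: le_lt_trans upper _; rewrite ltry.
have I0 : (0 <= \int[nu]_(z in B1) (vorticity w z ^+ 2)%:E)%E.
  by apply: integral_ge0 => z _; rewrite lee_fin sqr_ge0.
pose I := \int[nu]_(z in B1) (vorticity w z ^+ 2).
have IE : (\int[nu]_(z in B1) (vorticity w z ^+ 2)%:E = I%:E)%E.
  by rewrite /I /Rintegral fineK // ge0_fin_numE.
have Ige0 : 0 <= I by rewrite -lee_fin -IE.
have Ile : I <= eps ^+ 2 * (K * S) by rewrite -lee_fin -IE I2.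
(* Since a quotient by 0 is 0, the norm must be shown positive before the ratio can be bounded
   below. *)
have Ipos : 0 < I.
  rewrite lt_neqAle Ige0 andbT eq_sym; apply/eqP => Iz.
  have : \int[nu]_(z in B1) (ev om z * (z.2 * (sqn z)^-1)) = 0.
    apply: moment_eq0 => //; last by rewrite -I2 IE Iz.
    by apply: mfunM; [exact: mfun_snd|apply: mfunV; exact: mfun_sqn].
  under eq_Rintegral do rewrite mulrA.
  by move=> m0; move: lower; rewrite m0 leNgt SK0.
have LE : L2_norm B1 (vorticity w) = Num.sqrt I by exact: L2_normE.
have [s1 s2 s3] := stream_smooth r1 apsi.
(* The pressure is the potential from [stream_smooth] and [stream_steady_NS], left to
   unification. *)
exists w; eexists; split.
- split; [split|..].
  + by move=> k; exact: Ck_sub (@unit_disc_obox2 R) (s1 k).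
  + by move=> k; exact: Ck_sub (@unit_disc_obox2 R) (s2 k).
  + by move=> k; exact: Ck_sub (@unit_disc_obox2 R) (s3 k).
  + by move=> z /unit_disc_obox2 z2; exact: (stream_steady_NS r1 apsi veq z2).
  + exact: dirichlet_ev a1 a2.
- apply: contrapT => H; suff : I = 0 by move=> Iz; rewrite Iz ltxx in Ipos.
  transitivity (\int[nu]_(z in B1) (0 : R)); last by rewrite Rintegral_cst // mul0r.
  apply: eq_Rintegral => z; rewrite inE => Bz.
  have [->|v0] := eqVneq (vorticity w z) 0; first by rewrite expr0n.
  by case: H; exists z.
- by split; exact: trace_ev.
- exact: E.
- rewrite E LE ler_pdivlMr ?sqrtr_gt0 // (mulrC _^-1) ler_pdivlMr ?mulr_gt0 //.
  apply: le_trans mom.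
  have q0 : 0 <= M * Num.sqrt I * (2 * pi).
    by rewrite !mulr_ge0 ?sqrtr_ge0 // ltW.
  rewrite -ler_sqr ?nnegrE ?(ltW SK0) // !exprMn sqr_sqrtr //.
  have h1 := ler_wpM2l (mulr_ge0 (sqr_ge0 M) (sqr_ge0 (pi : R))) Ile.
  have h2 := ler_wpM2l (mulr_ge0 (sqr_ge0 eps) (le_trans ler01 S1)) HJ.
  lra.
Qed.

End LargeRatio.

Theorem theorem8 (R : realType) :
  exists (w : nat -> R * R -> R * R) (p : nat -> R * R -> R)
         (g : nat -> R * R -> R * R),
    [/\ forall k, D_solution (@unit_disc R) (w k) (p k),
        forall k, exists2 z, unit_disc z & vorticity (w k) z != 0,
        forall k, is_vtrace (w k) (g k),
        forall k,
          enorm (mean_field (w k) (g k) 1 - mean_field (w k) (g k) 0)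
            / L2_norm (@unit_disc R) (vorticity (w k))
          = (2 * pi)^-1 * enorm (vorticity_moment (w k))
            / L2_norm (@unit_disc R) (vorticity (w k)) &
        (fun k =>
          enorm (mean_field (w k) (g k) 1 - mean_field (w k) (g k) 0)
            / L2_norm (@unit_disc R) (vorticity (w k)))
          @ \oo --> +oo].
Proof.
have [w Hw] := choice (fun k : nat => large_ratio_flow (ler0n R k)).
have [p Hp] := choice Hw.
exists w, p, w; split=> [k|k|k|k|].
- by have [] := Hp k.
- by have [] := Hp k.
- by have [] := Hp k.
- by have [_ _ _ -> _] := Hp k.
- apply: (@ger_cvgy _ _ _ _ (fun k : nat => k%:R)); last exact: cvgr_idn.
  by apply: nearW => k; have [] := Hp k.
Qed.
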